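(* Let $\phi\in\mathcal S_d$ with $\sup_\xi|\widehat\phi(\xi)|=1$ and suppose $\Omega(\phi)=\{\xi_0\}$, where $\xi_0$ is of positive homogeneous type or of imaginary homogeneous type for $\widehat\phi$, with drift $\alpha_{\xi_0}$ and homogeneous order $\mu_{\xi_0}=\mu_\phi$; in the imaginary case assume additionally $\mu_{\xi_0}<1$. (1) If $\xi_0$ is of positive homogeneous type, then $\phi^{(n)}(x)=\widehat\phi(\xi_0)^ne^{-ix\cdot\xi_0}H^n_{P_{\xi_0}}(x-n\alpha_{\xi_0})+o(n^{-\mu_\phi})$ uniformly for $x\in\mathbb{Z}^d$ as $n\to\infty$. (2) If $\xi_0$ is of imaginary homogeneous type, then for every compact $K\subseteq\mathbb{R}^d$ and every $E\in\mathrm{Exp}(Q_{\xi_0})$, $\phi^{(n)}(x)=\widehat\phi(\xi_0)^ne^{-ix\cdot\xi_0}H^n_{iQ_{\xi_0}}(x-n\alpha_{\xi_0})+o(n^{-\mu_\phi})$ uniformly for $x\in(n\alpha_{\xi_0}+n^{E^*}(K))\cap\mathbb{Z}^d$.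
   Context: Notation: $t^E:=\exp(\log(t)E)$; $E^*$ adjoint. $P$ homogeneous w.r.t. $E$: $P(t^E\xi)=tP(\xi)$; $\mathrm{Exp}(P)$ = set of such $E$. Positive homogeneous: real, continuous, positive definite ($\ge0$, zero only at $0$), $\mathrm{Exp}(P)\ne\emptyset$, $\{P=1\}$ compact; homogeneous order $\mu_P=\mathrm{tr}E$, $E\in\mathrm{Exp}(P)$. For $E$ with $\|t^E\|\to0$ as $t\to0$: subhomogeneous w.r.t. $E$ means for each $\epsilon>0$, compact $K$ there is $\tau>0$ with $|\widetilde P(t^E\xi)|\le\epsilon t$, $0<t<\tau$, $\xi\in K$; strongly subhomogeneous of order $l$: $C^l$ near $0$ and $|t^k\partial_t^k\widetilde P(t^E\xi)|\le\epsilon t$ for all $k\le l$. $\mathcal S_d$ = $\phi:\mathbb{Z}^d\to\mathbb{C}$ with $\sum_x|x^\beta\phi(x)|<\infty$ for all multi-indices $\beta$; $\widehat\phi(\xi)=\sum_x\phi(x)e^{ix\cdot\xi}$; $\phi^{(1)}=\phi$, $\phi^{(n)}(x)=\sum_y\phi^{(n-1)}(x-y)\phi(y)$; $\Omega(\phi)=\{\xi\in(-\pi,\pi]^d:|\widehat\phi(\xi)|=1\}$. For $\xi_0\in\Omega(\phi)$, $\Gamma_{\xi_0}(\xi)=\log(\widehat\phi(\xi+\xi_0)/\widehat\phi(\xi_0))$ (principal branch) on a convex neighborhood of $0$, written $i\alpha\cdot\xi-i(Q+\widetilde Q)-(R+\widetilde R)$ with $\alpha\in\mathbb{R}^d$,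 $Q,R$ real polynomials vanishing at $0$ without linear terms, $\widetilde Q,\widetilde R$ real smooth vanishing at $0$. Positive homogeneous type: such a decomposition with $R$ positive homogeneous and some $E\in\mathrm{Exp}(R)$ with $Q$ homogeneous w.r.t. $E$ and $\widetilde Q,\widetilde R$ subhomogeneous w.r.t. $E$; set $P_{\xi_0}=R+iQ$, $\mu_{\xi_0}=\mu_R$. Imaginary homogeneous type: $|Q|,R$ positive homogeneous, some $E\in\mathrm{Exp}(|Q|)$ and $k>1$ with $R$ homogeneous w.r.t. $E/k$, $\widetilde Q$ strongly subhomogeneous w.r.t. $E$ of order 2, $\widetilde R$ strongly subhomogeneous w.r.t. $E/k$ of order 1; $Q_{\xi_0}=Q$, $\mu_{\xi_0}=\mu_{|Q|}$. Drift $\alpha_{\xi_0}=\alpha$. $\mu_\phi=\min_{\xi\in\Omega(\phi)}\mu_\xi$. Attractors: $H^t_P(x)=(2\pi)^{-d}\int_{\mathbb{R}^d}e^{-tP(\xi)}e^{-ix\cdot\xi}d\xi$; for continuous real $Q$ with $|Q|$ positive homogeneous and $\mu_{|Q|}<1$, $H^t_{iQ}(x)=(2\pi)^{-d}\lim_{\tau\to\infty}\int_{\{|Q|<\tau\}}e^{-itQ(\xi)-ix\cdot\xi}d\xi$ (limit exists). *)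

(* Defs.v *)
From HB Require Import structures.
From mathcomp Require Import all_boot all_order all_algebra.
From mathcomp Require Import all_classical all_reals all_analysis.
From mathcomp Require Import complex.
Set Implicit Arguments. Unset Strict Implicit. Unset Printing Implicit Defensive.
Import Order.TTheory GRing.Theory Num.Theory.
Import numFieldNormedType.Exports.
Local Open Scope classical_set_scope.
Local Open Scope ring_scope.
Local Open Scope complex_scope.

Section Defs.
Variable R : realType.
Variable d : nat.

Definition cexp (z : R[i]) : R[i] :=
  (expR (complex.Re z) * cos (complex.Im z))
    +i* (expR (complex.Re z) * sin (complex.Im z)).

Definition cmod (z : R[i]) : R := Normc.normc z.

Definition principal_log (z w : R[i]) : Prop :=
  cexp w = z /\ - pi < complex.Im w <= pi.

Definition dotR (x y : 'rV[R]_d) : R := \sum_i x 0 i * y 0 i.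
Definition zR (x : 'rV[int]_d) : 'rV[R]_d := map_mx (fun z : int => z%:~R) x.

(* a matrix M acting on a vector xi of R^d (column convention: M xi) *)
Definition act (M : 'M[R]_d) (xi : 'rV[R]_d) : 'rV[R]_d := xi *m M^T.

Definition boxsum (V : nmodType) (N : nat) (g : 'rV[int]_d -> V) : V :=
  \sum_(k : 'rV['I_(2 * N).+1]_d)
     g (map_mx (fun i : 'I_(2 * N).+1 => (i%:Z - N%:Z)%R) k).

Definition abs_summable (g : 'rV[int]_d -> R) : Prop :=
  exists M : R, forall N, boxsum N (fun x => `|g x|) <= M.

(* the sum over Z^d of an (absolutely summable) complex function *)
Definition zsum (f : 'rV[int]_d -> R[i]) : R[i] :=
  (limn (fun N => complex.Re (boxsum N f)))
    +i* (limn (fun N => complex.Im (boxsum N f))).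

Definition in_Sd (phi : 'rV[int]_d -> R[i]) : Prop :=
  forall beta : 'rV[nat]_d,
    abs_summable (fun x =>
      `|(\prod_i (x 0 i) ^+ (beta 0 i))%:~R : R| * cmod (phi x)).

Definition fourier (phi : 'rV[int]_d -> R[i]) (xi : 'rV[R]_d) : R[i] :=
  zsum (fun x => phi x * cexp (0 +i* dotR (zR x) xi)).

(* convpow1 phi n = phi^(n+1) ;  phi^(1) = phi,
   phi^(n)(x) = sum_y phi^(n-1)(x-y) phi(y) *)
Fixpoint convpow1 (phi : 'rV[int]_d -> R[i]) (n : nat) : 'rV[int]_d -> R[i] :=
  match n with
  | 0%N => phi
  | m.+1 => fun x => zsum (fun y => convpow1 phi m (x - y) * phi y)
  end.
(* phi^(n) for n >= 1 (the value at n = 0 is irrelevant) *)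
Definition convpow (phi : 'rV[int]_d -> R[i]) (n : nat) := convpow1 phi n.-1.

Definition Omega (phi : 'rV[int]_d -> R[i]) : set 'rV[R]_d :=
  [set xi : 'rV[R]_d | (forall i, - pi < xi 0 i <= pi) /\ cmod (fourier phi xi) = 1].

Definition mexp (A : 'M[R]_d) : 'M[R]_d :=
  limn (fun N => \sum_(k < N) (k`!%:R)^-1 *: A ^+ k).
Definition tpow (t : R) (E : 'M[R]_d) : 'M[R]_d := mexp (ln t *: E).

Definition Exp_set (P : 'rV[R]_d -> R) : set 'M[R]_d :=
  [set E | forall (t : R) (xi : 'rV[R]_d), 0 < t -> P (act (tpow t E) xi) = t * P xi].

Definition pos_homogeneous (P : 'rV[R]_d -> R) : Prop :=
  [/\ continuous P,
      (forall xi, 0 <= P xi),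
      (forall xi, P xi = 0 <-> xi = 0),
      Exp_set P !=set0 &
      compact [set xi : 'rV[R]_d | P xi = 1] ].

Definition contracting (E : 'M[R]_d) : Prop :=
  (fun t => tpow t E) @ 0^'+ --> (0 : 'M[R]_d).

Definition subhomogeneous (E : 'M[R]_d) (Pt : 'rV[R]_d -> R) : Prop :=
  contracting E /\
  forall eps : R, 0 < eps -> forall K : set 'rV[R]_d, compact K ->
    exists tau : R, 0 < tau /\
      forall t xi, 0 < t -> t < tau -> K xi ->
        `|Pt (act (tpow t E) xi)| <= eps * t.

Fixpoint iterD (vs : seq 'rV[R]_d) (f : 'rV[R]_d -> R) : 'rV[R]_d -> R :=
  match vs with [::] => f | v :: vs' => 'D_v (iterD vs' f) end.

Definition Ck_on (U : set 'rV[R]_d) (l : nat) (f : 'rV[R]_d -> R) : Prop :=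
  forall (vs : seq 'rV[R]_d) (x : 'rV[R]_d), U x ->
    ((size vs <= l)%N -> {for x, continuous (iterD vs f)}) /\
    ((size vs < l)%N -> forall v, derivable (iterD vs f) x v).

Definition smooth_on (U : set 'rV[R]_d) (f : 'rV[R]_d -> R) : Prop :=
  forall l, Ck_on U l f.

Definition Ck_near0 (l : nat) (f : 'rV[R]_d -> R) : Prop :=
  exists U : set 'rV[R]_d, [/\ open U, U 0 & Ck_on U l f].

Definition strongly_subhomogeneous (E : 'M[R]_d) (l : nat)
    (Pt : 'rV[R]_d -> R) : Prop :=
  [/\ contracting E, Ck_near0 l Pt &
  forall eps : R, 0 < eps -> forall K : set 'rV[R]_d, compact K ->
    exists tau : R, 0 < tau /\
      forall t xi (k : nat), 0 < t -> t < tau -> K xi -> (k <= l)%N ->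
        `|t ^+ k * derive1n k (fun s => Pt (act (tpow s E) xi)) t| <= eps * t].

Definition poly_no_low (p : 'rV[R]_d -> R) : Prop :=
  exists s : seq (R * 'rV[nat]_d),
    (forall m, m \in s -> (2 <= \sum_i m.2 ord0 i)%N) /\
    forall xi, p xi = \sum_(m <- s) m.1 * \prod_i xi 0 i ^+ (m.2 0 i).

Definition convex_nbhd0 (U : set 'rV[R]_d) : Prop :=
  [/\ open U, U 0 &
      forall x y (s : R), U x -> U y -> 0 <= s -> s <= 1 ->
        U ((1 - s) *: x + s *: y)].

Definition Gamma_decomp (phi : 'rV[int]_d -> R[i]) (xi0 : 'rV[R]_d)
    (U : set 'rV[R]_d) (alpha : 'rV[R]_d)
    (Q Qt Rr Rt : 'rV[R]_d -> R) : Prop :=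
  convex_nbhd0 U /\ poly_no_low Q /\ poly_no_low Rr /\
  (smooth_on U Qt /\ Qt 0 = 0) /\ (smooth_on U Rt /\ Rt 0 = 0) /\
     (forall xi, U xi ->
        principal_log (fourier phi (xi + xi0) / fourier phi xi0)
          ((- (Rr xi + Rt xi)) +i* (dotR alpha xi - (Q xi + Qt xi)))).

Definition positive_type (phi : 'rV[int]_d -> R[i]) (xi0 : 'rV[R]_d)
    (alpha : 'rV[R]_d) (P : 'rV[R]_d -> R[i]) (mu : R) : Prop :=
  exists (U : set 'rV[R]_d) (Q Qt Rr Rt : 'rV[R]_d -> R) (E : 'M[R]_d),
    Gamma_decomp phi xi0 U alpha Q Qt Rr Rt /\
    pos_homogeneous Rr /\ Exp_set Rr E /\ Exp_set Q E /\
    subhomogeneous E Qt /\ subhomogeneous E Rt /\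
    (forall xi, P xi = (Rr xi) +i* (Q xi)) /\
    mu = \tr E.

Definition imaginary_type (phi : 'rV[int]_d -> R[i]) (xi0 : 'rV[R]_d)
    (alpha : 'rV[R]_d) (Qx : 'rV[R]_d -> R) (mu : R) : Prop :=
  exists (U : set 'rV[R]_d) (Q Qt Rr Rt : 'rV[R]_d -> R) (E : 'M[R]_d) (k : R),
    Gamma_decomp phi xi0 U alpha Q Qt Rr Rt /\
    pos_homogeneous (fun xi => `|Q xi|) /\ pos_homogeneous Rr /\
    Exp_set (fun xi => `|Q xi|) E /\
    1 < k /\ Exp_set Rr (k^-1 *: E) /\
    strongly_subhomogeneous E 2 Qt /\
    strongly_subhomogeneous (k^-1 *: E) 1 Rt /\
    Qx = Q /\ mu = \tr E.

Definition set_coord (v : 'rV[R]_d) (m : nat) (s : R) : 'rV[R]_d :=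
  \row_j (if (j : nat) == m then s else v 0 j).

Fixpoint iint (n : nat) (f : 'rV[R]_d -> R) (v : 'rV[R]_d) : R :=
  match n with
  | 0%N => f v
  | m.+1 => \int[lebesgue_measure]_(s in setT) iint m f (set_coord v m s)
  end.

Definition intRd (f : 'rV[R]_d -> R) : R := iint d f 0.

Definition cintRd (f : 'rV[R]_d -> R[i]) : R[i] :=
  (intRd (fun xi => complex.Re (f xi))) +i* (intRd (fun xi => complex.Im (f xi))).

Definition H_attr (P : 'rV[R]_d -> R[i]) (t : R) (y : 'rV[R]_d) : R[i] :=
  ((2 * pi) ^- d)%:C *
    cintRd (fun xi => cexp (- (t%:C * P xi) - (0 +i* dotR y xi))).

Definition H_attr_imag (Q : 'rV[R]_d -> R) (t : R) (y : 'rV[R]_d) : R[i] :=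
  let g := fun tau xi =>
    if `|Q xi| < tau then cexp (0 +i* (- (t * Q xi) - dotR y xi)) else 0 in
  ((2 * pi) ^- d)%:C *
    (lim (intRd (fun xi => complex.Re (g tau xi)) @[tau --> +oo])
      +i* lim (intRd (fun xi => complex.Im (g tau xi)) @[tau --> +oo])).

End Defs.
Arguments zR {R d} x.

(* Main.v *)
(* Fourier inversion writes phi^(n)(x) as an integral of the n-th power of the
   characteristic function over [-pi, pi]^d.  Off the peak xi_0 the integrand is
   geometrically small; near it the integrand is exp (n Gamma), and the dilation
   xi = n^{-E} z (Jacobian n^{-tr E}) turns it into exp (-P z) times the linear
   phase exp (-i (x - n alpha) . n^{-E} z), up to an error that subhomogeneity
   sends to 0.  In the positive case dominated convergence with the majorant
   exp (- R z / 2) concludes, since R grows at least quadratically.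

   In the imaginary case the limit is only conditionally integrable.  The region
   |Q z| >= T is cut into dilation curves s |-> s^E w with w in the shell
   1 <= |Q w| <= 2.  Along a curve the phase is s Q(w) plus terms whose
   derivatives are small (strong subhomogeneity, and |s^E w| = O(s^{1/2}) for the
   linear term), so one integration by parts against the weight s^{tr E - 1}
   bounds the contribution by O(T^{tr E - 1}), uniformly in n.  As tr E < 1 this
   tail is negligible, and on |Q z| < T dominated convergence applies again. *)
Require Import Defs.
From HB Require Import structures.
From mathcomp Require Import all_boot all_order all_algebra.
From mathcomp Require Import fingroup perm.
From mathcomp Require Import all_classical all_reals all_analysis.
From mathcomp Require Import measurable_realfun complex ring lra zify.
Import Order.TTheory GRing.Theory Num.Theory.
Import numFieldNormedType.Exports.
Local Open Scope classical_set_scope.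
Local Open Scope ring_scope.
Local Open Scope complex_scope.

(** * Lebesgue measure and linear changes of variables on row vectors *)

(** [intRd] is an iterated one-variable integral in which each inner integral is collapsed to a real
    number, so neither Fubini nor a Jacobian formula applies to it directly. A measure [lebd] on row
    vectors is therefore built one coordinate at a time; estimates are made for it, and [intRdE]
    returns to [intRd] for integrable functions. The Jacobian of t^E comes from shears: a matrix
    near the identity is a product of shears, and t^E is a power of such a matrix. The absence of
    polynomial terms of degree below 2 bounds the gauge N (R or |Q|) by a multiple of |x|^2 near 0;
    through the dilations this becomes |x|^2 = O(N(x)) far out. That gives the Gaussian majorant in
    the positive case and keeps the linear phase slower than the main one in the imaginary case. In
    the imaginary case damping yields no fixed majorant, since n R(n^-E z) = n^(1-k) R(z) tends to
    0. On the zone T <= |Q| < n delta the damped amplitude still varies with n; its derivative along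
    a curve is nevertheless O(1/s) uniformly in n, because x exp(-x) <= 1. T is fixed by the tail
    bounds before n is chosen, and no choice involves the dual variable beyond a bound on its
    size. *)

Section rv_measurable.
Context {R : realType} {d : nat}.
Let coor (i : 'I_d) (x : 'rV[R]_d) : R := x ord0 i.

Let rv_set0 : g_sigma_preimage coor set0.
Proof. exact: sigma_algebra0. Qed.
Let rv_setC A : g_sigma_preimage coor A -> g_sigma_preimage coor (~` A).
Proof. exact: sigma_algebraC. Qed.
Let rv_bigcup (F : (set 'rV[R]_d)^nat) : (forall i, g_sigma_preimage coor (F i)) ->
  g_sigma_preimage coor (\bigcup_i (F i)).
Proof. exact: sigma_algebra_bigcup. Qed.

(** Generating the sigma-algebra by the coordinates makes measurability into row vectors a
    coordinatewise matter; [open_measurable_rV] shows that it contains the open sets. *)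
HB.instance Definition _ := @isMeasurable.Build default_measure_display
  'rV[R]_d (g_sigma_preimage coor) rv_set0 rv_setC rv_bigcup.

Lemma measurable_coord (i : 'I_d) :
  measurable_fun [set: 'rV[R]_d] (fun x : 'rV[R]_d => x ord0 i).
Proof.
move=> _ Y mY; rewrite setTI; apply: sub_sigma_algebra => /=.
rewrite -bigcup_seq/=; exists i => /=; first by rewrite mem_index_enum.
by exists Y => //; rewrite setTI.
Qed.

Lemma measurable_rVP {d' : measure_display} {T : measurableType d'}
    (f : T -> 'rV[R]_d) :
  (forall i, measurable_fun [set: T] (fun x => f x ord0 i)) ->
  measurable_fun [set: T] f.
Proof.
move=> mf; suff H : g_sigma_preimage (fun i => coor i \o f) `<=` measurable.
  by move=> _ A mA; apply: H; rewrite g_sigma_preimage_comp; exists A.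
apply: smallest_sub; first exact: sigma_algebra_measurable.
move=> A; rewrite -bigcup_seq/= => -[i _ [B mB <-]].
exact: mf.
Qed.

Lemma measurable_rV_ball (x : 'rV[R]_d) (e : R) : measurable (ball x e).
Proof.
have [e0|e0] := ltP 0 e; last first.
  rewrite (_ : ball x e = set0) //; apply/seteqP; split => // y [].
  by rewrite ltNge e0.
rewrite (_ : ball x e = \big[setI/setT]_(i < d) ((fun y : 'rV[R]_d => y ord0 i) @^-1` ball (x ord0 i) e)).
  elim/big_ind: _ => //; first exact: measurableI.
  move=> i _; rewrite -[X in measurable X]setTI; apply: measurable_coord => //.
  exact: measurable_ball.
apply/seteqP; split => y.
  by case=> _ H; rewrite -bigcap_seq => i _; exact: H.
rewrite -bigcap_seq => H; split => // i j; rewrite (ord1 i).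
by apply: H => /=; rewrite mem_index_enum.
Qed.

Lemma rat_rV_dense (x : 'rV[R]_d) (e : R) : 0 < e ->
  exists q : 'rV[rat]_d, ball x e (map_mx (@ratr R) q).
Proof.
move=> e0.
have H (i : 'I_d) : exists q : rat, x ord0 i - e < ratr q < x ord0 i + e.
  by have [|q] := @rat_in_itvoo R (x ord0 i - e) (x ord0 i + e);
    [lra | rewrite in_itv/=; exists q].
case: (choice H) => q Hq; exists (\row_i q i); split => // i j.
rewrite (ord1 i) /ball/= !mxE ltr_distl -ltrBlDr.
by have /andP[h1 h2] := Hq j; apply/andP; split; lra.
Qed.

(** Balls with rational centre and radius 1/(n+1) are countably many, and those contained in U cover
    it. [pickle] supplies the enumeration; a code of no ball, or of a ball not inside U, contributes
    the empty set. *)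
Lemma open_measurable_rV (U : set 'rV[R]_d) : open U -> measurable U.
Proof.
move=> oU.
pose F (k : nat) : set 'rV[R]_d :=
  if unpickle k is Some (q, n) then
    let B := ball (map_mx (@ratr R) (q : 'rV[rat]_d)) (n.+1%:R^-1 : R) in
    if `[< B `<=` U >] then B else set0
  else set0.
rewrite (_ : U = \bigcup_k F k).
  apply: bigcup_measurable => k _; rewrite /F; case: unpickle => // -[q n] /=.
  by case: ifP => // _; exact: measurable_rV_ball.
apply/seteqP; split => x; last first.
  case=> k _; rewrite /F; case: unpickle => // -[q n] /=.
  by case: ifPn => // /asboolP H /H.
move=> Ux; have /nbhs_ballP[e /= e0 He] := open_nbhs_nbhs (conj oU Ux).
(* A ball of radius below e/2 whose centre is within that radius of x stays inside [ball x e]. *)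
have [n Hn] : exists n, n.+1%:R^-1 < e / 2.
  have e2 : 0 < e / 2 by rewrite divr_gt0.
  have [n _ H] := near_infty_natSinv_lt (PosNum e2).
  by exists n; apply: H => /=.
have [q Hq] := @rat_rV_dense x (n.+1%:R^-1) ltac:(by rewrite invr_gt0 ltr0n).
exists (pickle (q, n)) => //; rewrite /F pickleK; set B := ball _ _ => /=.
case: ifPn => [_|/asboolP[]]; first exact: ball_sym.
move=> y By; apply: He; apply: (@le_ball _ _ _ (n.+1%:R^-1 + n.+1%:R^-1)).
  by rewrite [leRHS]splitr lerD ?ltW.
exact: ball_triangle By.
Qed.

Lemma continuous_measurable_rV (f : 'rV[R]_d -> R) :
  continuous f -> measurable_fun setT f.
Proof.
move=> /continuousP cf; apply: (measurability _ (RGenOpens.measurableE R)).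
move=> _ [_ [a [b ->] <-]]; rewrite setTI; apply: open_measurable_rV.
exact/cf/interval_open.
Qed.

End rv_measurable.

Section lebesgue_rV.
Context {R : realType} {d : nat}.
Local Notation rv := 'rV[R]_d.
Local Notation mR := (measurableTypeR R).
Local Notation leb := (@lebesgue_measure R).

Definition coord_update (m : nat) (p : mR * rv) : rv := set_coord p.2 m p.1.

Lemma set_coordE (v : rv) m s j :
  set_coord v m s ord0 j = if (j : nat) == m then s else v ord0 j.
Proof. by rewrite mxE. Qed.

Lemma measurable_coord_update m : measurable_fun setT (coord_update m).
Proof.
apply: measurable_rVP => i; have [e|ne] := eqVneq (i : nat) m.
  rewrite (_ : (fun _ => _) = fst) //.
  by apply/funext => -[s v]; rewrite /coord_update set_coordE e eqxx.
rewrite (_ : (fun _ => _) = (fun x : rv => x ord0 i) \o snd).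
  by apply: measurableT_comp => //; exact: measurable_coord.
by apply/funext => -[s v]; rewrite /coord_update set_coordE (negbTE ne).
Qed.

Lemma measurable_set_coord m (v : rv) :
  measurable_fun setT (fun s : mR => set_coord v m s).
Proof.
apply: measurable_rVP => i; have [e|ne] := eqVneq (i : nat) m.
  rewrite (_ : (fun _ => _) = id) //.
  by apply/funext => s; rewrite set_coordE e eqxx.
rewrite (_ : (fun _ => _) = cst (v ord0 i)) //.
by apply/funext => s; rewrite set_coordE (negbTE ne).
Qed.

(** Only coordinates of index below m are constrained: the measure of stage m is concentrated where
    the others vanish. *)
Definition nbox (m k : nat) : set rv :=
  [set x | forall j : 'I_d, (j < m)%N -> `|x ord0 j| <= k%:R].

Lemma measurable_nbox m k : measurable (nbox m k).
Proof.
rewrite (_ : nbox m k = \big[setI/setT]_(i < d)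
    (if (i < m)%N then (fun y : rv => y ord0 i) @^-1` `[- k%:R, k%:R] else setT)).
  elim/big_ind: _ => //; first exact: measurableI.
  move=> i _; case: ifP => // _; rewrite -[X in measurable X]setTI.
  exact: measurable_coord.
apply/seteqP; split => x.
  move=> H; rewrite -bigcap_seq => i _ /=; case: ifP => // im.
  by rewrite /= in_itv/= -ler_norml; exact: H.
rewrite -bigcap_seq => H j jm; have := H j; rewrite /= jm /= in_itv/= -ler_norml.
by apply; rewrite mem_index_enum.
Qed.

Section step.
Variables (m : nat) (mu : {sigma_finite_measure set rv -> \bar R}).

(** Adjoins Lebesgue measure in one more coordinate. As a push-forward of a product, it inherits
    Tonelli and Fubini. *)
Definition step : set rv -> \bar R :=
  fun A => (leb \x mu)%E (coord_update m @^-1` A).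

Let mcu (A : set rv) : measurable A -> measurable (coord_update m @^-1` A).
Proof.
by move=> mA; rewrite -[X in measurable X]setTI; exact: measurable_coord_update.
Qed.

Let step0 : step set0 = 0%E.
Proof. by rewrite /step preimage_set0 measure0. Qed.
Let step_ge0 A : (0 <= step A)%E. Proof. exact: measure_ge0. Qed.
Let step_sa : semi_sigma_additive step.
Proof.
move=> F mF tF mUF; rewrite /step preimage_bigcup.
apply: measure_semi_sigma_additive.
- by move=> n; exact: mcu.
- apply/trivIsetP => /= i j _ _ ij; rewrite -preimage_setI.
  by move/trivIsetP : tF => /(_ _ _ _ _ ij) ->//; rewrite preimage_set0.
- by rewrite -preimage_bigcup; exact: mcu.
Qed.

HB.instance Definition _ := isMeasure.Build _ _ _ step step0 step_ge0 step_sa.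

Lemma step_nbox k : (m < d)%N -> (mu (nbox m k) < +oo)%E ->
  (step (nbox m.+1 k) < +oo)%E.
Proof.
move=> md fin; rewrite /step (_ : _ @^-1` _ = `[- k%:R, k%:R] `*` nbox m k).
  have E : (leb [set` `[(- k%:R)%R, k%:R%R]] < +oo)%E.
    by have -> := @lebesgue_measure_itv R `[(- k%:R)%R, k%:R%R]; case: ifP => // _; rewrite -EFinB ltry.
  rewrite product_measure1E//; last exact: measurable_nbox.
  by rewrite lte_mul_pinfty// ge0_fin_numE.
apply/seteqP; split => -[s v] /=; rewrite in_itv/= -ler_norml.
  move=> H; split.
    have := H (Ordinal md) (ltnSn m).
    by rewrite /coord_update set_coordE eqxx.
  move=> j jm; have := H j (ltnW jm).
  by rewrite /coord_update set_coordE ltn_eqF.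
move=> [hs hv] j; rewrite ltnS leq_eqVlt /coord_update set_coordE.
by case: eqP => //= _; exact: hv.
Qed.
End step.

Lemma le_coord_norm (x : rv) i : `|x ord0 i| <= `|x|.
Proof.
rewrite [leRHS]/Num.norm/= mx_normrE.
exact: (le_bigmax _ (fun ij => `|x ij.1 ij.2|) (ord0, i)).
Qed.

Lemma nbox_cover m (mu : {measure set rv -> \bar R}) :
  (forall k, (mu (nbox m k) < +oo)%E) -> sigma_finite setT mu.
Proof.
move=> fin; exists (nbox m); last by move=> k; split => //; exact: measurable_nbox.
apply/esym/seteqP; split => // x _.
exists (Num.truncn `|x|).+1 => // j _.
apply: le_trans (ltW (truncnS_gt _)).
exact: le_coord_norm.
Qed.

(** The product at the next stage requires a sigma-finite measure. Finiteness on boxes is the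
    invariant that propagates, and [nbox_cover] derives sigma-finiteness from it. *)
Record boxfin_measure (m : nat) := BoxFin {
  bf_mu : {sigma_finite_measure set rv -> \bar R};
  bf_fin : forall k, (bf_mu (nbox m k) < +oo)%E }.

Section sigma_finite_pack.
Variables (mu : {measure set rv -> \bar R}) (H : sigma_finite setT mu).
Definition sigma_finite_of : set rv -> \bar R := let _ := H in mu.
HB.instance Definition _ := Measure.copy sigma_finite_of mu.
HB.instance Definition _ := Measure_isSigmaFinite.Build _ _ _ sigma_finite_of H.
Definition sigma_finite_pack : {sigma_finite_measure set rv -> \bar R} :=
  sigma_finite_of.
End sigma_finite_pack.

Definition rv_dirac0 : {measure set rv -> \bar R} := @dirac _ rv (0 : rv) R.

Lemma dirac0_nbox k : (rv_dirac0 (nbox 0 k) < +oo)%E.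
Proof. by rewrite /rv_dirac0 /= diracE; case: (_ \in _); rewrite ltry. Qed.

Lemma sigma_finite_dirac0 : sigma_finite setT rv_dirac0.
Proof. exact: nbox_cover dirac0_nbox. Qed.

Lemma boxfin_step_sigma m (M : boxfin_measure m) : (m < d)%N ->
  sigma_finite setT (step m (bf_mu _ M)).
Proof. by move=> md; apply: (@nbox_cover m.+1) => k; apply: step_nbox => //; exact: bf_fin. Qed.

Lemma nbox_ge m k : ~ (m < d)%N -> nbox m.+1 k = nbox m k.
Proof.
move=> /negP; rewrite -leqNgt => dm; apply/seteqP; split => x H j jm; apply: H.
  exact: leqW.
exact: leq_trans (ltn_ord j) dm.
Qed.

(** Past the last coordinate the measure is repeated, to keep the recursion total; there the boxes
    of stages m and m+1 coincide. *)
Definition boxfin_step m (M : boxfin_measure m) : boxfin_measure m.+1 :=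
  match Bool.bool_dec (m < d)%N true with
  | left md => BoxFin m.+1 (sigma_finite_pack _ (boxfin_step_sigma m M md))
      (fun k => step_nbox m (bf_mu _ M) k md (bf_fin _ M k))
  | right md => BoxFin m.+1 (bf_mu _ M)
      (fun k => eq_rect_r (fun A => (bf_mu _ M A < +oo)%E) (bf_fin _ M k) (nbox_ge m k md))
  end.

Fixpoint boxfin_seq m : boxfin_measure m :=
  match m with
  | 0%N => BoxFin 0 (sigma_finite_pack _ sigma_finite_dirac0) dirac0_nbox
  | m'.+1 => boxfin_step m' (boxfin_seq m')
  end.

(* Lebesgue measure in the coordinates of index smaller than m, the other
   coordinates being 0 *)
Definition lebm m : {sigma_finite_measure set rv -> \bar R} := bf_mu _ (boxfin_seq m).

Lemma lebmS m : (m < d)%N -> lebm m.+1 = step m (lebm m) :> (set rv -> \bar R).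
Proof. by move=> md; rewrite /lebm /= /boxfin_step; case: Bool.bool_dec. Qed.

Lemma lebm_nbox m k : (lebm m (nbox m k) < +oo)%E.
Proof. exact: bf_fin. Qed.

Lemma ge0_integral_lebmS m (f : rv -> \bar R) : (m < d)%N ->
  measurable_fun setT f -> (forall x, (0 <= f x)%E) ->
  (\int[lebm m.+1]_x f x = \int[leb]_s \int[lebm m]_w f (set_coord w m s))%E.
Proof.
move=> md mf f0.
rewrite (@eq_measure_integral _ _ _ setT (step m (lebm m))); last first.
  by move=> A _ _; exact: (congr1 (@^~ A) (lebmS m md)).
rewrite (@ge0_integral_pushforward _ _ _ _ _ (coord_update m)
  (measurable_coord_update m) (leb \x lebm m)%E setT f)//.
rewrite preimage_setT (fubini_tonelli1 (f \o coord_update m))//.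
by apply: (measurableT_comp mf); exact: measurable_coord_update.
by move=> x; exact: f0.
Qed.

Lemma ge0_integral_lebmS' m (f : rv -> \bar R) : (m < d)%N ->
  measurable_fun setT f -> (forall x, (0 <= f x)%E) ->
  (\int[lebm m.+1]_x f x = \int[lebm m]_w \int[leb]_s f (set_coord w m s))%E.
Proof.
move=> md mf f0; rewrite ge0_integral_lebmS//.
rewrite (fubini_tonelli (f \o coord_update m))//.
  by apply: (measurableT_comp mf); exact: measurable_coord_update.
by move=> x; exact: f0.
Qed.

Lemma integrable_lebmS m (f : rv -> \bar R) : (m < d)%N ->
  (lebm m.+1).-integrable setT f ->
  (leb \x lebm m)%E.-integrable setT (f \o coord_update m).
Proof.
move=> md /integrableP[mf fi]; apply/integrableP; split.
  by apply: (measurableT_comp mf); exact: measurable_coord_update.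
rewrite (fubini_tonelli1 (fun p => `|(f \o coord_update m) p|%E))//=.
  by rewrite -[ltLHS](ge0_integral_lebmS m (fun x => `|f x|)%E)//; exact: measurableT_comp.
apply: measurableT_comp => //.
by apply: (measurableT_comp mf); exact: measurable_coord_update.
Qed.

Lemma integral_lebmS m (f : rv -> \bar R) : (m < d)%N ->
  (lebm m.+1).-integrable setT f ->
  (\int[lebm m.+1]_x f x = \int[leb \x lebm m]_p f (coord_update m p))%E.
Proof.
move=> md fi; have /integrableP[mf _] := fi.
rewrite (@eq_measure_integral _ _ _ setT (step m (lebm m))); last first.
  by move=> A _ _; exact: (congr1 (@^~ A) (lebmS m md)).
rewrite (@integral_pushforward _ _ _ _ _ (coord_update m)
  (measurable_coord_update m) (leb \x lebm m)%E setT f)//.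
by rewrite preimage_setT; exact: integrable_lebmS.
Qed.

(** [iint m f v] integrates the coordinates below m and reads the others from v, whereas [lebm m]
    puts 0 there; [merge] reconciles the two. *)
Definition merge m (w v : rv) : rv :=
  \row_j (if (j < m)%N then w ord0 j else v ord0 j).

Lemma merge_set_coord m (w v : rv) s :
  merge m w (set_coord v m s) = merge m.+1 (set_coord w m s) v.
Proof.
by apply/rowP => j; rewrite !mxE ltnS; case: (ltngtP j m).
Qed.

(** The slices may fail to be integrable, so measurability goes through positive and negative parts,
    where Tonelli's statement applies. *)
Lemma measurable_iint m (f : rv -> R) : measurable_fun setT f ->
  measurable_fun setT (iint m f).
Proof.
move=> mf; elim: m => // m IH /=.
pose G (p : rv * mR) : \bar R := (iint m f (set_coord p.1 m p.2))%:E.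
have mG : measurable_fun setT G.
  apply/measurable_EFinP; apply: (measurableT_comp IH).
  exact: (measurableT_comp (measurable_coord_update m) (@measurable_swap _ _ _ _)).
apply: (measurableT_comp (fine_measurable _)) => //.
rewrite (_ : (fun _ => _) = (fun v => \int[leb]_s G^\+ (v, s) - \int[leb]_s G^\- (v, s))%E).
  apply: emeasurable_funB.
    by apply: measurable_fun_fubini_tonelli_F => //; exact: measurable_funepos.
  by apply: measurable_fun_fubini_tonelli_F => //; exact: measurable_funeneg.
by apply/funext => v; rewrite [LHS]integralE; congr (_ - _)%E; apply: eq_integral => s _; rewrite (funeposE, funenegE) (funeposE, funenegE).
Qed.

(** Fubini makes the slices integrable for almost every s only, so the induction hypothesis
    identifies the integrands almost everywhere; on the exceptional slices the measurability of
    [iint] is enough. *)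
Lemma iintE m (f : rv -> R) v : (m <= d)%N -> measurable_fun setT f ->
  (lebm m).-integrable setT (fun w => (f (merge m w v))%:E) ->
  iint m f v = \int[lebm m]_w f (merge m w v).
Proof.
elim: m v => [|m IH] v md mf fi.
  rewrite /= /Rintegral (@eq_measure_integral _ _ _ setT rv_dirac0)//.
  rewrite integral_dirac//=; last first.
    by apply: measurable_int; exact: fi.
  rewrite indicT mul1r; congr f; apply/rowP => j; by rewrite !mxE.
pose F (p : mR * rv) := (f (merge m.+1 (coord_update m p) v))%:E.
have Fi : (leb \x lebm m)%E.-integrable setT F by exact: integrable_lebmS fi.
rewrite [RHS]/Rintegral integral_lebmS//= -(integral12_prod_meas1 Fi).
congr fine; apply: ae_eq_integral => //.
- apply/measurable_EFinP; apply: (measurableT_comp (measurable_iint m f mf)).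
  exact: measurable_set_coord.
- exact: measurable_fubini_F Fi.
have := ae_integrable1 Fi; apply: filterS => s /= si _.
have E w : F (s, w) = (f (merge m w (set_coord v m s)))%:E.
  by rewrite /F /= merge_set_coord.
rewrite IH//; [|exact: ltnW|]; last first.
  by apply: eq_integrable si => // w _; exact: E.
rewrite /fubini_F (eq_integral (fun w => (f (merge m w (set_coord v m s)))%:E)).
  rewrite fineK//; apply: integrable_fin_num => //.
  by apply: eq_integrable si => // w _; exact: E.
by move=> w _; exact: E.
Qed.

Definition lebd := lebm d.

Lemma intRdE (f : rv -> R) : measurable_fun setT f ->
  lebd.-integrable setT (EFin \o f) -> intRd f = \int[lebd]_w f w.
Proof.
have E w : merge d w 0 = w by apply/rowP => j; rewrite mxE ltn_ord.
move=> mf fi; rewrite /intRd iintE//.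
  by apply: eq_Rintegral => w _; rewrite E.
by apply: eq_integrable fi => // w _; rewrite /= E.
Qed.

End lebesgue_rV.

(** * Affine maps of the line and shears *)

Section affine_1d.
Context {R : realType}.
Local Notation mR := (measurableTypeR R).
Local Notation leb := (@lebesgue_measure R).

Lemma measurable_affine (b c : R) :
  measurable_fun setT (fun s : mR => b * s + c : mR).
Proof.
apply: continuous_measurable_fun => x.
by apply: cvgD; [apply: cvgM; [exact: cvg_cst|exact: cvg_id]|exact: cvg_cst].
Qed.

(** The image measure multiplied by b gives each interval []x, y]] its length, and this
    characterises Lebesgue measure. *)
Lemma lebesgue_affine (b c : R) (A : set mR) : 0 < b -> measurable A ->
  leb ((fun s : mR => b * s + c : mR) @^-1` A) = (b^-1%:E * leb A)%E.
Proof.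
move=> b0 mA.
have b0' : 0 <= b by exact: ltW.
have maff := measurable_affine b c.
pose mu : {measure set mR -> \bar R} := mscale (NngNum b0')
  (measure_function_pushforward__canonical__measure_function_Measure leb maff).
suff -> : leb A = mu A.
  by rewrite /mscale/= /pushforward muleA -EFinM mulVf ?gt_eqF// mul1e.
apply: lebesgue_measure_unique => //= _ [[x y] _ <-] /=.
rewrite /mscale/= /pushforward.
have -> : (fun s : mR => b * s + c : mR) @^-1` `]x, y]%classic =
    [set` `](x - c) / b, (y - c) / b]].
  apply/seteqP; split => s; rewrite /= !in_itv/= ltr_pdivrMr// ler_pdivlMr//;
  by rewrite ltrBlDr lerBrDr mulrC.
have H := @lebesgue_measure_itv R `]x, y].
have H' := @lebesgue_measure_itv R `](x - c) / b, (y - c) / b].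
rewrite H H' /= !lte_fin ltr_pM2r ?invr_gt0// ltrD2r.
case: ifP => _; last by rewrite mule0.
by rewrite -!EFinB -EFinM -mulrBl; congr EFin; field; rewrite gt_eqF.
Qed.

Lemma ge0_integral_affine (b c : R) (f : mR -> \bar R) : 0 < b ->
  measurable_fun setT f -> (forall x, (0 <= f x)%E) ->
  (\int[leb]_s f (b * s + c)%R = b^-1%:E * \int[leb]_s f s)%E.
Proof.
move=> b0 mf f0; have b0' : 0 <= b^-1 by rewrite invr_ge0 ltW.
rewrite -[b^-1]/((NngNum b0')%:num) -ge0_integral_mscale//.
have H := @ge0_integral_pushforward _ _ _ _ _ _ (measurable_affine b c) leb setT f.
rewrite -[LHS](H measurableT)//.
apply: eq_measure_integral => [|? A mA _]; first exact: measurable_affine.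
by rewrite /mscale /= /pushforward lebesgue_affine.
Qed.

End affine_1d.

Section shear.
Context {R : realType} {d : nat}.
Local Notation rv := 'rV[R]_d.
Local Notation mR := (measurableTypeR R).
Local Notation leb := (@lebesgue_measure R).

Lemma measurable_set_coordr m s : measurable_fun setT (fun v : rv => set_coord v m s).
Proof.
apply: measurable_rVP => j; have [e|ne] := eqVneq (j : nat) m.
  rewrite (_ : (fun _ => _) = cst s) //.
  by apply/funext => v; rewrite set_coordE e eqxx.
rewrite (_ : (fun _ => _) = (fun x : rv => x ord0 j)); first exact: measurable_coord.
by apply/funext => v; rewrite set_coordE (negbTE ne).
Qed.

Lemma set_coord_set (x : rv) m s s' : set_coord (set_coord x m s) m s' = set_coord x m s'.
Proof. by apply/rowP => j; rewrite !set_coordE; case: eqP. Qed.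

Lemma set_coordC (x : rv) m k s t : m != k ->
  set_coord (set_coord x m s) k t = set_coord (set_coord x k t) m s.
Proof.
move=> mk; apply/rowP => j; rewrite !set_coordE.
by have [-> |//] := eqVneq (j : nat) m; rewrite (negbTE mk).
Qed.

Definition shear (i : 'I_d) (b : R) (g : rv -> R) (x : rv) : rv :=
  set_coord x i (b * x ord0 i + g x).

Lemma measurable_shear i b g : measurable_fun setT g ->
  measurable_fun setT (shear i b g).
Proof.
move=> mg; apply: measurable_rVP => j; have [e|ne] := eqVneq (j : nat) i.
  rewrite (_ : (fun _ => _) = (fun x : rv => b * x ord0 i + g x)); last first.
    by apply/funext => x; rewrite /shear set_coordE e eqxx.
  apply: measurable_funD => //; apply: measurable_funM => //.
  exact: measurable_coord.
rewrite (_ : (fun _ => _) = (fun x : rv => x ord0 j)); first exact: measurable_coord.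
by apply/funext => x; rewrite /shear set_coordE (negbTE ne).
Qed.

(** Tonelli allows either order of integration. If i is the coordinate added last, it is integrated
    first, and the affine formula applies with g constant. Otherwise the last coordinate is frozen,
    and the statement with one coordinate fewer applies to the slices of f and g. *)
Lemma ge0_integral_shear_lebm (i : 'I_d) (b : R) k (g : rv -> R) (f : rv -> \bar R) :
  0 < b -> (i < k <= d)%N ->
  measurable_fun setT g -> (forall x s, g (set_coord x i s) = g x) ->
  measurable_fun setT f -> (forall x, (0 <= f x)%E) ->
  (\int[lebm k]_x f (shear i b g x) = b^-1%:E * \int[lebm k]_x f x)%E.
Proof.
move=> b0 + mg gi mf f0.
elim: k => // k IH in g mg gi f mf f0 *.
rewrite ltnS leq_eqVlt => /andP[+ kd] => /predU1P[ik|ik].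
  have mfs : measurable_fun setT (f \o shear i b g).
    exact: (measurableT_comp mf (measurable_shear _ _ _ mg)).
  rewrite (ge0_integral_lebmS' k (f \o shear i b g) kd mfs (fun x => f0 _)) (ge0_integral_lebmS' k f)//.
  rewrite -ge0_integralZl//; last 3 first.
  - apply: (measurable_fun_fubini_tonelli_G (f \o coord_update k)).
      by apply: (measurableT_comp mf); exact: measurable_coord_update.
    by move=> x; exact: f0.
  - by move=> x _; exact: integral_ge0.
  - by rewrite lee_fin invr_ge0 ltW.
  apply: eq_integral => w _.
  rewrite -(@ge0_integral_affine _ b (g w) (fun s => f (set_coord w k s)))//.
    by apply: eq_integral => s _; rewrite /shear /= -ik set_coord_set gi set_coordE eqxx.
  by apply: (measurableT_comp mf); exact: measurable_set_coord.
have mfs : measurable_fun setT (f \o shear i b g).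
  exact: (measurableT_comp mf (measurable_shear _ _ _ mg)).
rewrite (ge0_integral_lebmS k (f \o shear i b g) kd mfs (fun x => f0 _)) (ge0_integral_lebmS k f)//.
rewrite -ge0_integralZl//; last 3 first.
- apply: (measurable_fun_fubini_tonelli_F (f \o coord_update k)).
    by apply: (measurableT_comp mf); exact: measurable_coord_update.
  by move=> x; exact: f0.
- by move=> x _; exact: integral_ge0.
- by rewrite lee_fin invr_ge0 ltW.
apply: eq_integral => s _.
have ki : k != i by rewrite gtn_eqF.
rewrite -(IH (fun w => g (set_coord w k s)) _ _ (fun w => f (set_coord w k s)))//.
- apply: eq_integral => w _; congr f; rewrite /shear /=.
  by rewrite set_coordC// set_coordE eq_sym (negbTE ki).
- apply: (measurableT_comp mg); exact: measurable_set_coordr.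
- by move=> x t; rewrite set_coordC 1?eq_sym// gi.
- apply: (measurableT_comp mf); exact: measurable_set_coordr.
- by rewrite ik ltnW.
Qed.

Lemma ge0_integral_shear (i : 'I_d) (b : R) (g : rv -> R) (f : rv -> \bar R) :
  0 < b -> measurable_fun setT g -> (forall x s, g (set_coord x i s) = g x) ->
  measurable_fun setT f -> (forall x, (0 <= f x)%E) ->
  (\int[lebd]_x f (shear i b g x) = b^-1%:E * \int[lebd]_x f x)%E.
Proof. by move=> *; apply: ge0_integral_shear_lebm => //; rewrite ltn_ord leqnn. Qed.

End shear.

(** * Linear changes of variables as products of shears *)

Section linear_cov.
Context {R : realType} {d : nat}.
Local Notation rv := 'rV[R]_d.
Implicit Types (M N : 'M[R]_d).

Lemma actE M (x : rv) i : act M x ord0 i = \sum_j M i j * x ord0 j.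
Proof. by rewrite mxE; apply: eq_bigr => j _; rewrite !mxE mulrC. Qed.

Lemma act_mul M N (x : rv) : act (M *m N) x = act M (act N x).
Proof. by rewrite /act trmx_mul mulmxA. Qed.

Lemma act1 (x : rv) : act 1%:M x = x.
Proof. by rewrite /act trmx1 mulmx1. Qed.

Lemma measurable_act M : measurable_fun setT (act M).
Proof.
apply: measurable_rVP => i.
rewrite (_ : (fun _ => _) = (fun x : rv => \sum_j M i j * x ord0 j)); last first.
  by apply/funext => x; rewrite actE.
apply: measurable_sum => j; apply: measurable_funM => //.
exact: measurable_coord.
Qed.

(** Interpolates between the identity and M one row at a time; for k <= d its determinant is the
    leading principal minor of order k of M. *)
Definition rows_upto M k : 'M[R]_d :=
  \matrix_(i, j) (if (i < k)%N then M i j else (i == j)%:R).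

Definition row_op (m : 'I_d) (r : rv) : 'M[R]_d :=
  \matrix_(i, j) (if i == m then r ord0 j else (i == j)%:R).

Lemma det_row_op m r : \det (row_op m r) = r ord0 m.
Proof.
rewrite (expand_det_row _ m).
have E j : cofactor (row_op m r) m j = (\adj 1%:M : 'M[R]_d) j m.
  rewrite mxE /cofactor; congr (_ * \det _).
  apply/matrixP => a b; rewrite !mxE.
  by rewrite eq_sym (negbTE (neq_lift _ _)).
under eq_bigr => j _ do rewrite E mxE eqxx.
have A1 : (\adj 1%:M : 'M[R]_d) = 1%:M.
  by rewrite -[LHS]mul1mx mul_mx_adj det1.
rewrite A1 (bigD1 m)//= mxE eqxx mulr1 big1 ?addr0// => j jm.
by rewrite mxE (negbTE jm) mulr0.
Qed.

Lemma act_row_op m (r x : rv) :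
  act (row_op m r) x = shear m (r ord0 m) (fun y => \sum_(j | j != m) r ord0 j * y ord0 j) x.
Proof.
apply/rowP => i; rewrite actE /shear set_coordE.
have [im|im] := eqVneq (i : nat) m.
  rewrite -(bigD1 m (P := xpredT) (F := fun j => r ord0 j * x ord0 j))//=.
  apply: eq_bigr => j _; rewrite mxE.
  by have -> : i == m by apply/eqP/val_inj.
rewrite (bigD1 i)//= mxE.
have -> : (i == m) = false by apply/negbTE; apply: contraNneq im => ->.
rewrite eqxx mul1r big1 ?addr0// => j ji; rewrite mxE.
have -> : (i == m) = false by apply/negbTE; apply: contraNneq im => ->.
by rewrite eq_sym (negbTE ji) mul0r.
Qed.

Lemma ge0_integral_row_op m (r : rv) (f : rv -> \bar R) : 0 < r ord0 m ->
  measurable_fun setT f -> (forall x, (0 <= f x)%E) ->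
  (\int[lebd]_x f (act (row_op m r) x) = (r ord0 m)^-1%:E * \int[lebd]_x f x)%E.
Proof.
move=> r0 mf f0.
rewrite -(ge0_integral_shear m _ (fun y => \sum_(j | j != m) r ord0 j * y ord0 j))//.
- by apply: eq_integral => x _; rewrite act_row_op.
- under eq_fun do rewrite big_mkcond/=.
  apply: measurable_sum => j; case: (j != m) => //; apply: measurable_funM => //.
  exact: measurable_coord.
- move=> x s; apply: eq_bigr => j jm; rewrite set_coordE.
  by rewrite -val_eqE/= in jm; rewrite (negbTE jm).
Qed.

(** Row m of M, expanded in the basis formed by the rows of [rows_upto M m], gives the nontrivial
    row of the elementary factor. *)
Lemma rows_uptoS M (m : 'I_d) : \det (rows_upto M m) != 0 ->
  rows_upto M m.+1 =
  row_op m (row m M *m invmx (rows_upto M m)) *m rows_upto M m.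
Proof.
move=> dn; have U : rows_upto M m \in unitmx by rewrite unitmxE unitfE.
apply/row_matrixP => i; rewrite row_mul.
have [->|im] := eqVneq i m.
  rewrite (_ : row m (row_op _ _) = row m M *m invmx (rows_upto M m)).
    by rewrite mulmxKV//; apply/rowP => j; rewrite !mxE ltnSn.
  by apply/rowP => j; rewrite !mxE eqxx.
rewrite (_ : row i (row_op _ _) = row i 1%:M).
  rewrite -row_mul mul1mx; apply/rowP => j; rewrite !mxE ltnS.
  by rewrite leq_eqVlt -[(i : nat) == m]/(i == m) (negbTE im).
by apply/rowP => j; rewrite !mxE (negbTE im).
Qed.

(** M is a product of d row operations, each a shear whose diagonal entry is the quotient of two
    consecutive minors. Positive minors make all these entries positive, so neither permutations nor
    absolute values enter. *)
Lemma ge0_integral_act M (f : rv -> \bar R) :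
  (forall k, (k <= d)%N -> 0 < \det (rows_upto M k)) ->
  measurable_fun setT f -> (forall x, (0 <= f x)%E) ->
  (\int[lebd]_x f (act M x) = (\det M)^-1%:E * \int[lebd]_x f x)%E.
Proof.
move=> dM; have MM : rows_upto M d = M by apply/matrixP => i j; rewrite mxE ltn_ord.
suff H m : (m <= d)%N -> forall f : rv -> \bar R,
    measurable_fun setT f -> (forall x, (0 <= f x)%E) ->
    (\int[lebd]_x f (act (rows_upto M m) x) =
     (\det (rows_upto M m))^-1%:E * \int[lebd]_x f x)%E.
  by move: f; rewrite -[in act M]MM -[in \det M]MM => f; exact: H.
elim: m => [_|m IH md] {}f mf f0.
  have -> : rows_upto M 0 = 1%:M by apply/matrixP => i j; rewrite !mxE.
  rewrite det1 invr1 mul1e; apply: eq_integral => x _; by rewrite act1.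
have d0 := dM _ (ltnW md); have d1 := dM _ md.
have E := rows_uptoS M (Ordinal md) (lt0r_neq0 d0).
rewrite /= in E; set r := row _ _ *m _ in E.
have Ed : \det (rows_upto M m.+1) = r ord0 (Ordinal md) * \det (rows_upto M m).
  by rewrite E det_mulmx det_row_op.
have r0 : 0 < r ord0 (Ordinal md) by rewrite Ed pmulr_lgt0 in d1.
under eq_integral => x _ do rewrite E act_mul.
have mfa : measurable_fun setT (f \o act (row_op (Ordinal md) r)).
  exact: (measurableT_comp mf (measurable_act _)).
rewrite (IH (ltnW md) (f \o act (row_op (Ordinal md) r)) mfa (fun x => f0 _)) /=.
by rewrite ge0_integral_row_op// Ed invfM EFinM muleA [(_^-1%:E * _)%E]muleC.
Qed.

Lemma continuous_sum_fun {T : topologicalType} {I : Type} (s : seq I) (P : pred I) (F : I -> T -> R) :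
  (forall i, P i -> continuous (F i)) -> continuous (fun x => \sum_(i <- s | P i) F i x).
Proof.
move=> cF; elim: s => [|i s IH] x.
  by under eq_fun do rewrite big_nil; exact: cvg_cst.
have [Pi|Pi] := boolP (P i).
  under eq_fun do rewrite big_cons Pi.
  by apply: cvgD; [exact: cF|exact: IH].
by under eq_fun do rewrite big_cons (negbTE Pi); exact: IH.
Qed.

Lemma continuous_prod_fun {T : topologicalType} {I : Type} (s : seq I) (P : pred I) (F : I -> T -> R) :
  (forall i, P i -> continuous (F i)) -> continuous (fun x => \prod_(i <- s | P i) F i x).
Proof.
move=> cF; elim: s => [|i s IH] x.
  by under eq_fun do rewrite big_nil; exact: cvg_cst.
have [Pi|Pi] := boolP (P i).
  under eq_fun do rewrite big_cons Pi.
  by apply: cvgM; [exact: cF|exact: IH].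
by under eq_fun do rewrite big_cons (negbTE Pi); exact: IH.
Qed.

Lemma continuous_det_rows k : continuous (fun M : 'M[R]_d => \det (rows_upto M k)).
Proof.
apply: continuous_sum_fun => s _ M.
set c := (-1) ^+ _.
have C : (fun _ : 'M[R]_d => c : R) x @[x --> M] --> (c : R).
  by apply: (@cvg_cst _ c _ (nbhs M) (nbhs_filter M)).
apply: (cvgM C) => /=.
have H i j : continuous (fun N : 'M[R]_d => rows_upto N k i j).
  under eq_fun do rewrite mxE.
  by case: (i < k)%N; [exact: coord_continuous|exact: cst_continuous].
exact: (continuous_prod_fun _ _ _ (fun i _ => H i _) M).
Qed.

Lemma near1_det_rows : \forall M \near (1%:M : 'M[R]_d),
  forall k, (k <= d)%N -> 0 < \det (rows_upto M k).
Proof.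
have H k : \forall M \near (1%:M : 'M[R]_d), 0 < \det (rows_upto M k).
  apply: (cvgr_gt _ (@continuous_det_rows k 1%:M)).
  rewrite (_ : rows_upto _ k = 1%:M) ?det1//.
  by apply/matrixP => i j; rewrite !mxE; case: ifP.
have : \forall M \near (1%:M : 'M[R]_d), forall k : 'I_d.+1, 0 < \det (rows_upto M k).
  by apply: (@filter_forall _ _ _ _ (nbhs_filter (1%:M : 'M[R]_d))) => k; exact: H.
apply: filterS => M HM k kd; exact: (HM (Ordinal (kd : (k < d.+1)%N))).
Qed.

End linear_cov.

(** * The matrix exponential and the dilations t^E *)

Section mexp.
Context {R : realType}.

Lemma cvg_matrix {T : Type} (F : set_system T) {FF : Filter F} {m n}
    (f : T -> 'M[R]_(m, n)) (L : 'M[R]_(m, n)) :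
  (forall i j, f x i j @[x --> F] --> L i j) -> f @ F --> L.
Proof.
move=> H; apply/cvg_ballP => e e0.
have : \forall x \near F, forall i j, ball (L i j) e (f x i j).
  apply: filter_forall => i; apply: filter_forall => j.
  by have /cvg_ballP := H i j; exact.
by apply: filterS => x Hx.
Qed.

Lemma cvg_sumR {T I : Type} (F : set_system T) {FF : Filter F} (s : seq I)
    (f : I -> T -> R) (l : I -> R) :
  (forall i, f i x @[x --> F] --> l i) ->
  \sum_(i <- s) f i x @[x --> F] --> \sum_(i <- s) l i.
Proof.
move=> H; elim: s => [|i s IH].
  under eq_fun do rewrite big_nil; rewrite big_nil; exact: cvg_cst.
by under eq_fun do rewrite big_cons; rewrite big_cons; apply: cvgD.
Qed.

Lemma is_cvg_pseries_fact (g : nat -> R) (C B K : R) : 0 <= C -> 0 <= B ->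
  (forall n, `|g n| <= C * (B ^+ n / n`!%:R)) -> cvgn (pseries g K).
Proof.
move=> C0 B0 Hg; apply: normed_cvg.
apply: (@series_le_cvg _ _ (fun n => C * exp_coeff (B * `|K|) n)).
- by move=> n /=; exact: normr_ge0.
- by move=> n; rewrite mulr_ge0// exp_coeff_ge0// mulr_ge0.
- move=> n /=; rewrite normrM normrX /exp_coeff/= exprMn.
  apply: le_trans (_ : C * (B ^+ n / n`!%:R) * `|K| ^+ n <= _).
    by rewrite ler_wpM2r// exprn_ge0.
  by rewrite !mulrA [_ * _ / _ * _]mulrAC.
- exact: is_cvg_seriesZ (is_cvg_series_exp_coeff _).
Qed.

Context {d : nat}.
Implicit Types A E : 'M[R]_d.

(** Each entry of the exponential is treated as a scalar power series in s, so that termwise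
    differentiation of real power series applies. *)
Definition mexp_coef A i j (n : nat) : R := n`!%:R^-1 * (A ^+ n) i j.

Lemma pseries_diffs_mexp_coef A i j :
  pseries_diffs (mexp_coef A i j) = fun n => n`!%:R^-1 * (A * A ^+ n) i j.
Proof.
apply/funext => n; rewrite /pseries_diffs /mexp_coef factS natrM invfM exprS.
by rewrite -!mulrA mulVKf ?pnatr_eq0.
Qed.

Lemma pseries_diffs2_mexp_coef A i j :
  pseries_diffs (pseries_diffs (mexp_coef A i j)) =
  fun n => n`!%:R^-1 * (A * A * A ^+ n) i j.
Proof.
rewrite pseries_diffs_mexp_coef.
apply/funext => n; rewrite /pseries_diffs factS natrM invfM exprS.
by rewrite -!mulrA mulVKf ?pnatr_eq0.
Qed.

(** The factor d makes up for the max norm being submultiplicative only up to the dimension. *)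
Let B A : R := d%:R * `|A|.

Lemma mx_entry_norm {m n} (M : 'M[R]_(m, n)) i j : `|M i j| <= `|M|.
Proof.
rewrite [leRHS]/Num.norm/= mx_normrE.
exact: (le_bigmax _ (fun ij => `|M ij.1 ij.2|) (i, j)).
Qed.

Lemma mulmx_norm {m n p} (M : 'M[R]_(m, n)) (N : 'M[R]_(n, p)) :
  `|M *m N| <= n%:R * `|M| * `|N|.
Proof.
rewrite [leLHS]/Num.norm/= mx_normrE; apply: bigmax_le => [|[i j] _ /=].
  by rewrite !mulr_ge0.
rewrite mxE; apply: le_trans (ler_norm_sum _ _ _) _.
apply: le_trans (ler_sum _ (G := fun=> `|M| * `|N|) _) _.
  by move=> k _; rewrite normrM ler_pM// mx_entry_norm.
by rewrite sumr_const card_ord -[leLHS]mulr_natl mulrA.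
Qed.

Lemma mexp_term_bound A (M : 'M[R]_d) n : `|M * A ^+ n| <= `|M| * B A ^+ n.
Proof.
elim: n => [|n IH]; first by rewrite !expr0 !mulr1.
rewrite exprSr mulrA; apply: le_trans (mulmx_norm (M * A ^+ n) A) _.
rewrite exprSr mulrA [d%:R * _ * _]mulrAC -/(B A) mulrC.
by rewrite ler_wpM2r// mulr_ge0.
Qed.

Lemma is_cvg_mexp_gen A (M : 'M[R]_d) i j K :
  cvgn (pseries (fun n => n`!%:R^-1 * (M * A ^+ n) i j) K).
Proof.
apply: (is_cvg_pseries_fact _ `|M| (B A)) => //; first by rewrite mulr_ge0.
move=> n; rewrite normrM ger0_norm ?invr_ge0// mulrC mulrA ler_wpM2r ?invr_ge0//.
exact: le_trans (mx_entry_norm _ _ _) (mexp_term_bound _ _ _).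
Qed.

Lemma is_cvg_mexp_coef A i j K : cvgn (pseries (mexp_coef A i j) K).
Proof.
have := is_cvg_mexp_gen A 1 i j K.
by under eq_fun do rewrite mul1r.
Qed.

Lemma exprZmx A (s : R) k : (s *: A) ^+ k = s ^+ k *: A ^+ k.
Proof.
elim: k => [|k IH]; first by rewrite !expr0 scale1r.
rewrite !exprS IH -[_ * _]/(_ *m _) -scalemxAl -scalemxAr scalerA.
by rewrite -[A * _]/(A *m _).
Qed.

Lemma cvg_mexp A (s : R) :
  (fun N => \sum_(k < N) (k`!%:R)^-1 *: (s *: A) ^+ k) @ \oo -->
  (\matrix_(i, j) limn (pseries (mexp_coef A i j) s) : 'M[R]_d).
Proof.
apply: cvg_matrix => i j; rewrite mxE.
have := is_cvg_mexp_coef A i j s; apply: cvg_trans.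
apply: near_eq_cvg; apply: nearW => N.
rewrite /pseries /series /= big_mkord summxE; apply: eq_bigr => k _.
by rewrite exprZmx !mxE /mexp_coef mulrA mulrAC.
Qed.

Lemma mexpE A (s : R) i j : mexp (s *: A) i j = limn (pseries (mexp_coef A i j) s).
Proof. by rewrite /mexp (cvg_lim _ (cvg_mexp A s))// mxE. Qed.

Lemma cvg_mexp_lim A (s : R) :
  (fun N => \sum_(k < N) (k`!%:R)^-1 *: (s *: A) ^+ k) @ \oo --> mexp (s *: A).
Proof. by rewrite [X in _ --> X](cvg_lim _ (cvg_mexp A s))//; exact: cvg_mexp. Qed.

Lemma cvg_mexp_entry A (s : R) i j :
  (fun N => (\sum_(k < N) (k`!%:R)^-1 *: (s *: A) ^+ k : 'M[R]_d) i j) @ \oo -->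
  mexp (s *: A) i j.
Proof.
exact: (cvg_comp _ (fun M : 'M[R]_d => M i j) (cvg_mexp_lim A s)
  (@coord_continuous _ _ _ i j (mexp (s *: A)))).
Qed.

Global Instance is_derive_mexp A (s : R) i j :
  is_derive s 1 (fun s => mexp (s *: A) i j) ((A *m mexp (s *: A)) i j).
Proof.
have -> : (fun s => mexp (s *: A) i j) = fun s => limn (pseries (mexp_coef A i j) s).
  by apply/funext => t; rewrite mexpE.
have -> : (A *m mexp (s *: A)) i j = limn (pseries (pseries_diffs (mexp_coef A i j)) s).
  rewrite mxE; under eq_bigr do rewrite mexpE.
  apply/esym/cvg_lim => //.
  have H : (fun N => \sum_l A i l * pseries (mexp_coef A l j) s N) @ \oo -->
     \sum_l A i l * limn (pseries (mexp_coef A l j) s).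
    apply: cvg_sumR => l; apply: cvgM; first exact: cvg_cst.
    exact: is_cvg_mexp_coef.
  apply: cvg_trans H; apply: near_eq_cvg; apply: nearW => N.
  rewrite pseries_diffs_mexp_coef /pseries /series /=.
  under eq_bigr do rewrite big_distrr/=.
  rewrite exchange_big/=; apply: eq_bigr => n _.
  rewrite mxE mulr_sumr mulr_suml; apply: eq_bigr => l _.
  by rewrite /mexp_coef !mulrA [A i l * _]mulrC.
(* The series converge everywhere, so any radius beyond |s| serves. *)
apply: (@pseries_snd_diffs _ _ (`|s| + 1)).
- exact: is_cvg_mexp_coef.
- by rewrite pseries_diffs_mexp_coef; exact: is_cvg_mexp_gen.
- by rewrite pseries_diffs2_mexp_coef; exact: is_cvg_mexp_gen.
- by rewrite [ltRHS]ger0_norm ?addr_ge0// ltrDl.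
Qed.

Lemma mexp0 : mexp (0 : 'M[R]_d) = 1%:M.
Proof.
have H := cvg_mexp (0 : 'M[R]_d) 0; apply/(cvg_lim (@norm_hausdorff _ _)).
apply: cvg_near_cst; exists 1%N => // -[//|N] _.
rewrite big_ord_recl/= expr0 fact0 invr1 scale1r big1 ?addr0// => i _.
by rewrite expr0n /= scaler0.
Qed.

Lemma mexp_comm A (s : R) : A *m mexp (s *: A) = mexp (s *: A) *m A.
Proof.
apply/matrixP => i j.
have H1 : (fun N => (A *m \sum_(k < N) (k`!%:R)^-1 *: (s *: A) ^+ k) i j) @ \oo -->
    (A *m mexp (s *: A)) i j.
  under eq_fun do rewrite mxE.
  rewrite mxE; apply: cvg_sumR => l; apply: cvgM; first exact: cvg_cst.
  exact: cvg_mexp_entry.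
have H2 : (fun N => ((\sum_(k < N) (k`!%:R)^-1 *: (s *: A) ^+ k) *m A) i j) @ \oo -->
    (mexp (s *: A) *m A) i j.
  under eq_fun do rewrite mxE.
  rewrite mxE; apply: cvg_sumR => l; apply: cvgM; last exact: cvg_cst.
  exact: cvg_mexp_entry.
rewrite -(cvg_lim _ H1)// -(cvg_lim _ H2)//; congr (limn _).
apply/funext => N; congr (fun_of_matrix _ i j).
rewrite mulmx_sumr mulmx_suml; apply: eq_bigr => k _.
rewrite exprZmx -!scalemxAl -!scalemxAr -[A *m _]/(A * _) -[_ *m A]/(_ * A).
by rewrite -exprS -exprSr.
Qed.

Lemma is_derive_sum_fin {I : finType} (f : I -> R -> R) (df : I -> R) (s : R) :
  (forall i, is_derive s 1 (f i) (df i)) ->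
  is_derive s 1 (fun s => \sum_i f i s) (\sum_i df i).
Proof.
move=> H; elim: (index_enum I) => [|i r IH].
  rewrite big_nil; under eq_fun do rewrite big_nil; exact: is_derive_cst.
rewrite big_cons; under eq_fun do rewrite big_cons; exact: is_deriveD.
Qed.

(** The entries of u |-> exp((s+t-u) A) exp(u A) have derivative zero; the values at u = t and u = 0
    are the two sides. *)
Lemma mexpD A (s t : R) : mexp ((s + t) *: A) = mexp (s *: A) *m mexp (t *: A).
Proof.
apply/matrixP => i j; apply/esym.
pose f u := (mexp ((s + t - u) *: A) *m mexp (u *: A)) i j.
have df x : is_derive x (1 : R) f 0.
  pose F l u := mexp ((s + t - u) *: A) i l * mexp (u *: A) l j.
  pose DF l := mexp ((s + t - x) *: A) i l *: (A *m mexp (x *: A)) l j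
      + mexp (x *: A) l j *: - (mexp ((s + t - x) *: A) *m A) i l.
  have HF l : is_derive x (1 : R) (F l) (DF l).
    have h : is_derive x 1 (fun u => mexp ((s + t - u) *: A) i l)
        (- (mexp ((s + t - x) *: A) *m A) i l).
      rewrite -mexp_comm -mulrN1.
      have h1 : is_derive x 1 (fun u : R => s + t - u) (-1).
        by apply: is_derive_eq; rewrite add0r mul1r.
      exact: (@is_derive1_comp R (fun v => mexp (v *: A) i l) (fun u => s + t - u) x
        _ (-1) (is_derive_mexp A (s + t - x) i l) h1).
    exact: (is_deriveM h (is_derive_mexp A x l j)).
  have S0 : \sum_l DF l = 0.
    rewrite big_split/= /GRing.scale/=.
    have -> : \sum_l mexp ((s + t - x) *: A) i l * (A *m mexp (x *: A)) l j =
       (mexp ((s + t - x) *: A) *m (A *m mexp (x *: A))) i j by rewrite [RHS]mxE.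
    rewrite [X in _ + X](_ : _ = - (mexp ((s + t - x) *: A) *m A *m mexp (x *: A)) i j).
      by rewrite mulmxA addrN.
    by rewrite [in RHS]mxE -sumrN; apply: eq_bigr => l _; rewrite mulrN mulrC.
  have := is_derive_sum_fin F DF x HF; rewrite S0.
  by rewrite (_ : (fun u => \sum_l F l u) = f)//; apply/funext => u; rewrite /f mxE.
have := @is_derive_0_is_cst R f t 0 df.
rewrite /f subr0 scale0r mexp0 mulmx1 => <-.
by rewrite addrK.
Qed.

End mexp.

(** * Determinant and Jacobian of the matrix exponential *)

Section mexp_det.
Context {R : realType}.

Lemma derivable_prod_fun {I : Type} (r : seq I) (P : pred I) (f : I -> R -> R) (x : R) :
  (forall i, derivable (f i) x 1) -> derivable (fun s => \prod_(i <- r | P i) f i s) x 1.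
Proof.
move=> H; elim: r => [|i r IH].
  under eq_fun do rewrite big_nil; exact: derivable_cst.
have [Pi|Pi] := boolP (P i).
  by under eq_fun do rewrite big_cons Pi; exact: derivableM.
by under eq_fun do rewrite big_cons (negbTE Pi).
Qed.

Lemma is_derive_prod1 {I : Type} (r : seq I) (f : I -> R -> R) (df : I -> R) (x : R) :
  (forall i, f i x = 1) -> (forall i, is_derive x 1 (f i) (df i)) ->
  is_derive x 1 (fun s => \prod_(i <- r) f i s) (\sum_(i <- r) df i).
Proof.
move=> f1 H; elim: r => [|i r IH].
  rewrite big_nil; under eq_fun do rewrite big_nil; exact: is_derive_cst.
rewrite big_cons; under eq_fun do rewrite big_cons.
have P1 : \prod_(j <- r) f j x = 1 by rewrite big1.
by have := is_deriveM (H i) IH; rewrite f1 P1 !scale1r addrC.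
Qed.

Lemma is_derive_prod0 {I : finType} (f : I -> R -> R) (x : R) i j : i != j ->
  f i x = 0 -> f j x = 0 -> (forall i, derivable (f i) x 1) ->
  is_derive x 1 (fun s => \prod_i f i s) 0.
Proof.
move=> ij fi fj df.
pose g s := \prod_(k | (k != i) && (k != j)) f k s.
have -> : (fun s => \prod_i f i s) = f i * (f j * g).
  apply/funext => s; rewrite (bigD1 i)//= (bigD1 j)//=.
  by rewrite eq_sym.
have dg : derivable g x 1 by exact: derivable_prod_fun.
have dj : is_derive x 1 (f j) ('D_1 (f j) x) by apply: DeriveDef.
have di : is_derive x 1 (f i) ('D_1 (f i) x) by apply: DeriveDef.
have dg' : is_derive x 1 g ('D_1 g x) by apply: DeriveDef.
have := is_deriveM di (is_deriveM dj dg').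
have z : (f j * g) x = 0 by rewrite -[LHS]/(f j x * g x) fj mul0r.
by rewrite fi scale0r add0r z scale0r.
Qed.

Context {d : nat}.
Implicit Types A E : 'M[R]_d.

Let Y0 A i j : mexp (0 *: A) i j = (i == j)%:R.
Proof. by rewrite scale0r mexp0 mxE. Qed.

(** In the Leibniz expansion the identity permutation has all factors equal to 1 at s = 0 and
    contributes the trace. Any other permutation moves at least two indices, so two factors of its
    product vanish there and its derivative is zero. *)
Lemma is_derive_det_mexp0 A : is_derive (0 : R) (1 : R) (fun s : R => \det (mexp (s *: A))) (\tr A).
Proof.
pose D (s : perm_type 'I_d) : R := if s == 1%g then \tr A else 0.
pose F (s : perm_type 'I_d) (u : R) := (-1) ^+ odd_perm s *
  \prod_i mexp (u *: A) i (fun_of_perm s i).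
have trE : \sum_s (-1) ^+ odd_perm s * D s = \tr A.
  rewrite (bigD1 1%g)//= /D eqxx odd_perm1 mul1r big1 ?addr0// => s s1.
  by rewrite (negbTE s1) mulr0.
have HF s : is_derive (0 : R) (1 : R) (F s) ((-1) ^+ odd_perm s * D s).
  suff H : is_derive (0 : R) (1 : R) (fun u => \prod_i mexp (u *: A) i (fun_of_perm s i)) (D s).
    exact: (is_deriveZ _ H).
  rewrite /D; case: eqVneq => [->|s1].
    have E i : (A *m mexp (0 *: A)) i i = A i i by rewrite scale0r mexp0 mulmx1.
    rewrite /mxtrace; under eq_bigr do rewrite -E.
    apply: is_derive_prod1 => i; first by rewrite perm1 Y0 eqxx.
    by rewrite perm1; exact: is_derive_mexp.
  have [i si] : exists i, fun_of_perm s i != i.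
    apply/existsP; apply: contraNT s1 => /existsPn H; apply/eqP/permP => i.
    by rewrite perm1; apply/eqP; have := H i; rewrite negbK.
  apply: (@is_derive_prod0 _ _ _ i (fun_of_perm s i)).
  - by rewrite eq_sym.
  - by rewrite Y0 eq_sym (negbTE si).
  - rewrite Y0; case: eqP => // /perm_inj e.
    by rewrite -e eqxx in si.
  - by move=> k; apply: ex_derive; exact: is_derive_mexp.
by have := is_derive_sum_fin F _ 0 HF; rewrite trE.
Qed.

(** The determinant turns addition of parameters into multiplication, which carries the derivative
    at 0 to every point: D' = tr(A) D. Hence D(s) exp(-s tr A) is constant. *)
Lemma det_mexp A (s : R) : \det (mexp (s *: A)) = expR (s * \tr A).
Proof.
pose D s := \det (mexp (s *: A)).
have D0 : D 0 = 1 by rewrite /D scale0r mexp0 det1.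
have DD u v : D (u + v) = D u * D v by rewrite /D mexpD det_mulmx.
have dD x : is_derive x (1 : R) D (D x * \tr A).
  have h : is_derive x (1 : R) (fun u => u - x) 1.
    by apply: is_derive_eq; ring.
  have h0 : is_derive (x - x) (1 : R) D (\tr A).
    by rewrite subrr; exact: is_derive_det_mexp0.
  have := is_deriveZ (D x) (@is_derive1_comp R D (fun u => u - x) x _ _ h0 h).
  rewrite mulr1; congr (is_derive x 1 _ _).
  by apply/funext => u; rewrite -[LHS]/(D x * D (u - x)) -DD addrC subrK.
pose f u := D u * expR (- (u * \tr A)).
have df x : is_derive x (1 : R) f 0.
  have h : is_derive x (1 : R) (fun u => - (u * \tr A)) (- \tr A).
    by apply: is_derive_eq; rewrite /GRing.scale/=; ring.
  have := is_deriveM (dD x) (@is_derive1_comp R expR _ x _ _ (is_derive_expR _) h).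
  by congr (is_derive x 1 _ _); rewrite /GRing.scale/=; ring.
have := @is_derive_0_is_cst R f s 0 df.
rewrite /f D0 mul0r oppr0 expR0 mulr1 expRN => H.
have e0 := lt0r_neq0 (expR_gt0 (s * \tr A)).
by rewrite -/(D s) -[LHS](mulfVK e0) H mul1r.
Qed.

Lemma continuous_mexp A : continuous (fun s : R => mexp (s *: A)).
Proof.
move=> s; apply: cvg_matrix => i j.
have : derivable (fun u : R => mexp (u *: A) i j) s 1.
  by apply: ex_derive; exact: is_derive_mexp.
by move=> /derivable1_diffP/differentiable_continuous.
Qed.

(** For s near 0 the matrix is close to the identity and factors into shears. The formula is stable
    under addition of parameters, so a general s is reached as n+1 copies of s/(n+1). *)
Lemma ge0_integral_mexp A (s : R) (f : 'rV[R]_d -> \bar R) :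
  measurable_fun setT f -> (forall x, (0 <= f x)%E) ->
  (\int[lebd]_x f (act (mexp (s *: A)) x) =
   (expR (- (s * \tr A)))%:E * \int[lebd]_x f x)%E.
Proof.
pose P s := forall f : 'rV[R]_d -> \bar R,
  measurable_fun setT f -> (forall x, (0 <= f x)%E) ->
  (\int[lebd]_x f (act (mexp (s *: A)) x) =
   (expR (- (s * \tr A)))%:E * \int[lebd]_x f x)%E.
suff : P s by exact.
have P0 : \forall u \near (0 : R), P u.
  have C : mexp (u *: A) @[u --> (0 : R)] --> (1%:M : 'M[R]_d).
    by rewrite -mexp0 -(scale0r A); exact: continuous_mexp.
  apply: (@filterS R (nbhs (0 : R)) (nbhs_filter _) _ _ _ (C _ near1_det_rows)) => u Hu g mg g0.
  by rewrite ge0_integral_act// det_mexp expRN.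
have PD u v : P u -> P v -> P (u + v).
  move=> Pu Pv g mg g0; rewrite mexpD.
  under eq_integral do rewrite act_mul.
  have mga : measurable_fun setT (g \o act (mexp (u *: A))).
    exact: (measurableT_comp mg (measurable_act _)).
  rewrite (Pv (g \o act (mexp (u *: A))) mga (fun x => g0 _)) /=.
  by rewrite Pu// muleA -EFinM -expRD; congr ((expR _)%:E * _)%E; ring.
have PM n u : P u -> P (n.+1%:R * u).
  move=> Pu; elim: n => [|n IH]; first by rewrite mul1r.
  by rewrite -natr1 mulrDl mul1r; exact: PD.
have /nbhs_ballP[e /= e0 He] := P0.
have [n Hn] : exists n : nat, `|s| / e < n.+1%:R.
  by exists (Num.truncn (`|s| / e)); exact: truncnS_gt.
have -> : s = n.+1%:R * (s / n.+1%:R) by rewrite mulrC divfK.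
apply: PM; apply: He; rewrite /ball/= sub0r normrN normrM normfV.
by rewrite [`|n.+1%:R|]ger0_norm// ltr_pdivrMr// mulrC -ltr_pdivrMr.
Qed.

End mexp_det.

Section scaling_integral.
Context {R : realType} {d : nat}.
Local Notation rv := 'rV[R]_d.
Variables (a : rv -> rv) (c : R).
Hypotheses (ma : measurable_fun setT a) (c0 : 0 <= c).
Hypothesis H : forall f : rv -> \bar R,
  measurable_fun setT f -> (forall x, (0 <= f x)%E) ->
  (\int[lebd]_x f (a x) = c%:E * \int[lebd]_x f x)%E.

Lemma integrable_scaling (f : rv -> \bar R) :
  lebd.-integrable setT f -> lebd.-integrable setT (f \o a).
Proof.
move=> /integrableP[mf fi]; apply/integrableP; split; first exact: (measurableT_comp mf ma).
rewrite -[ltLHS]/(\int[lebd]_x (fun y => `|f y|)%E (a x))%E H//.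
  by apply: lte_mul_pinfty => //; rewrite lee_fin.
exact: measurableT_comp.
Qed.

Lemma integral_scaling (f : rv -> \bar R) :
  lebd.-integrable setT f -> (\int[lebd]_x f (a x) = c%:E * \int[lebd]_x f x)%E.
Proof.
move=> fi; have /integrableP[mf _] := fi.
rewrite integralE [in RHS]integralE muleBr//; last first.
  apply: fin_num_adde_defl.
  by rewrite fin_numN; apply: integrable_fin_num => //; exact: integrable_funeneg.
rewrite -!H//; try exact: measurable_funepos; try exact: measurable_funeneg.
by congr (_ - _)%E; apply: eq_integral => x _; rewrite ?funeposE ?funenegE.
Qed.

Lemma Rintegral_scaling (f : rv -> R) :
  lebd.-integrable setT (EFin \o f) -> \int[lebd]_x f (a x) = c * \int[lebd]_x f x.
Proof.
move=> fi; rewrite /Rintegral (integral_scaling (EFin \o f) fi) fineM//.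
by apply: integrable_fin_num.
Qed.

End scaling_integral.

Section tpow.
Context {R : realType} {d : nat}.
Local Notation rv := 'rV[R]_d.
Local Notation mR := (measurableTypeR R).
Implicit Types (E : 'M[R]_d) (s t : R).

Lemma tpowM s t E : 0 < s -> 0 < t -> tpow (s * t) E = tpow s E *m tpow t E.
Proof. by move=> s0 t0; rewrite /tpow lnM// mexpD. Qed.

Lemma tpow1 E : tpow 1 E = 1%:M.
Proof. by rewrite /tpow ln1 scale0r mexp0. Qed.

Lemma act_tpowM s t E (x : rv) : 0 < s -> 0 < t ->
  act (tpow (s * t) E) x = act (tpow s E) (act (tpow t E) x).
Proof. by move=> s0 t0; rewrite tpowM// act_mul. Qed.

Lemma act_tpow1 E (x : rv) : act (tpow 1 E) x = x.
Proof. by rewrite tpow1 act1. Qed.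

Lemma act_tpowK t E (x : rv) : 0 < t -> act (tpow t E) (act (tpow t^-1 E) x) = x.
Proof. by move=> t0; rewrite -act_tpowM ?invr_gt0// mulfV ?gt_eqF// act_tpow1. Qed.

Lemma act_tpowVK t E (x : rv) : 0 < t -> act (tpow t^-1 E) (act (tpow t E) x) = x.
Proof. by move=> t0; rewrite -act_tpowM ?invr_gt0// mulVf ?gt_eqF// act_tpow1. Qed.

Lemma tpowZ t (c : R) E : 0 < t -> tpow t (c *: E) = tpow (t `^ c) E.
Proof. by move=> t0; rewrite /tpow ln_powR scalerA mulrC. Qed.

Lemma tpow_tr t E : tpow t E^T = (tpow t E)^T.
Proof.
apply/matrixP => i j; rewrite [RHS]mxE /tpow.
rewrite -(cvg_lim _ (cvg_mexp_entry E (ln t) j i))//.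
rewrite -(cvg_lim _ (cvg_mexp_entry E^T (ln t) i j))//; congr (limn _).
apply/funext => N; rewrite !summxE; apply: eq_bigr => k _.
rewrite !mxE; congr (_ * _).
have T (A : 'M[R]_d) n : (A^T) ^+ n = (A ^+ n)^T.
  elim: n => [|n IH]; first by rewrite !expr0 trmx1.
  by rewrite exprS IH exprSr -[_ * _]/(_ *m _) -trmx_mul.
by rewrite -linearZ/= T mxE.
Qed.

Lemma ge0_integral_tpow s E (f : rv -> \bar R) : 0 < s ->
  measurable_fun setT f -> (forall x, (0 <= f x)%E) ->
  (\int[lebd]_x f (act (tpow s E) x) = (s `^ (- \tr E))%:E * \int[lebd]_x f x)%E.
Proof.
move=> s0 mf f0; rewrite /tpow ge0_integral_mexp//.
by rewrite /powR gt_eqF// mulNr mulrC.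
Qed.

Lemma integrable_tpow s E (f : rv -> \bar R) : 0 < s ->
  lebd.-integrable setT f -> lebd.-integrable setT (f \o act (tpow s E)).
Proof.
move=> s0; apply: (@integrable_scaling _ _ _ (s `^ (- \tr E))).
- exact: measurable_act.
- exact: powR_ge0.
- by move=> g mg g0; exact: ge0_integral_tpow.
Qed.

Lemma Rintegral_tpow s E (f : rv -> R) : 0 < s ->
  lebd.-integrable setT (EFin \o f) ->
  \int[lebd]_x f (act (tpow s E) x) = s `^ (- \tr E) * \int[lebd]_x f x.
Proof.
by move=> s0; apply: Rintegral_scaling => g mg g0; exact: ge0_integral_tpow.
Qed.

Lemma is_derive_tpow t E i j : 0 < t ->
  is_derive t (1 : R) (fun t => tpow t E i j) ((E *m tpow t E) i j / t).
Proof.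
move=> t0; have := @is_derive1_comp R (fun s => mexp (s *: E) i j) (@ln R) t _ _
  (is_derive_mexp E (ln t) i j) (is_derive1_ln t0).
exact.
Qed.

Lemma measurable_act_tpow E :
  measurable_fun setT (fun p : mR * rv => act (tpow p.1 E) p.2).
Proof.
apply: measurable_rVP => i.
rewrite (_ : (fun _ => _) = (fun p : mR * rv => \sum_j tpow p.1 E i j * p.2 ord0 j)); last first.
  by apply/funext => p; rewrite actE.
apply: measurable_sum => j; apply: measurable_funM.
  apply: (@measurableT_comp _ _ _ _ _ _ (fun t : mR => tpow t E i j)) => //.
  apply: (@measurableT_comp _ _ _ _ _ _ (fun s : mR => mexp (s *: E) i j)); last exact: measurable_ln.
  apply: continuous_measurable_fun => s.
  exact: (@continuous_comp _ _ _ (fun s : R => mexp (s *: E)) (fun M : 'M[R]_d => M i j) s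
    (continuous_mexp E s) (@coord_continuous _ _ _ i j _)).
apply: (@measurableT_comp _ _ _ _ _ _ (fun x : rv => x ord0 j)) => //.
exact: measurable_coord.
Qed.

End tpow.

(** * Complex-valued integrals *)

Section complex_facts.
Context {R : realType}.
Implicit Types z w : R[i].
Local Notation Re := complex.Re.
Local Notation Im := complex.Im.

Lemma complex_ext z w : Re z = Re w -> Im z = Im w -> z = w.
Proof. by case: z => a b; case: w => c e /= -> ->. Qed.

Lemma ReM z w : Re (z * w) = Re z * Re w - Im z * Im w.
Proof. by case: z => a b; case: w. Qed.
Lemma ImM z w : Im (z * w) = Re z * Im w + Im z * Re w.
Proof. by case: z => a b; case: w. Qed.
Lemma ReD z w : Re (z + w) = Re z + Re w.
Proof. by case: z => a b; case: w. Qed.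
Lemma ImD z w : Im (z + w) = Im z + Im w.
Proof. by case: z => a b; case: w. Qed.
Lemma ReN z : Re (- z) = - Re z. Proof. by case: z. Qed.
Lemma ImN z : Im (- z) = - Im z. Proof. by case: z. Qed.
Lemma ReB z w : Re (z - w) = Re z - Re w. Proof. by rewrite ReD ReN. Qed.
Lemma ImB z w : Im (z - w) = Im z - Im w. Proof. by rewrite ImD ImN. Qed.
Lemma Re_sum {I : Type} (s : seq I) (F : I -> R[i]) :
  Re (\sum_(i <- s) F i) = \sum_(i <- s) Re (F i).
Proof. by elim: s => [|i s IH]; rewrite ?big_nil// !big_cons ReD IH. Qed.
Lemma Im_sum {I : Type} (s : seq I) (F : I -> R[i]) :
  Im (\sum_(i <- s) F i) = \sum_(i <- s) Im (F i).
Proof. by elim: s => [|i s IH]; rewrite ?big_nil// !big_cons ImD IH. Qed.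

Lemma cmod_ge0 z : 0 <= cmod z.
Proof. by case: z => a b; exact: sqrtr_ge0. Qed.
Lemma cmodM z w : cmod (z * w) = cmod z * cmod w.
Proof. exact: Normc.normcM. Qed.
Lemma cmodV z : cmod z^-1 = (cmod z)^-1.
Proof. exact: Normc.normcV. Qed.
Lemma cmod0 : cmod (0 : R[i]) = 0. Proof. exact: Normc.normc0. Qed.
Lemma cmod1 : cmod (1 : R[i]) = 1. Proof. exact: Normc.normc1. Qed.
Lemma cmodX z n : cmod (z ^+ n) = cmod z ^+ n.
Proof. by elim: n => [|n IH]; rewrite ?expr0 ?cmod1// !exprS cmodM IH. Qed.
Lemma cmodN z : cmod (- z) = cmod z.
Proof. by case: z => a b; rewrite /cmod /= !sqrrN. Qed.
Lemma cmodD z w : cmod (z + w) <= cmod z + cmod w.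
Proof.
have := ler_normD z w; rewrite /Num.norm/= -rmorphD/=.
by rewrite lecR.
Qed.
Lemma cmodB z w : cmod (z - w) <= cmod z + cmod w.
Proof. by rewrite -(cmodN w) cmodD. Qed.
Lemma cmod_sum {I : Type} (s : seq I) (F : I -> R[i]) :
  cmod (\sum_(i <- s) F i) <= \sum_(i <- s) cmod (F i).
Proof.
elim: s => [|i s IH]; first by rewrite !big_nil cmod0.
by rewrite !big_cons (le_trans (cmodD _ _))// lerD2l.
Qed.
Lemma cmod_real (x : R) : cmod x%:C = `|x|.
Proof. by rewrite /cmod /= expr0n addr0 sqrtr_sqr. Qed.
Lemma Re_le_cmod z : `|Re z| <= cmod z.
Proof.
by case: z => a b; rewrite /cmod /= -sqrtr_sqr ler_wsqrtr// lerDl sqr_ge0.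
Qed.
Lemma Im_le_cmod z : `|Im z| <= cmod z.
Proof.
by case: z => a b; rewrite /cmod /= -sqrtr_sqr ler_wsqrtr// lerDr sqr_ge0.
Qed.
Lemma cmod_le_ReIm z : cmod z <= `|Re z| + `|Im z|.
Proof.
have -> : z = (Re z)%:C + (0 +i* Im z) by apply: complex_ext; rewrite ?ReD ?ImD/= ?addr0 ?add0r.
apply: le_trans (cmodD _ _) _; rewrite cmod_real.
rewrite ReD ImD /= addr0 add0r lerD2l.
by rewrite /cmod /= expr0n add0r sqrtr_sqr.
Qed.

Lemma cexpD z w : cexp (z + w) = cexp z * cexp w.
Proof.
by apply: complex_ext; rewrite ?ReM ?ImM /cexp /= ReD ImD expRD ?cosD ?sinD; ring.
Qed.
Lemma cexp0 : cexp (0 : R[i]) = 1.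
Proof. by apply: complex_ext; rewrite /cexp /= expR0 ?cos0 ?sin0 ?mul1r// mulr0. Qed.
Lemma cmod_cexp z : cmod (cexp z) = expR (Re z).
Proof.
rewrite /cmod /cexp /= !exprMn -mulrDr cos2Dsin2 mulr1.
by rewrite sqrtr_sqr ger0_norm ?expR_ge0.
Qed.
Lemma cexpX z n : cexp z ^+ n = cexp (n%:R * z).
Proof.
elim: n => [|n IH]; first by rewrite expr0 mul0r cexp0.
by rewrite exprS IH -cexpD -natr1 mulrDl mul1r addrC.
Qed.
Lemma natcE n : (n%:R : R[i]) = (n%:R : R)%:C.
Proof. by rewrite rmorph_nat. Qed.

End complex_facts.

Section cint.
Context {R : realType} {d : nat}.
Local Notation rv := 'rV[R]_d.
Local Notation Re := complex.Re.
Local Notation Im := complex.Im.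
Implicit Types f g : rv -> R[i].

Definition cmeasurable f :=
  measurable_fun setT (fun x => Re (f x)) /\ measurable_fun setT (fun x => Im (f x)).

Definition cintegrable f := lebd.-integrable setT (fun x => (Re (f x))%:E) /\
  lebd.-integrable setT (fun x => (Im (f x))%:E).

Definition cint f : R[i] :=
  (\int[lebd]_x Re (f x)) +i* (\int[lebd]_x Im (f x)).

Lemma cmeasurableM f g : cmeasurable f -> cmeasurable g -> cmeasurable (fun x => f x * g x).
Proof.
move=> [fr fi] [gr gi]; split.
  by under eq_fun do rewrite ReM; apply: measurable_funB; apply: measurable_funM.
by under eq_fun do rewrite ImM; apply: measurable_funD; apply: measurable_funM.
Qed.

Lemma cmeasurableB f g : cmeasurable f -> cmeasurable g -> cmeasurable (fun x => f x - g x).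
Proof.
move=> [fr fi] [gr gi]; split.
  by under eq_fun do rewrite ReB; exact: measurable_funB.
by under eq_fun do rewrite ImB; exact: measurable_funB.
Qed.

Lemma cmeasurableX f n : cmeasurable f -> cmeasurable (fun x => f x ^+ n).
Proof.
move=> mf; elim: n => [|n IH].
  by under eq_fun do rewrite expr0; split; exact: measurable_cst.
by under eq_fun do rewrite exprS; exact: cmeasurableM.
Qed.

Lemma cmeasurable_cst (c : R[i]) : cmeasurable (fun=> c).
Proof. by split; exact: measurable_cst. Qed.

Lemma cmeasurable_cexp f : cmeasurable f -> cmeasurable (fun x => cexp (f x)).
Proof.
move=> [fr fi]; split; rewrite /cexp /=; apply: measurable_funM;
  try exact: (measurableT_comp (@measurable_expR R) fr).
  apply: measurableT_comp fi; apply: continuous_measurable_fun; exact: continuous_cos.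
apply: measurableT_comp fi; apply: continuous_measurable_fun; exact: continuous_sin.
Qed.

Lemma cintegrable_le f (g : rv -> R) : cmeasurable f ->
  lebd.-integrable setT (EFin \o g) -> (forall x, cmod (f x) <= g x) -> cintegrable f.
Proof.
move=> [fr fi] ig fg; split; apply: le_integrable ig => //; try exact/measurable_EFinP.
  move=> x _ /=; rewrite lee_fin (le_trans (Re_le_cmod _))// (le_trans (fg x))//.
  exact: ler_norm.
move=> x _ /=; rewrite lee_fin (le_trans (Im_le_cmod _))// (le_trans (fg x))//.
exact: ler_norm.
Qed.

Lemma cintegrable_measurable f : cintegrable f -> cmeasurable f.
Proof.
by move=> [/integrableP[fr _] /integrableP[fi _]]; split; exact/measurable_EFinP.
Qed.

Lemma cintegrableZ (c : R[i]) f : cintegrable f -> cintegrable (fun x => c * f x).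
Proof.
move=> [fr fi]; split.
  under eq_fun do rewrite ReM EFinB !EFinM.
  by apply: integrableB => //; apply: integrableZl.
under eq_fun do rewrite ImM EFinD !EFinM.
by apply: integrableD => //; apply: integrableZl.
Qed.

Lemma cintegrableD f g : cintegrable f -> cintegrable g -> cintegrable (fun x => f x + g x).
Proof.
move=> [fr fi] [gr gi]; split.
  by under eq_fun do rewrite ReD EFinD; exact: integrableD.
by under eq_fun do rewrite ImD EFinD; exact: integrableD.
Qed.

Lemma cintZ (c : R[i]) f : cintegrable f -> cint (fun x => c * f x) = c * cint f.
Proof.
move=> [fr fi].
have I1 (r : R) : lebd.-integrable setT (EFin \o (fun x => r * Re (f x))).
  by rewrite /comp; under eq_fun do rewrite EFinM; exact: integrableZl.
have I2 (r : R) : lebd.-integrable setT (EFin \o (fun x => r * Im (f x))).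
  by rewrite /comp; under eq_fun do rewrite EFinM; exact: integrableZl.
apply: complex_ext; rewrite ?ReM ?ImM /=.
  under eq_Rintegral do rewrite ReM.
  by rewrite (RintegralB _ (I1 _) (I2 _))// !RintegralZl.
under eq_Rintegral do rewrite ImM.
by rewrite (RintegralD _ (I2 _) (I1 _))// !RintegralZl.
Qed.

Lemma cintD f g : cintegrable f -> cintegrable g ->
  cint (fun x => f x + g x) = cint f + cint g.
Proof.
move=> [fr fi] [gr gi]; apply: complex_ext; rewrite ?ReD ?ImD /=.
  by under eq_Rintegral do rewrite ReD; rewrite RintegralD.
by under eq_Rintegral do rewrite ImD; rewrite RintegralD.
Qed.

Lemma cintegrableN f : cintegrable f -> cintegrable (fun x => - f x).
Proof. by move=> fi; under eq_fun do rewrite -mulN1r; exact: cintegrableZ. Qed.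

Lemma cintegrableB f g : cintegrable f -> cintegrable g -> cintegrable (fun x => f x - g x).
Proof. by move=> fi gi; apply: cintegrableD => //; exact: cintegrableN. Qed.

Lemma cintB f g : cintegrable f -> cintegrable g ->
  cint (fun x => f x - g x) = cint f - cint g.
Proof.
move=> fi gi; rewrite cintD//; last exact: cintegrableN.
congr (_ + _); under [in LHS]eq_fun do rewrite -mulN1r.
by rewrite cintZ// mulN1r.
Qed.

Lemma eq_cint f g : f =1 g -> cint f = cint g.
Proof. by move=> /funext ->. Qed.

Lemma cmod_cint_le f (g : rv -> R) : cmeasurable f ->
  lebd.-integrable setT (EFin \o g) -> (forall x, cmod (f x) <= g x) ->
  cmod (cint f) <= 2 * \int[lebd]_x g x.
Proof.
move=> mf ig fg; have [fr fi] := cintegrable_le _ _ mf ig fg.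
apply: le_trans (cmod_le_ReIm _) _ => /=.
rewrite mulr_natl mulr2n; apply: lerD.
  apply: le_trans (le_normr_Rintegral _ fr) _ => //.
  apply: le_Rintegral => //; first exact: integrable_norm.
  by move=> x _; exact: le_trans (Re_le_cmod _) (fg x).
apply: le_trans (le_normr_Rintegral _ fi) _ => //.
apply: le_Rintegral => //; first exact: integrable_norm.
by move=> x _; exact: le_trans (Im_le_cmod _) (fg x).
Qed.

Lemma cintRdE f : cintegrable f -> cintRd f = cint f.
Proof.
move=> fi; have [mr mi] := cintegrable_measurable _ fi; have [fr fim] := fi.
by rewrite /cintRd !intRdE.
Qed.

Lemma cint_tpow s (E : 'M[R]_d) f : 0 < s -> cintegrable f ->
  cint (fun x => f (act (tpow s E) x)) = (s `^ (- \tr E))%:C * cint f.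
Proof.
move=> s0 [fr fi]; apply: complex_ext; rewrite ?ReM ?ImM /= mul0r ?subr0 ?addr0.
  exact: (Rintegral_tpow s E (fun x => Re (f x))).
exact: (Rintegral_tpow s E (fun x => Im (f x))).
Qed.

End cint.

(** * Fourier series on the lattice *)

Section continuous_real_fun.
Context {R : realType} {T : topologicalType}.
Implicit Types f g : T -> R.
Lemma cont_cst (c : R) : continuous (fun _ : T => c). Proof. exact: cst_continuous. Qed.
Lemma contD f g : continuous f -> continuous g -> continuous (fun x => f x + g x).
Proof. by move=> cf cg x; exact: cvgD (cf x) (cg x). Qed.
Lemma contB f g : continuous f -> continuous g -> continuous (fun x => f x - g x).
Proof. by move=> cf cg x; exact: cvgB (cf x) (cg x). Qed.
Lemma contN f : continuous f -> continuous (fun x => - f x).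
Proof. by move=> cf x; exact: cvgN (cf x). Qed.
Lemma contM f g : continuous f -> continuous g -> continuous (fun x => f x * g x).
Proof. by move=> cf cg x; exact: cvgM (cf x) (cg x). Qed.
Lemma cont_comp (h : R -> R) f : continuous h -> continuous f -> continuous (fun x => h (f x)).
Proof. by move=> ch cf x; exact: (@continuous_comp _ _ _ f h x (cf x) (ch _)). Qed.
End continuous_real_fun.

Section boxsum_facts.
Context {R : realType} {d : nat}.
Local Notation zv := 'rV[int]_d.
Local Notation Re := complex.Re.
Local Notation Im := complex.Im.

(** Listing the lattice points of a box without repetition allows nested boxes to be compared by
    rearrangement of sums. *)
Definition boxseq N : seq zv :=
  [seq map_mx (fun i : 'I_(2 * N).+1 => (i%:Z - N%:Z)%R) k | k <- enum {: 'rV['I_(2 * N).+1]_d}].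

Lemma boxsumE (V : nmodType) N (g : zv -> V) : boxsum N g = \sum_(x <- boxseq N) g x.
Proof. by rewrite big_map big_enum. Qed.

Lemma boxseq_uniq N : uniq (boxseq N).
Proof.
rewrite map_inj_uniq ?enum_uniq// => k k' /rowP H; apply/rowP => i.
by have := H i; rewrite !mxE => /addIr [] /val_inj.
Qed.

Lemma mem_boxseq N (x : zv) : (x \in boxseq N) = [forall i, `|x ord0 i| <= N%:Z].
Proof.
apply/mapP/forallP => [[k _ ->] i|H].
  rewrite mxE; have := ltn_ord (k ord0 i); move: (nat_of_ord _) => a a2.
  by rewrite ler_norml; lia.
have Hi i : (absz (x ord0 i + N%:Z)%R < (2 * N).+1)%N.
  by have := H i; move: (x ord0 i) => y; rewrite ler_norml; lia.
exists (\row_i Ordinal (Hi i)); first by rewrite mem_enum.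
apply/rowP => i; rewrite !mxE /=; have := H i; move: (x ord0 i) => y.
by rewrite ler_norml; lia.
Qed.

Lemma boxsum_split N N' (g : zv -> R) : (N <= N')%N ->
  boxsum N' g = boxsum N g + \sum_(x <- boxseq N' | x \notin boxseq N) g x.
Proof.
move=> NN; rewrite !boxsumE (bigID (mem (boxseq N)))/=; congr (_ + _).
rewrite -big_filter; apply: perm_big; apply: uniq_perm.
- exact/filter_uniq/boxseq_uniq.
- exact: boxseq_uniq.
move=> x; rewrite mem_filter andb_idr// !mem_boxseq => /forallP H.
by apply/forallP => i; rewrite (le_trans (H i))// lez_nat.
Qed.

Lemma boxsum_ndecr (g : zv -> R) : (forall x, 0 <= g x) ->
  nondecreasing_seq (fun N => boxsum N g).
Proof.
move=> g0 N N' NN; rewrite (boxsum_split _ _ _ NN) lerDl.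
exact: sumr_ge0.
Qed.

Lemma boxsumD N (f g : zv -> R) : boxsum N (fun x => f x + g x) = boxsum N f + boxsum N g.
Proof. by rewrite !boxsumE big_split. Qed.
Lemma boxsumB N (f g : zv -> R) : boxsum N (fun x => f x - g x) = boxsum N f - boxsum N g.
Proof. by rewrite !boxsumE sumrB. Qed.
Lemma le_boxsum N (f g : zv -> R) : (forall x, f x <= g x) -> boxsum N f <= boxsum N g.
Proof. by move=> fg; rewrite !boxsumE; apply: ler_sum. Qed.

Lemma Re_boxsum N (f : zv -> R[i]) : Re (boxsum N f) = boxsum N (fun x => Re (f x)).
Proof. by rewrite !boxsumE Re_sum. Qed.
Lemma Im_boxsum N (f : zv -> R[i]) : Im (boxsum N f) = boxsum N (fun x => Im (f x)).
Proof. by rewrite !boxsumE Im_sum. Qed.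
Lemma cmod_boxsum N (f : zv -> R[i]) : cmod (boxsum N f) <= boxsum N (fun x => cmod (f x)).
Proof. by rewrite !boxsumE cmod_sum. Qed.

Section dominated.
Variables (h : zv -> R) (M : R).
Hypotheses (hM : forall N, boxsum N h <= M).

Lemma cvg_boxsum_ge0 (g : zv -> R) (C : R) : (forall x, 0 <= g x) ->
  (forall N, boxsum N g <= C) -> cvgn (fun N => boxsum N g).
Proof.
move=> g0 gC; apply: nondecreasing_is_cvgn; first exact: boxsum_ndecr.
by exists C => _ [N _ <-].
Qed.

Variable g : zv -> R.
Hypothesis gh : forall x, `|g x| <= h x.

Let h0 x : 0 <= h x. Proof. exact: le_trans (gh x). Qed.
Let gDh x : 0 <= h x + g x.
Proof. by have := gh x; rewrite ler_norml => /andP[? _]; lra. Qed.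
Let hBg x : 0 <= h x - g x.
Proof. by have := gh x; rewrite ler_norml => /andP[_ ?]; lra. Qed.

Lemma cvg_boxsum_h : cvgn (fun N => boxsum N h).
Proof. exact: cvg_boxsum_ge0 hM. Qed.

Let cD : cvgn (fun N => boxsum N (fun x => h x + g x)).
Proof.
apply: (cvg_boxsum_ge0 _ (2 * M)) => // N.
apply: (@le_trans _ _ (boxsum N (fun x => h x + h x))).
  by apply: le_boxsum => x; rewrite lerD2l (le_trans (ler_norm _)).
by rewrite boxsumD; have := hM N; lra.
Qed.

(** h + g and h are non-negative, so their box sums increase and are bounded; g is their
    difference. *)
Lemma cvg_boxsum_dom : cvgn (fun N => boxsum N g).
Proof.
have -> : (fun N => boxsum N g) = (fun N => boxsum N (fun x => h x + g x) - boxsum N h).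
  by apply/funext => N; rewrite boxsumD addrC addKr.
by apply: is_cvgB => //; exact: cvg_boxsum_h.
Qed.

(** Both h + g and h - g have non-negative tails. The bound does not depend on g, so a family
    dominated by h converges uniformly; this yields the continuity of Fourier series. *)
Lemma boxsum_tail N : `|limn (fun N => boxsum N g) - boxsum N g| <=
  limn (fun N => boxsum N h) - boxsum N h.
Proof.
have eD : limn (fun N => boxsum N (fun x => h x + g x)) =
    limn (fun N => boxsum N h) + limn (fun N => boxsum N g).
  under eq_fun do rewrite boxsumD.
  by apply: limD; [exact: cvg_boxsum_h|exact: cvg_boxsum_dom].
have eB : limn (fun N => boxsum N (fun x => h x - g x)) =
    limn (fun N => boxsum N h) - limn (fun N => boxsum N g).
  under eq_fun do rewrite boxsumB.
  by apply: limB; [exact: cvg_boxsum_h|exact: cvg_boxsum_dom].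
have cB : cvgn (fun N => boxsum N (fun x => h x - g x)).
  under eq_fun do rewrite boxsumB.
  by apply: is_cvgB; [exact: cvg_boxsum_h|exact: cvg_boxsum_dom].
have h1 := nondecreasing_cvgn_le (boxsum_ndecr _ gDh) cD N.
have h2 := nondecreasing_cvgn_le (boxsum_ndecr _ hBg) cB N.
rewrite eD boxsumD in h1; rewrite eB boxsumB in h2.
by rewrite ler_norml; apply/andP; split; lra.
Qed.

End dominated.

Lemma continuous_boxsum_lim {T : topologicalType} (h : zv -> R) (M : R) (g : T -> zv -> R) :
  (forall N, boxsum N h <= M) -> (forall t x, `|g t x| <= h x) ->
  (forall x, continuous (fun t => g t x)) ->
  continuous (fun t => limn (fun N => boxsum N (g t))).
Proof.
move=> hM gh cg t0.
have h0 x : 0 <= h x by exact: le_trans (gh t0 x).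
apply/cvgrPdist_lt => e e0.
have e3 : 0 < e / 3 by rewrite divr_gt0.
have ch : cvgn (fun N => boxsum N h) by exact: cvg_boxsum_ge0 hM.
have /cvgrPdist_lt /(_ _ e3) [N _ HN] := ch.
have {}HN : limn (fun N => boxsum N h) - boxsum N h < e / 3.
  by apply: le_lt_trans (HN N (leqnn N)); exact: ler_norm.
have cN : continuous (fun t => boxsum N (g t)).
  by under eq_fun do rewrite boxsumE; apply: continuous_sum_fun.
have /cvgrPdist_lt /(_ _ e3) Ht := cN t0.
apply: filterS Ht => t /= Ht.
have h1 := boxsum_tail _ _ hM _ (gh t0) N.
have h2 := boxsum_tail _ _ hM _ (gh t) N.
move: h1 h2 Ht; rewrite !ler_norml !ltr_norml => /andP[? ?] /andP[? ?] /andP[? ?].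
by apply/andP; split; lra.
Qed.

End boxsum_facts.

Section fourier_facts.
Context {R : realType} {d : nat}.
Local Notation zv := 'rV[int]_d.
Local Notation rv := 'rV[R]_d.
Local Notation Re := complex.Re.
Local Notation Im := complex.Im.

Definition iexp (t : R) : R[i] := cexp (0 +i* t).

Lemma iexpD s t : iexp (s + t) = iexp s * iexp t.
Proof. by rewrite /iexp -cexpD; congr cexp; apply: complex_ext; rewrite ?ReD ?ImD/= ?addr0. Qed.
Lemma iexp0 : iexp 0 = 1. Proof. exact: cexp0. Qed.
Lemma cmod_iexp t : cmod (iexp t) = 1.
Proof. by rewrite /iexp cmod_cexp expR0. Qed.
Lemma Re_iexp t : Re (iexp t) = cos t. Proof. by rewrite /iexp /cexp /= expR0 mul1r. Qed.
Lemma Im_iexp t : Im (iexp t) = sin t. Proof. by rewrite /iexp /cexp /= expR0 mul1r. Qed.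

Lemma dotRDl (x y z : rv) : dotR (x + y) z = dotR x z + dotR y z.
Proof. by rewrite /dotR -big_split; apply: eq_bigr => i _; rewrite mxE mulrDl. Qed.
Lemma dotRDr (x y z : rv) : dotR z (x + y) = dotR z x + dotR z y.
Proof. by rewrite /dotR -big_split; apply: eq_bigr => i _; rewrite mxE mulrDr. Qed.
Lemma dotRNl (x z : rv) : dotR (- x) z = - dotR x z.
Proof. by rewrite /dotR -sumrN; apply: eq_bigr => i _; rewrite mxE mulNr. Qed.
Lemma dotRBl (x y z : rv) : dotR (x - y) z = dotR x z - dotR y z.
Proof. by rewrite dotRDl dotRNl. Qed.
Lemma dotRZl c (x z : rv) : dotR (c *: x) z = c * dotR x z.
Proof. by rewrite /dotR mulr_sumr; apply: eq_bigr => i _; rewrite mxE mulrA. Qed.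
Lemma dotRZr c (x z : rv) : dotR x (c *: z) = c * dotR x z.
Proof. by rewrite /dotR mulr_sumr; apply: eq_bigr => i _; rewrite mxE mulrCA. Qed.
Lemma dotR_act (M : 'M[R]_d) (x z : rv) : dotR (act M^T x) z = dotR x (act M z).
Proof.
rewrite /dotR; under eq_bigr do rewrite actE mulr_suml.
rewrite exchange_big/=; apply: eq_bigr => j _; rewrite actE mulr_sumr.
by apply: eq_bigr => i _; rewrite mxE -mulrA mulrCA.
Qed.
Lemma dotR_norm (x z : rv) : `|dotR x z| <= d%:R * `|x| * `|z|.
Proof.
rewrite /dotR; apply: le_trans (ler_norm_sum _ _ _) _.
apply: le_trans (ler_sum _ (G := fun=> `|x| * `|z|) _) _.
  by move=> k _; rewrite normrM ler_pM// le_coord_norm.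
by rewrite sumr_const card_ord -[leLHS]mulr_natl mulrA.
Qed.

Lemma continuous_dotR (x : rv) : continuous (dotR x).
Proof.
apply: continuous_sum_fun => i _.
by apply: contM; [exact: cont_cst|exact: coord_continuous].
Qed.

Variable phi : zv -> R[i].
Hypothesis phiS : in_Sd phi.

Lemma summable_phi : exists M, forall N, boxsum N (fun x => cmod (phi x)) <= M.
Proof.
have [M HM] := phiS (const_mx 0%N); exists M => N; apply: le_trans (HM N).
apply: le_boxsum => x; rewrite big1 ?mul1r//; last by move=> i _; rewrite mxE expr0.
by rewrite normr1 mul1r ler_norm.
Qed.

Let g (xi : rv) (x : zv) : R[i] := phi x * cexp (0 +i* dotR (zR x) xi).

Lemma cmod_fourier_term xi x : cmod (g xi x) = cmod (phi x).
Proof. by rewrite /g cmodM -/(iexp _) cmod_iexp mulr1. Qed.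

Let gr xi x : `|Re (g xi x)| <= cmod (phi x).
Proof. by rewrite -(cmod_fourier_term xi) Re_le_cmod. Qed.
Let gi xi x : `|Im (g xi x)| <= cmod (phi x).
Proof. by rewrite -(cmod_fourier_term xi) Im_le_cmod. Qed.

Lemma continuous_cos_dot (x : rv) : continuous (fun xi => cos (dotR x xi)).
Proof. by apply: (cont_comp cos); [exact: continuous_cos|exact: continuous_dotR]. Qed.
Lemma continuous_sin_dot (x : rv) : continuous (fun xi => sin (dotR x xi)).
Proof. by apply: (cont_comp sin); [exact: continuous_sin|exact: continuous_dotR]. Qed.

Lemma continuous_Re_fourier : continuous (fun xi => Re (fourier phi xi)).
Proof.
have [M HM] := summable_phi.
rewrite /fourier /zsum /=; under eq_fun do under eq_fun do rewrite Re_boxsum.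
apply: (continuous_boxsum_lim _ _ _ HM gr) => x.
under eq_fun do rewrite /g ReM -/(iexp _) Re_iexp Im_iexp.
apply: contB; apply: contM; (try exact: cont_cst).
  exact: continuous_cos_dot.
exact: continuous_sin_dot.
Qed.

Lemma continuous_Im_fourier : continuous (fun xi => Im (fourier phi xi)).
Proof.
have [M HM] := summable_phi.
rewrite /fourier /zsum /=; under eq_fun do under eq_fun do rewrite Im_boxsum.
apply: (continuous_boxsum_lim _ _ _ HM gi) => x.
under eq_fun do rewrite /g ImM -/(iexp _) Re_iexp Im_iexp.
apply: contD; apply: contM; (try exact: cont_cst).
  exact: continuous_sin_dot.
exact: continuous_cos_dot.
Qed.

Lemma cvg_Re_fourier xi : (fun N => Re (boxsum N (g xi))) @ \oo --> Re (fourier phi xi).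
Proof.
have [M HM] := summable_phi.
have E : Re (fourier phi xi) = limn (fun N => boxsum N (fun x => Re (g xi x))).
  by rewrite /fourier /zsum /=; congr (limn _); apply/funext => N; rewrite Re_boxsum.
rewrite E; under eq_fun do rewrite Re_boxsum.
exact: cvg_boxsum_dom HM _ (gr xi).
Qed.

Lemma cvg_Im_fourier xi : (fun N => Im (boxsum N (g xi))) @ \oo --> Im (fourier phi xi).
Proof.
have [M HM] := summable_phi.
have E : Im (fourier phi xi) = limn (fun N => boxsum N (fun x => Im (g xi x))).
  by rewrite /fourier /zsum /=; congr (limn _); apply/funext => N; rewrite Im_boxsum.
rewrite E; under eq_fun do rewrite Im_boxsum.
exact: cvg_boxsum_dom HM _ (gi xi).
Qed.

End fourier_facts.

Lemma integrable_indic_fin {disp : measure_display} {T : measurableType disp}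
    {R : realType} (mu : {measure set T -> \bar R}) (A : set T) :
  measurable A -> (mu A < +oo)%E -> mu.-integrable setT (EFin \o \1_A).
Proof.
move=> mA muA; apply/integrableP; split; first exact/measurable_EFinP.
rewrite (eq_integral (fun x => (\1_A x)%:E)); last first.
  by move=> t _; rewrite gee0_abs// lee_fin.
by rewrite integral_indic// setIT.
Qed.

(** * Orthogonality of characters on the cube *)

Section ftc.
Context {R : realType}.
Local Notation leb := (@lebesgue_measure R).

Lemma FTC2_is_derive (f F : R -> R) (a b : R) : a < b ->
  (forall x, a <= x <= b -> {for x, continuous f}) ->
  (forall x, a <= x <= b -> is_derive x (1 : R) F (f x)) ->
  (\int[leb]_(x in `[a, b]) (f x)%:E = (F b - F a)%:E)%E.
Proof.
move=> ab cf dF.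
have cF x : a <= x <= b -> {for x, continuous F}.
  move=> /dF d; have : derivable F x 1 by exact: ex_derive.
  by move=> /derivable1_diffP/differentiable_continuous.
rewrite EFinB; apply: continuous_FTC2 => //.
- apply: continuous_in_subspaceT => x; rewrite inE/= in_itv/=; exact: cf.
- split.
  + by move=> x; rewrite in_itv/= => /andP[/ltW ax /ltW xb]; apply: ex_derive; apply: dF; rewrite ax.
  + by apply: cvg_at_right_filter; apply: cF; rewrite lexx ltW.
  + by apply: cvg_at_left_filter; apply: cF; rewrite lexx ltW.
- move=> x; rewrite in_itv/= => /andP[/ltW ax /ltW xb].
  have xab : a <= x <= b by rewrite ax.
  by have d := dF x xab; rewrite derive1E derive_val.
Qed.

Lemma sin_intpi (z : int) : sin (z%:~R * pi) = 0 :> R.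
Proof.
have H (n : nat) : sin (n%:R * pi) = 0 :> R.
  elim: n => [|n IH]; first by rewrite mul0r sin0.
  by rewrite -natr1 mulrDl mul1r sinDpi IH oppr0.
by case: z => n; rewrite ?NegzE ?mulrNz ?mulNr ?sinN -pmulrn ?H ?oppr0.
Qed.

Definition pi_ind (s : R) : R := \1_`[- pi, pi] s.

(** The free phase c absorbs the remaining coordinates in the induction of [int_pibox_cos]. *)
Lemma int_cos_period (z : int) (c : R) :
  \int[leb]_s (pi_ind s * cos (z%:~R * s + c)) =
  (if z == 0 then 2 * pi else 0) * cos c.
Proof.
have p0 : - pi < pi :> R by have := pi_gt0 R; lra.
have -> : \int[leb]_s (pi_ind s * cos (z%:~R * s + c)) =
    fine (\int[leb]_(s in `[- pi, pi]) (cos (z%:~R * s + c))%:E).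
  rewrite -[RHS]/(\int[leb]_(s in `[- pi, pi]) (cos (z%:~R * s + c))) [RHS]Rintegral_mkcond.
  apply: eq_Rintegral => s _; rewrite /pi_ind indicE patchE.
  by case: ifP => _; rewrite ?mul1r ?mul0r.
have ccos : continuous (fun s : R => cos (z%:~R * s + c)).
  apply: (cont_comp cos); first exact: continuous_cos.
  by apply: contD; [apply: contM; [exact: cont_cst|move=> x; exact: cvg_id]|exact: cont_cst].
have [z0|z0] := eqVneq z 0.
  have dF (x : R) : - pi <= x <= pi ->
      is_derive x (1 : R) (fun s => s * cos c) (cos (z%:~R * x + c)).
    move=> _; rewrite z0 mul0r add0r.
    by apply: is_derive_eq; rewrite /GRing.scale/=; ring.
  rewrite (FTC2_is_derive _ _ _ _ p0 (fun x _ => ccos x) dF)/=; ring.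
have zr : z%:~R != 0 :> R by rewrite intr_eq0.
have dF (x : R) : - pi <= x <= pi ->
    is_derive x (1 : R) (fun s => (z%:~R)^-1 * sin (z%:~R * s + c)) (cos (z%:~R * x + c)).
  move=> _; have h : is_derive x (1 : R) (fun s : R => z%:~R * s + c) (z%:~R).
    by apply: is_derive_eq; rewrite /GRing.scale/=; ring.
  have h2 := is_deriveZ (z%:~R)^-1 (@is_derive1_comp R sin _ x _ _ (is_derive_sin _) h).
  by move: h2; congr (is_derive x 1 _ _); rewrite /GRing.scale/=; field.
rewrite (FTC2_is_derive _ _ _ _ p0 (fun x _ => ccos x) dF)/=.
by rewrite mul0r mulrN !sinD sinN cosN sin_intpi; ring.
Qed.

End ftc.

Section orthogonality.
Context {R : realType} {d : nat}.
Local Notation zv := 'rV[int]_d.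
Local Notation rv := 'rV[R]_d.
Local Notation leb := (@lebesgue_measure R).
Local Notation mR := (measurableTypeR R).
Local Notation Re := complex.Re.
Local Notation Im := complex.Im.

Definition pibox (m : nat) (x : rv) : R := \prod_(j < d | (j < m)%N) pi_ind (x ord0 j).

Lemma pi_ind01 (s : R) : 0 <= pi_ind s <= 1.
Proof. by rewrite /pi_ind indicE; case: (_ \in _); rewrite ?lexx ?ler01. Qed.

Lemma pibox01 m x : 0 <= pibox m x <= 1.
Proof.
apply/andP; split; first by apply: prodr_ge0 => j _; case/andP: (pi_ind01 (x ord0 j)).
by apply: prodr_ile1 => j _; exact: pi_ind01.
Qed.

Lemma measurable_pi_ind : measurable_fun setT (pi_ind : mR -> R).
Proof. exact: measurable_indic. Qed.

Lemma measurable_pibox m : measurable_fun setT (pibox m).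
Proof.
rewrite /pibox; under eq_fun do rewrite big_mkcond/=.
apply: measurable_prod => j _; case: (j < m)%N => //.
exact: (measurableT_comp measurable_pi_ind (measurable_coord j)).
Qed.

Lemma pibox_set_coord m (w : rv) s : (m < d)%N ->
  pibox m.+1 (set_coord w m s) = pi_ind s * pibox m w.
Proof.
move=> md; rewrite /pibox (bigD1 (Ordinal md))//= set_coordE eqxx; congr (_ * _).
apply: eq_big => [j|j].
  by rewrite -val_eqE/= ltnS; case: ltngtP.
by rewrite -val_eqE/= => /andP[_ jm]; rewrite set_coordE (negbTE jm).
Qed.

Lemma pibox_out m x : ~ nbox m 4 x -> pibox m x = 0.
Proof.
move=> nb; have [j [jm xj]] : exists j : 'I_d, (j < m)%N /\ ~ (`|x ord0 j| <= 4).
  apply: contrapT => H; apply: nb => j jm; apply: contrapT => xj; apply: H; by exists j.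
rewrite /pibox (bigD1 j)//= /pi_ind indicE.
rewrite (_ : _ \in _ = false) ?mul0r//; apply/negbTE/negP; rewrite inE/= in_itv/= -ler_norml => h.
apply: xj; apply: le_trans h _; have := @pihalf_lt2 R; lra.
Qed.

Lemma integrable_pibox m : (lebm m).-integrable setT (EFin \o pibox m).
Proof.
(* The integer 4 exceeds pi, so the cube lies in a box already known to have finite measure. *)
have im : (lebm m).-integrable setT (EFin \o \1_(nbox m 4 : set rv)).
  by apply: integrable_indic_fin; [exact: measurable_nbox|exact: lebm_nbox].
apply: le_integrable im => //; first by apply/measurable_EFinP; exact: measurable_pibox.
move=> x _ /=; rewrite lee_fin indicE.
have [p0 p1] := andP (pibox01 m x).
have [h|h] := pselect (nbox m 4 x); first by rewrite (mem_set h) mulr1n normr1 ger0_norm; [exact: p1|exact: p0].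
by rewrite pibox_out// normr0.
Qed.

Lemma integrable_pibox_mul m (h : rv -> R) : measurable_fun setT h ->
  (forall x, `|h x| <= 1) -> (lebm m).-integrable setT (EFin \o (fun x => pibox m x * h x)).
Proof.
move=> mh h1; apply: le_integrable (integrable_pibox m) => //.
  by apply/measurable_EFinP; apply: measurable_funM => //; exact: measurable_pibox.
move=> x _ /=; rewrite lee_fin normrM.
by rewrite ler_piMr.
Qed.

Definition pdot (k : zv) m (x : rv) : R := \sum_(j < d | (j < m)%N) (k ord0 j)%:~R * x ord0 j.

Lemma measurable_cos_pdot k m c : measurable_fun setT (fun x => cos (pdot k m x + c)).
Proof.
apply: continuous_measurable_rV; apply: (cont_comp cos); first exact: continuous_cos.
apply: contD; last exact: cont_cst.
apply: continuous_sum_fun => j _; apply: contM; first exact: cont_cst.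
exact: coord_continuous.
Qed.

Lemma pdot_set_coord k m (w : rv) s (md : (m < d)%N) :
  pdot k m.+1 (set_coord w m s) = (k ord0 (Ordinal md))%:~R * s + pdot k m w.
Proof.
rewrite /pdot (bigD1 (Ordinal md))//= set_coordE eqxx; congr (_ + _).
apply: eq_big => [j|j].
  by rewrite -val_eqE/= ltnS; case: ltngtP.
by rewrite -val_eqE/= => /andP[_ jm]; rewrite set_coordE (negbTE jm).
Qed.

Lemma int_pibox_cos (k : zv) m (c : R) : (m <= d)%N ->
  \int[lebm m]_x (pibox m x * cos (pdot k m x + c)) =
  (\prod_(j < d | (j < m)%N) (if k ord0 j == 0 then 2 * pi else 0)) * cos c.
Proof.
elim: m c => [|m IH] c md.
  rewrite /Rintegral (@eq_measure_integral _ _ _ setT rv_dirac0)//.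
  rewrite integral_dirac//=; last first.
    apply/measurable_EFinP; apply: measurable_funM; first exact: measurable_pibox.
    exact: measurable_cos_pdot.
  by rewrite indicT mul1r /pibox /pdot !big_pred0// !mul1r add0r.
have bd n c' : forall x : rv, `|cos (pdot k n x + c')| <= 1 by move=> x; exact: cos_max.
have fi := integrable_pibox_mul m.+1 _ (measurable_cos_pdot k m.+1 c) (bd m.+1 c).
have Fi := integrable_lebmS m _ md fi.
rewrite /Rintegral integral_lebmS//= -(integral12_prod_meas1 Fi) /fubini_F /=.
set V := \prod_(j < d | (j < m)%N) _ in IH.
have E (s : R) : (\int[lebm m]_w (pibox m.+1 (coord_update m (s, w)) *
     cos (pdot k m.+1 (coord_update m (s, w)) + c))%:E)%E =
    (V * (pi_ind s * cos ((k ord0 (Ordinal md))%:~R * s + c)))%:E.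
  have e w : pibox m.+1 (coord_update m (s, w)) * cos (pdot k m.+1 (coord_update m (s, w)) + c) =
     pi_ind s * (pibox m w * cos (pdot k m w + ((k ord0 (Ordinal md))%:~R * s + c))).
    rewrite /coord_update /= pibox_set_coord// (pdot_set_coord _ _ _ _ md) -mulrA.
    by congr (_ * (_ * cos _)); ring.
  under eq_integral do rewrite e.
  have ii := integrable_pibox_mul m _ (measurable_cos_pdot k m ((k ord0 (Ordinal md))%:~R * s + c))
     (bd m ((k ord0 (Ordinal md))%:~R * s + c)).
  under eq_integral do rewrite EFinM.
  rewrite integralZl// -[X in (_ * X)%E]fineK; last exact: integrable_fin_num.
  rewrite -[fine _]/(\int[lebm m]_w _) IH; last exact: ltnW.
  by rewrite -EFinM; congr EFin; ring.
under eq_integral do rewrite E.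
rewrite -[LHS]/(\int[leb]_s _) RintegralZl//; last first.
  have i1 : leb.-integrable setT (EFin \o pi_ind).
    exact: integrable_indic_itv.
  apply: le_integrable i1 => //.
    apply/measurable_EFinP; apply: measurable_funM; first exact: measurable_pi_ind.
    apply: continuous_measurable_fun; apply: (cont_comp cos); first exact: continuous_cos.
    by apply: contD; [apply: contM; [exact: cont_cst|move=> x; exact: cvg_id]|exact: cont_cst].
  by move=> s _ /=; rewrite lee_fin normrM ler_piMr// cos_max.
rewrite int_cos_period [in RHS](bigD1 (Ordinal md))//= /V.
rewrite mulrA [_ * (if _ then _ else _)]mulrC; congr (_ * _ * _).
by apply: eq_bigl => j; rewrite -val_eqE/= ltnS; case: ltngtP.
Qed.

End orthogonality.

Section dominated_cint.
Context {R : realType} {d : nat}.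
Local Notation rv := 'rV[R]_d.
Local Notation Re := complex.Re.
Local Notation Im := complex.Im.

Lemma Rintegral_dominated (F : nat -> rv -> R) (f g : rv -> R) :
  (forall N, measurable_fun setT (F N)) -> measurable_fun setT f ->
  (forall x, F N x @[N --> \oo] --> f x) ->
  lebd.-integrable setT (EFin \o g) -> (forall N x, `|F N x| <= g x) ->
  (fun N => \int[lebd]_x F N x) @ \oo --> \int[lebd]_x f x.
Proof.
move=> mF mf cF ig Fg.
have [||||| fi _ c] := @dominated_convergence _ _ _ (@lebd R d) setT measurableT
  (fun N x => (F N x)%:E) (EFin \o f) (EFin \o g).
- by move=> N; apply/measurable_EFinP.
- exact/measurable_EFinP.
- by apply: aeW => x _; apply: cvg_EFin; [exact: nearW|exact: cF].
- exact: ig.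
- by apply: aeW => x N _; rewrite lee_fin.
apply: fine_cvg; rewrite fineK; first exact: c.
exact: integrable_fin_num.
Qed.

Lemma cint_dominated (F : nat -> rv -> R[i]) (f : rv -> R[i]) (g : rv -> R) :
  (forall N, cmeasurable (F N)) -> cmeasurable f ->
  (forall x, Re (F N x) @[N --> \oo] --> Re (f x)) ->
  (forall x, Im (F N x) @[N --> \oo] --> Im (f x)) ->
  lebd.-integrable setT (EFin \o g) -> (forall N x, cmod (F N x) <= g x) ->
  ((fun N => Re (cint (F N))) @ \oo --> Re (cint f)) /\
  ((fun N => Im (cint (F N))) @ \oo --> Im (cint f)).
Proof.
move=> mF mf cr ci ig Fg; split; apply: Rintegral_dominated ig _ => //.
- by move=> N; have [] := mF N.
- by have [] := mf.
- by move=> N x; exact: le_trans (Re_le_cmod _) (Fg N x).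
- by move=> N; have [] := mF N.
- by have [] := mf.
- by move=> N x; exact: le_trans (Im_le_cmod _) (Fg N x).
Qed.

Lemma cintegrable0 : cintegrable (fun _ : rv => 0 : R[i]).
Proof. by split; exact: integrable0. Qed.

Lemma cint_sum {I : Type} (s : seq I) (F : I -> rv -> R[i]) :
  (forall i, cintegrable (F i)) ->
  cintegrable (fun x => \sum_(i <- s) F i x) /\
  cint (fun x => \sum_(i <- s) F i x) = \sum_(i <- s) cint (F i).
Proof.
move=> iF; elim: s => [|i s [IH1 IH2]].
  have -> : (fun x => \sum_(j <- [::]) F j x) = (fun _ : rv => 0).
    by apply/funext => x; rewrite big_nil.
  split; first exact: cintegrable0.
  by rewrite big_nil; apply: complex_ext => /=; rewrite /Rintegral integral0_eq.
have -> : (fun x => \sum_(j <- i :: s) F j x) = (fun x => F i x + \sum_(j <- s) F j x).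
  by apply/funext => x; rewrite big_cons.
by split; [exact: cintegrableD|rewrite big_cons cintD// IH2].
Qed.

End dominated_cint.

(** * Fourier inversion for convolution powers *)

Section inversion.
Context {R : realType} {d : nat}.
Local Notation zv := 'rV[int]_d.
Local Notation rv := 'rV[R]_d.
Local Notation Re := complex.Re.
Local Notation Im := complex.Im.

Lemma dotR_zR (k : zv) (x : rv) : dotR (zR k) x = pdot k d x.
Proof. by rewrite /dotR /pdot; apply: eq_big => [j|j _]; rewrite ?ltn_ord// !mxE. Qed.

Lemma zRB (x y : zv) : zR (x - y) = zR x - zR y :> rv.
Proof. by apply/rowP => i; rewrite !mxE intrD mulrNz. Qed.

Lemma cmeasurable_continuous (f : rv -> R[i]) : continuous (fun x => Re (f x)) ->
  continuous (fun x => Im (f x)) -> cmeasurable f.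
Proof. by move=> cr ci; split; exact: continuous_measurable_rV. Qed.

Lemma cmeasurable_real (f : rv -> R) : measurable_fun setT f -> cmeasurable (fun x => (f x)%:C).
Proof. by move=> mf; split => //; exact: measurable_cst. Qed.

Lemma cmeasurable_iexp_dot (y : rv) (c : R) : cmeasurable (fun x : rv => iexp (dotR y x + c)).
Proof.
have cd : continuous (fun x => dotR y x + c).
  by apply: contD; [exact: continuous_dotR|exact: cont_cst].
apply: cmeasurable_continuous.
  by under eq_fun do rewrite Re_iexp; apply: (cont_comp cos) cd; exact: continuous_cos.
by under eq_fun do rewrite Im_iexp; apply: (cont_comp sin) cd; exact: continuous_sin.
Qed.

Variables (phi : zv -> R[i]) (xi0 : rv).
Hypothesis phiS : in_Sd phi.

Lemma norm_cvg_le (u : nat -> R) (l M : R) : u @ \oo --> l ->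
  (forall n, `|u n| <= M) -> `|l| <= M.
Proof.
move=> cu uM; apply: (ler_cvg_to (cvg_norm cu) (cvg_cst M)).
exact: nearW.
Qed.

Lemma continuous_shift {V : normedModType R} (x0 : V) : continuous (fun x : V => x + x0).
Proof. by move=> x; apply: cvgD; [exact: cvg_id|exact: cvg_cst]. Qed.

Lemma cmeasurable_fourier_shift : cmeasurable (fun x => fourier phi (x + xi0)).
Proof.
have cs : continuous (fun x : rv => x + xi0) by exact: continuous_shift.
apply: cmeasurable_continuous => x.
  have := continuous_comp (cs x) (continuous_Re_fourier _ phiS (x + xi0)).
  exact.
have := continuous_comp (cs x) (continuous_Im_fourier _ phiS (x + xi0)).
exact.
Qed.

(** [sup] is an upper bound only for sets bounded above, so this a priori bound must precede
    [cmod_fourier_le1]. *)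
Lemma cmod_fourier_bounded : exists M, forall xi, cmod (fourier phi xi) <= M.
Proof.
have [M HM] := summable_phi _ phiS; exists (M + M) => z.
have B N : cmod (boxsum N (fun x => phi x * cexp (0 +i* dotR (zR x) z))) <= M.
  apply: le_trans (cmod_boxsum _ _) (le_trans _ (HM N)).
  by apply: le_boxsum => x; rewrite cmod_fourier_term.
apply: le_trans (cmod_le_ReIm _) _; apply: lerD.
  apply: (norm_cvg_le _ _ _ (cvg_Re_fourier _ phiS z)) => N.
  exact: le_trans (Re_le_cmod _) (B N).
apply: (norm_cvg_le _ _ _ (cvg_Im_fourier _ phiS z)) => N.
exact: le_trans (Im_le_cmod _) (B N).
Qed.

Hypothesis sup1 : sup (range (fun xi => cmod (fourier phi xi))) = 1.

Lemma cmod_fourier_le1 xi : cmod (fourier phi xi) <= 1.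
Proof.
rewrite -sup1; apply: ub_le_sup; last by exists xi.
by have [M HM] := cmod_fourier_bounded; exists M => _ [z _ <-].
Qed.

Let Phi (t : rv) : R[i] := fourier phi (t + xi0).
Let W n (x : zv) (t : rv) : R[i] :=
  (pibox d t)%:C * (Phi t ^+ n * iexp (- dotR (zR x) (t + xi0))).

(** The cube of integration is translated by xi0, so that the peak sits at its centre even when xi0
    is on the boundary of (-pi, pi]^d. Orthogonality survives the translation, which only adds a
    constant phase. *)
Definition fourier_coef n (x : zv) : R[i] := cint (W n x).

Let mW n x : cmeasurable (W n x).
Proof.
apply: cmeasurableM; first by apply: cmeasurable_real; exact: measurable_pibox.
apply: cmeasurableM; first by apply: cmeasurableX; exact: cmeasurable_fourier_shift.
have := cmeasurable_iexp_dot (- zR x) (- dotR (zR x) xi0).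
by under eq_fun do rewrite dotRNl -opprD -dotRDr.
Qed.

Let bW n x t : cmod (W n x t) <= pibox d t.
Proof.
have [p0 p1] := andP (pibox01 d t).
rewrite /W cmodM cmod_real ger0_norm// cmodM cmod_iexp mulr1 cmodX.
rewrite ler_piMr// exprn_ile1// ?cmod_ge0//; exact: cmod_fourier_le1.
Qed.

Let iW n x : cintegrable (W n x).
Proof. exact: cintegrable_le (mW n x) (integrable_pibox d) (bW n x). Qed.

Let Wsum n x N : boxsum N (fun y => fourier_coef n (x - y) * phi y) =
  cint (fun t => W n x t * boxsum N (fun y => phi y * cexp (0 +i* dotR (zR y) (t + xi0)))).
Proof.
rewrite boxsumE.
have [_ e] := cint_sum (boxseq N) (fun y t => phi y * W n (x - y) t)
   (fun y => cintegrableZ (phi y) _ (iW n (x - y))).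
transitivity (\sum_(y <- boxseq N) cint (fun t => phi y * W n (x - y) t)).
  by apply: eq_bigr => y _; rewrite cintZ// mulrC.
rewrite -e; apply: eq_cint => t; rewrite boxsumE mulr_sumr; apply: eq_bigr => y _.
rewrite /W -/(iexp _) zRB dotRBl opprB iexpD; ring.
Qed.

(** Convolving with phi multiplies the integrand by partial Fourier sums of phi. These tend to [Phi]
    and are bounded through the summability of phi, so dominated convergence on the cube applies. *)
Lemma fourier_coef_conv n x :
  ((fun N => Re (boxsum N (fun y => fourier_coef n (x - y) * phi y))) @ \oo
    --> Re (fourier_coef n.+1 x)) /\
  ((fun N => Im (boxsum N (fun y => fourier_coef n (x - y) * phi y))) @ \oo
    --> Im (fourier_coef n.+1 x)).
Proof.
have [M HM] := summable_phi _ phiS.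
pose G N t := boxsum N (fun y => phi y * cexp (0 +i* dotR (zR y) (t + xi0))).
suff [cr ci] : ((fun N => Re (cint (fun t => W n x t * G N t))) @ \oo --> Re (fourier_coef n.+1 x)) /\
    ((fun N => Im (cint (fun t => W n x t * G N t))) @ \oo --> Im (fourier_coef n.+1 x)).
  by split; under eq_fun do rewrite Wsum.
have mG N : cmeasurable (G N).
  have mg y : cmeasurable (fun t => phi y * cexp (0 +i* dotR (zR y) (t + xi0))).
    apply: cmeasurableM; first exact: cmeasurable_cst.
    have := cmeasurable_iexp_dot (zR y) (dotR (zR y) xi0).
    by under eq_fun do rewrite -dotRDr.
  split.
    under eq_fun do rewrite /G boxsumE Re_sum.
    by apply: measurable_sum => y; have [] := mg y.
  under eq_fun do rewrite /G boxsumE Im_sum.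
  by apply: measurable_sum => y; have [] := mg y.
apply: (@cint_dominated _ _ (fun N t => W n x t * G N t) (W n.+1 x) (fun t => M * pibox d t)).
- by move=> N; apply: cmeasurableM.
- exact: mW.
- move=> t; have -> : W n.+1 x t = W n x t * Phi t by rewrite /W exprSr; ring.
  rewrite ReM; under eq_fun do rewrite ReM.
  apply: cvgB; apply: cvgM; (try exact: cvg_cst).
    exact: cvg_Re_fourier.
  exact: cvg_Im_fourier.
- move=> t; have -> : W n.+1 x t = W n x t * Phi t by rewrite /W exprSr; ring.
  rewrite ImM; under eq_fun do rewrite ImM.
  apply: cvgD; apply: cvgM; (try exact: cvg_cst).
    exact: cvg_Im_fourier.
  exact: cvg_Re_fourier.
- rewrite /comp; under eq_fun do rewrite EFinM.
  by apply: integrableZl => //; exact: integrable_pibox.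
- move=> N t; rewrite cmodM mulrC; apply: ler_pM; rewrite ?cmod_ge0//.
  apply: le_trans (cmod_boxsum _ _) (le_trans _ (HM N)).
  by apply: le_boxsum => y; rewrite cmod_fourier_term.
Qed.

Lemma fourier_coef0 x : fourier_coef 0 x = if x == 0 then ((2 * pi) ^+ d)%:C else 0.
Proof.
pose c := dotR (zR x : rv) xi0.
have V : \prod_(j < d | (j < d)%N) (if x ord0 j == 0 then 2 * pi else 0 : R) =
   if x == 0 then (2 * pi) ^+ d else 0.
  have [->|x0] := eqVneq x 0.
    under eq_bigr do rewrite mxE eqxx.
    under eq_bigl do rewrite ltn_ord.
    by rewrite prodr_const card_ord.
  have [j xj] : exists j, x ord0 j != 0.
    apply/existsP; apply: contraNT x0 => /existsPn H; apply/eqP/rowP => j.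
    by rewrite mxE; apply/eqP; have := H j; rewrite negbK.
  by rewrite (bigD1 j)//= (negbTE xj) mul0r.
(* Shifting the phase by pi/2 turns the cosine into minus the sine, so one orthogonality formula
   covers both parts. *)
have E t : W 0 x t = (pibox d t * cos (pdot x d t + c)) +i* (pibox d t * cos (pdot x d t + (c + pi / 2))).
  rewrite /W expr0 mul1r dotRDr dotR_zR -/c; apply: complex_ext.
    by rewrite ReM Re_iexp /= mul0r subr0 cosN.
  by rewrite ImM Im_iexp /= mul0r addr0 sinN addrA cosDpihalf.
rewrite /fourier_coef (eq_cint _ _ E) /cint /=.
rewrite !int_pibox_cos// V.
have [x0|x0] := eqVneq x 0; last by rewrite !mul0r.
have -> : c = 0 by rewrite /c x0 /dotR big1// => i _; rewrite !mxE mul0r.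
by rewrite add0r cos_pihalf mulr0 cos0 mulr1.
Qed.

Lemma zsum_lim (f : zv -> R[i]) (z : R[i]) :
  (fun N => Re (boxsum N f)) @ \oo --> Re z ->
  (fun N => Im (boxsum N f)) @ \oo --> Im z -> zsum f = z.
Proof.
by move=> cr ci; apply: complex_ext; rewrite /zsum /=; apply/cvg_lim.
Qed.

(** Convolution powers and Fourier coefficients satisfy the same recursion. It is started at
    exponent 0, where the coefficients form a multiple of the unit mass at 0; the shift of index
    arises because [convpow1 phi n] is the power n+1. *)
Theorem fourier_inversion n x :
  convpow1 phi n x = ((2 * pi) ^- d)%:C * fourier_coef n.+1 x.
Proof.
have p0 : (2 * pi) ^+ d != 0 :> R by rewrite expf_neq0// mulf_neq0// gt_eqF// pi_gt0.
set c : R := (2 * pi) ^- d.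
have Rec (z : R[i]) : Re (c%:C * z) = c * Re z by rewrite ReM /= mul0r subr0.
have Imc (z : R[i]) : Im (c%:C * z) = c * Im z by rewrite ImM /= mul0r addr0.
elim: n x => [|n IH] x.
  have [cr ci] := fourier_coef_conv 0 x.
  (* Once the box contains x, only the term y = x of the sum survives, so the limit is attained. *)
  have [N0 HN0] : exists N0 : nat, forall i, `|x ord0 i| <= N0%:Z.
    exists (\max_i absz (x ord0 i))%N => i.
    by rewrite -abszE lez_nat; exact: (leq_bigmax i).
  have E N : (N0 <= N)%N -> boxsum N (fun y => fourier_coef 0 (x - y) * phi y) =
      ((2 * pi) ^+ d)%:C * phi x.
    move=> NN; rewrite boxsumE (bigD1_seq x)/=; last exact: boxseq_uniq.
      rewrite fourier_coef0 subrr eqxx big1 ?addr0// => y yx.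
      by rewrite fourier_coef0 subr_eq0 eq_sym (negbTE yx) mul0r.
    rewrite mem_boxseq; apply/forallP => i; rewrite (le_trans (HN0 i))//.
  have Er : Re (fourier_coef 1 x) = Re (((2 * pi) ^+ d)%:C * phi x).
    apply/esym; apply: (cvg_unique _ _ cr) => //; apply: cvg_near_cst.
    by exists N0 => // N /= NN; rewrite E.
  have Ei : Im (fourier_coef 1 x) = Im (((2 * pi) ^+ d)%:C * phi x).
    apply/esym; apply: (cvg_unique _ _ ci) => //; apply: cvg_near_cst.
    by exists N0 => // N /= NN; rewrite E.
  rewrite (complex_ext _ _ Er Ei) mulrA -rmorphM /c mulVf// mul1r.
  by [].
rewrite /=; have [cr ci] := fourier_coef_conv n.+1 x.
have E N : boxsum N (fun y => convpow1 phi n (x - y) * phi y) =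
    c%:C * boxsum N (fun y => fourier_coef n.+1 (x - y) * phi y).
  by rewrite !boxsumE mulr_sumr; apply: eq_bigr => y _; rewrite IH mulrA.
apply: zsum_lim.
  under eq_fun do rewrite E Rec; rewrite Rec.
  by apply: cvgM cr; exact: cvg_cst.
under eq_fun do rewrite E Imc; rewrite Imc.
by apply: cvgM ci; exact: cvg_cst.
Qed.

End inversion.

(** * Homogeneous gauges *)

Section gauge.
Context {R : realType} {d : nat}.
Local Notation rv := 'rV[R]_d.

Lemma act_norm (M : 'M[R]_d) (x : rv) : `|act M x| <= d%:R * `|M| * `|x|.
Proof.
rewrite [leLHS]/Num.norm/= mx_normrE; apply: bigmax_le => [|[i j] _ /=].
  by rewrite !mulr_ge0.
rewrite (ord1 i) actE; apply: le_trans (ler_norm_sum _ _ _) _.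
apply: le_trans (ler_sum _ (G := fun=> `|M| * `|x|) _) _.
  by move=> k _; rewrite normrM ler_pM// ?mx_entry_norm ?le_coord_norm.
by rewrite sumr_const card_ord -[leLHS]mulr_natl mulrA.
Qed.

Lemma actZ (M : 'M[R]_d) c (x : rv) : act M (c *: x) = c *: act M x.
Proof. by rewrite /act scalemxAl. Qed.

Lemma compact_bound (K : set rv) : compact K ->
  exists2 M : R, 0 < M & forall x, K x -> `|x| <= M.
Proof.
move=> /compact_bounded [M [_ HM]]; exists (`|M| + 1); first by rewrite ltr_pwDr.
by move=> x Kx; apply: HM Kx; rewrite (le_lt_trans (ler_norm _))// ltrDl.
Qed.

Variables (N : rv -> R) (E : 'M[R]_d).
Hypotheses (cN : continuous N) (N0 : forall x, 0 <= N x)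
  (Neq0 : forall x, N x = 0 <-> x = 0) (cpt : compact [set x : rv | N x = 1])
  (hN : Exp_set N E).

Lemma gauge_gt0 x : x != 0 -> 0 < N x.
Proof. by move=> x0; rewrite lt0r N0 andbT; apply: contra_neq x0 => /Neq0. Qed.

Lemma gauge_act t x : 0 < t -> N (act (tpow t E) x) = t * N x.
Proof. by move=> t0; exact: hN. Qed.

Lemma gauge_normalize x : x != 0 -> N (act (tpow (N x)^-1 E) x) = 1.
Proof.
move=> x0; have Nx := gauge_gt0 x x0.
by rewrite gauge_act ?invr_gt0// mulVf// gt_eqF.
Qed.

Lemma gauge_polar x : x != 0 ->
  act (tpow (N x) E) (act (tpow (N x)^-1 E) x) = x.
Proof. by move=> x0; rewrite act_tpowK// gauge_gt0. Qed.

Section growth.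
Variable C : R.
Hypothesis growth : forall x, `|x| <= 1 -> N x <= C * `|x| ^+ 2.

(* Near 0 the gauge is at most quadratic, so t^{-E} shrinks unit vectors by a
   factor at least of order t^{-1/2}; hence t^E dilates them at most by t^{1/2}. *)
Lemma gauge_quadratic_far : exists2 c : R, 0 < c &
  forall x, 1 <= N x -> `|x| ^+ 2 <= c * N x.
Proof.
have [M M0 HM] := compact_bound _ cpt.
(* C' >= 1 covers the case |s w| > 1, where the growth bound says nothing but t^-1 <= 1 suffices. *)
pose C' := Num.max C 1.
have C'1 : 1 <= C' by rewrite le_max lexx orbT.
have CC' : C <= C' by rewrite le_max lexx.
exists (M ^+ 4 * C'); first by rewrite mulr_gt0 ?exprn_gt0// (lt_le_trans ltr01).
move=> x Nx1.
have N00 : N 0 = 0 by apply/Neq0.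
have x0 : x != 0 by apply: contraTneq Nx1 => ->; rewrite N00 -ltNge ltr01.
pose f (s : R) := N (s *: x).
have cf : continuous f.
  have cs : continuous (fun s : R => s *: x) by move=> s; apply: cvgZr_tmp; exact: cvg_id.
  by move=> s; have := continuous_comp (cs s) (cN (s *: x)); exact.
(* The multiple s x lies on the unit level set, so s |x| <= M. For w = t^-E x one has N(s w) = 1/t,
   and growth at s w gives 1/t <= C' s^2 M^2. Eliminating s yields |x|^2 <= M^4 C' t. *)
have [s s01 fs] : exists2 s, s \in `[0, 1] & f s = 1.
  apply: IVT => //; first exact: continuous_subspaceT.
  by rewrite /f scale0r scale1r N00 min_l ?max_r// ler01.
have t0 := gauge_gt0 _ x0; set t := N x in Nx1 t0 *.
set w := act (tpow t^-1 E) x.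
have Nw : N w = 1 by exact: gauge_normalize.
have wM := HM _ Nw; have uM := HM _ fs.
have s0 : 0 < s.
  move: s01; rewrite in_itv/= le_eqVlt => /andP[/predU1P[s0|//] _].
  by move: fs; rewrite /f -s0 scale0r N00 => /esym/eqP; rewrite oner_eq0.
have h1 : t^-1 <= C' * (s * `|w|) ^+ 2.
  have e : N (s *: w) = t^-1 by rewrite /w -actZ gauge_act ?invr_gt0// -/(f s) fs mulr1.
  have nw : `|s *: w| = s * `|w| by rewrite normrZ gtr0_norm.
  have [le1|gt1] := leP (`|s *: w|) 1.
    rewrite -e; apply: le_trans (growth _ le1) _.
    by rewrite nw ler_wpM2r// sqr_ge0.
  rewrite nw in gt1; apply: (@le_trans _ _ 1); first by rewrite invf_le1.
  have g2 : 1 <= (s * `|w|) ^+ 2 by apply: exprn_ege1; exact: ltW.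
  by apply: le_trans g2 _; rewrite ler_peMl// sqr_ge0.
have h2 : 1 <= t * (C' * (s ^+ 2 * M ^+ 2)).
  rewrite -ler_pdivrMl// mulr1; apply: le_trans h1 _.
  rewrite exprMn ler_wpM2l ?ler_wpM2l ?sqr_ge0//; first exact: le_trans ler01 C'1.
  by rewrite ler_sqr ?nnegrE// ltW.
rewrite /f in fs.
have h3 : s ^+ 2 * `|x| ^+ 2 <= M ^+ 2.
  rewrite -exprMn -[s in s * _](gtr0_norm s0) -normrZ.
  by rewrite ler_sqr ?nnegrE// ltW.
apply: le_trans (_ : (t * (C' * (s ^+ 2 * M ^+ 2))) * `|x| ^+ 2 <= _).
  by rewrite ler_peMl// sqr_ge0.
rewrite [leLHS](_ : _ = (t * C' * M ^+ 2) * (s ^+ 2 * `|x| ^+ 2)); last by ring.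
rewrite [leRHS](_ : _ = (t * C' * M ^+ 2) * M ^+ 2); last by ring.
rewrite ler_wpM2l// mulr_ge0 ?sqr_ge0// mulr_ge0// ?(ltW t0)//.
exact: le_trans ler01 C'1.
Qed.
End growth.

Hypothesis ctr : contracting E.

(** For x nonzero write x = t^E w with t = N(x) and w on the compact unit level set; the norm of t^E
    tends to 0 with t. *)
Lemma gauge_small (e : R) : 0 < e -> exists2 tau : R, 0 < tau &
  forall x, N x < tau -> `|x| <= e.
Proof.
move=> e0; have [M M0 HM] := compact_bound _ cpt.
have e' : 0 < e / (d%:R * M + 1) by apply: divr_gt0 => //; apply: ltr_pwDr; [exact: ltr01|apply: mulr_ge0 => //; exact: ltW].
have /cvgrPdist_lt /(_ _ e') := ctr.
rewrite near_withinE => -[tau /= tau0 H].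
exists tau => // x Nx; have [->|x0] := eqVneq x 0; first by rewrite normr0 ltW.
have Nx0 := gauge_gt0 _ x0.
have := H (N x); rewrite /= sub0r normrN gtr0_norm// => /(_ Nx Nx0).
rewrite sub0r normrN => /ltW tE.
rewrite -(gauge_polar _ x0).
apply: le_trans (act_norm _ _) _.
have wM := HM _ (gauge_normalize _ x0).
apply: le_trans (_ : d%:R * (e / (d%:R * M + 1)) * M <= _).
  by apply: ler_pM; rewrite ?mulr_ge0// ler_wpM2l.
have D0 : 0 < d%:R * M + 1 by apply: ltr_pwDr; [exact: ltr01|apply: mulr_ge0 => //; exact: ltW].
rewrite [leLHS](_ : _ = e * (d%:R * M) / (d%:R * M + 1)); last by ring.
by rewrite ler_pdivrMr// ler_wpM2l ?(ltW e0)// lerDl.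
Qed.

(** The fixed dilation s^E with s = tau/2 carries the set into the unit ball; s^-E carries it back
    at the cost of a constant. *)
Lemma gauge_le1_bounded : exists2 M : R, 0 < M & forall x, N x <= 1 -> `|x| <= M.
Proof.
have [tau tau0 Ht] := gauge_small _ (ltr01 : 0 < 1 :> R).
pose s := tau / 2; have s0 : 0 < s by rewrite divr_gt0.
exists (d%:R * `|tpow s^-1 E| + 1); first by rewrite ltr_pwDr// mulr_ge0.
move=> x Nx; rewrite -(act_tpowVK s E x s0).
have h : `|act (tpow s E) x| <= 1.
  apply: Ht; rewrite gauge_act//.
  have : s * N x <= s by rewrite ler_piMr// ltW.
  by rewrite /s; lra.
apply: le_trans (act_norm _ _) _.
apply: le_trans (_ : d%:R * `|tpow s^-1 E| * 1 <= _); first by rewrite ler_wpM2l ?mulr_ge0.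
by rewrite mulr1 lerDl.
Qed.

Lemma gauge_quadratic (C : R) :
  (forall x, `|x| <= 1 -> N x <= C * `|x| ^+ 2) ->
  exists2 c : R, 0 < c & forall x, `|x| ^+ 2 <= c * (1 + N x).
Proof.
move=> growth; have [c c0 Hc] := gauge_quadratic_far _ growth.
have [M M0 HM] := gauge_le1_bounded.
exists (c + M ^+ 2); first by rewrite addr_gt0// exprn_gt0.
move=> x; have [h|h] := leP (N x) 1.
  apply: le_trans (_ : M ^+ 2 <= _); first by rewrite ler_sqr ?nnegrE ?(ltW M0)// HM.
  have := N0 x; have := sqr_ge0 M; nra.
apply: le_trans (Hc _ (ltW h)) _.
have := sqr_ge0 M; nra.
Qed.

(** Subhomogeneity concerns dilates of a compact set; with the unit level set and t = N(x) it
    becomes a pointwise comparison with N. The origin lies on no such dilation curve, whence the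
    hypothesis [Pt 0 = 0]. *)
Lemma gauge_subhom (Pt : rv -> R) (e : R) : subhomogeneous E Pt -> Pt 0 = 0 -> 0 < e ->
  exists2 tau : R, 0 < tau & forall x, N x < tau -> `|Pt x| <= e * N x.
Proof.
move=> [_ H] Pt0 e0; have [tau [tau0 Ht]] := H e e0 _ cpt.
exists tau => // x Nx; have [->|x0] := eqVneq x 0.
  by rewrite Pt0 normr0 mulr_ge0// ltW.
rewrite -[x in Pt x](gauge_polar _ x0); apply: Ht => //; first exact: gauge_gt0.
exact: gauge_normalize.
Qed.

End gauge.

(** * Gaussian majorants *)

Section gaussian.
Context {R : realType} {d : nat}.
Local Notation rv := 'rV[R]_d.
Local Notation leb := (@lebesgue_measure R).

Lemma integral_gauss_scaled (a : R) : 0 < a ->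
  (\int[leb]_s (expR (- a * s ^+ 2))%:E < +oo)%E.
Proof.
move=> a0; pose b := Num.sqrt a.
have b0 : 0 < b by rewrite sqrtr_gt0.
have mg : measurable_fun setT (fun s => (gauss_fun s)%:E : \bar R).
  by apply/measurable_EFinP; exact: measurable_gauss_fun.
have g0 x : (0 <= (gauss_fun x)%:E :> \bar R)%E by rewrite lee_fin gauss_fun_ge0.
have := ge0_integral_affine b 0 _ b0 mg g0.
have -> : (\int[leb]_s (gauss_fun (b * s + 0))%:E = \int[leb]_s (expR (- a * s ^+ 2))%:E)%E.
  apply: eq_integral => s _; rewrite /gauss_fun addr0 exprMn sqr_sqrtr ?(ltW a0)//.
  by rewrite mulNr.
by move=> ->; rewrite integralT_gauss -EFinM ltry.
Qed.

Lemma integrable_gauss_rV (a : R) : 0 < a ->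
  lebd.-integrable setT (EFin \o (fun x : rv => expR (- a * \sum_(j < d) x ord0 j ^+ 2))).
Proof.
move=> a0.
pose G m (x : rv) := expR (- a * \sum_(j < d | (j < m)%N) x ord0 j ^+ 2).
have mG m : measurable_fun setT (G m).
  apply: continuous_measurable_rV; apply: (cont_comp expR); first exact: continuous_expR.
  apply: contM; first exact: cont_cst.
  apply: continuous_sum_fun => j _; apply: (cont_comp (fun s => s ^+ 2)).
    exact: exprn_continuous.
  exact: coord_continuous.
have H m : (m <= d)%N -> (\int[lebm m]_x (G m x)%:E < +oo)%E.
  elim: m => [|m IH] md.
    rewrite (@eq_measure_integral _ _ _ setT rv_dirac0)//.
    rewrite integral_dirac//=; last by apply/measurable_EFinP; exact: mG.
    by rewrite diracE in_setT mul1e ltry.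
  rewrite (ge0_integral_lebmS m (fun x => (G m.+1 x)%:E))//; last 2 first.
  - by apply/measurable_EFinP; exact: mG.
  - by move=> x; rewrite lee_fin expR_ge0.
  have e s w : (G m.+1 (set_coord w m s))%:E = ((expR (- a * s ^+ 2))%:E * (G m w)%:E)%E.
    rewrite -EFinM /G -expRD; congr (expR _)%:E.
    rewrite (bigD1 (Ordinal md))//= set_coordE eqxx mulrDr; congr (_ + _ * _).
    apply: eq_big => [j|j].
      by rewrite -val_eqE/= ltnS; case: ltngtP.
    by rewrite -val_eqE/= => /andP[_ jm]; rewrite set_coordE (negbTE jm).
  have I0 : (0 <= \int[lebm m]_w (G m w)%:E)%E by apply: integral_ge0 => w _; rewrite lee_fin expR_ge0.
  rewrite (eq_integral (fun s : measurableTypeR R => ((expR (- a * (s : R) ^+ 2)%R)%:E * \int[lebm m]_w (G m w)%:E)%E)).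
    rewrite ge0_integralZr//.
    - apply: lte_mul_pinfty; last exact: IH (ltnW md).
        by apply: integral_ge0 => s _; rewrite lee_fin expR_ge0.
      rewrite ge0_fin_numE; first exact: integral_gauss_scaled.
      by apply: integral_ge0 => s _; rewrite lee_fin expR_ge0.
    - apply/measurable_EFinP; apply: continuous_measurable_fun.
      apply: (cont_comp expR); first exact: continuous_expR.
      by apply: contM; [exact: cont_cst|exact: exprn_continuous].
  move=> s _; under eq_integral do rewrite e.
  rewrite ge0_integralZl//.
  - by apply/measurable_EFinP; exact: mG.
  - by move=> w _; rewrite lee_fin expR_ge0.
have -> : (fun x : rv => expR (- a * \sum_(j < d) x ord0 j ^+ 2)) = G d.
  by apply/funext => x; rewrite /G; under [in RHS]eq_bigl do rewrite ltn_ord.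
apply/integrableP; split; first by apply/measurable_EFinP; exact: mG.
have := H d (leqnn d); congr (_ < _)%E; apply: eq_integral => x _.
by rewrite /= ger0_norm ?expR_ge0.
Qed.

Lemma integrable_exp_quadratic (N : rv -> R) (c a : R) : continuous N ->
  0 < c -> 0 < a -> (forall x, `|x| ^+ 2 <= c * (1 + N x)) ->
  lebd.-integrable setT (EFin \o (fun x => expR (- a * N x))).
Proof.
move=> cN c0 a0 H.
(* Chosen so that b times the sum of squares is at most a (1 + N x); d+1 in place of d avoids a zero
   denominator in dimension 0. *)
pose b := a / (c * d.+1%:R).
have b0 : 0 < b by rewrite divr_gt0// mulr_gt0.
have I := integrableZl measurableT (expR a) (integrable_gauss_rV b b0).
apply: le_integrable I => //.
  apply/measurable_EFinP; apply: continuous_measurable_rV.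
  by apply: (cont_comp expR); [exact: continuous_expR|apply: contM => //; exact: cont_cst].
move=> x _ /=; rewrite lee_fin -expRD !ger0_norm ?expR_ge0// ler_expR.
have S : \sum_(j < d) x ord0 j ^+ 2 <= d.+1%:R * `|x| ^+ 2.
  apply: le_trans (ler_sum _ (G := fun=> `|x| ^+ 2) _) _.
    by move=> j _; rewrite -[leLHS]real_normK ?num_real// ler_sqr ?nnegrE// le_coord_norm.
  rewrite sumr_const card_ord -[leLHS]mulr_natl ler_wpM2r ?sqr_ge0//.
  by rewrite ler_nat.
have S2 : b * (\sum_(j < d) x ord0 j ^+ 2) <= a * (1 + N x).
  apply: le_trans (_ : b * (d.+1%:R * (c * (1 + N x))) <= _).
    rewrite ler_wpM2l ?(ltW b0)// (le_trans S)// ler_wpM2l//.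
  rewrite le_eqVlt; apply/orP; left; apply/eqP; rewrite /b.
  have : d.+1%:R != 0 :> R by rewrite pnatr_eq0.
  by move: (d.+1%:R : R) => D D0; field; rewrite D0 gt_eqF.
by lra.
Qed.

End gaussian.

(** * The peak of the characteristic function *)

Section growth_poly.
Context {R : realType} {d : nat}.
Local Notation rv := 'rV[R]_d.

(** On the unit ball a monomial of degree at least 2 is at most |x|^2. *)
Lemma poly_no_low_growth (p : rv -> R) : poly_no_low p ->
  exists C : R, forall x, `|x| <= 1 -> `|p x| <= C * `|x| ^+ 2.
Proof.
move=> [s [ms pE]]; exists (\sum_(m <- s) `|m.1|) => x x1; rewrite pE.
apply: le_trans (ler_norm_sum _ _ _) _; rewrite mulr_suml.
rewrite big_seq [leRHS]big_seq; apply: ler_sum => m sm.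
rewrite normrM ler_wpM2l// normr_prod.
apply: le_trans (_ : \prod_(i < d) `|x| ^+ m.2 ord0 i <= _).
  apply: ler_prod => i _; rewrite normr_ge0/= normrX.
  by rewrite lerXn2r ?nnegrE// le_coord_norm.
rewrite prodrXr ler_wiXn2l//; exact: ms.
Qed.

End growth_poly.

Section fourier_peak.
Context {R : realType} {d : nat}.
Local Notation zv := 'rV[int]_d.
Local Notation rv := 'rV[R]_d.
Local Notation Re := complex.Re.
Local Notation Im := complex.Im.
Variables (phi : zv -> R[i]) (xi0 : rv).
Hypothesis phiS : in_Sd phi.
Hypothesis sup1 : sup (range (fun xi => cmod (fourier phi xi))) = 1.
Hypothesis Om : Omega phi = [set xi0].

Lemma iexp_int (z : int) : iexp (z%:~R * (2 * pi)) = 1 :> R[i].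
Proof.
have H (n : nat) : cos (n%:R * (2 * pi)) = 1 :> R /\ sin (n%:R * (2 * pi)) = 0 :> R.
  elim: n => [|n [c s]]; first by rewrite mul0r sin0 cos0.
  have e : 2 * pi = pi *+ 2 :> R by rewrite mulr_natl.
  by rewrite -natr1 mulrDl mul1r {2 4}e cosD2pi sinD2pi c s.
have [n [->|->]] : exists n : nat, z%:~R = n%:R :> R \/ z%:~R = - n%:R :> R.
  by case: z => n; [exists n; left|exists n.+1; right; rewrite NegzE mulrNz].
  by have [c s] := H n; apply: complex_ext; rewrite ?Re_iexp ?Im_iexp ?c ?s.
have [c s] := H n; apply: complex_ext.
  by rewrite Re_iexp mulNr cosN c.
by rewrite Im_iexp mulNr sinN s oppr0.
Qed.

Lemma fourier_periodic (xi : rv) (k : zv) :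
  fourier phi (xi + (2 * pi) *: zR k) = fourier phi xi.
Proof.
rewrite /fourier; congr zsum; apply/funext => x; congr (_ * _).
rewrite -!/(iexp _) dotRDr iexpD dotRZr.
rewrite (_ : 2 * pi * dotR (zR x) (zR k) = (\sum_i x ord0 i * k ord0 i)%:~R * (2 * pi)).
  by rewrite iexp_int mulr1.
rewrite mulrC; congr (_ * _); rewrite /dotR rmorph_sum/=; apply: eq_bigr => i _.
by rewrite !mxE rmorphM.
Qed.

Lemma xi0_range i : - pi < xi0 ord0 i <= pi.
Proof. by have [h _] : Omega phi xi0 by rewrite Om. Qed.

Lemma cmod_fourier_xi0 : cmod (fourier phi xi0) = 1.
Proof. by have [_ h] : Omega phi xi0 by rewrite Om. Qed.

Lemma fourier_xi0_neq0 : fourier phi xi0 != 0.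
Proof.
by apply/eqP => h; have := cmod_fourier_xi0; rewrite h cmod0 => /eqP; rewrite eq_sym oner_eq0.
Qed.

(** Periodicity brings t + xi0 back into (-pi, pi]^d, where xi0 is the only peak. So the coordinates
    of t are multiples of 2 pi of absolute value at most pi. *)
Lemma fourier_peak (t : rv) : (forall i, `|t ord0 i| <= pi) ->
  cmod (fourier phi (t + xi0)) = 1 -> t = 0.
Proof.
move=> tpi t1.
have p0 := @pi_gt0 R.
(* One period up or down suffices, the coordinates of t + xi0 lying in (-2 pi, 2 pi]. *)
pose k : zv := \row_i (if pi < t ord0 i + xi0 ord0 i then (-1 : int)
   else if t ord0 i + xi0 ord0 i <= - pi then 1 else 0).
have Ok : Omega phi (t + xi0 + (2 * pi) *: zR k).
  split; last by rewrite fourier_periodic.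
  move=> i; rewrite !mxE; have := tpi i; have := xi0_range i; rewrite ler_norml.
  move=> /andP[a1 a2] /andP[b1 b2].
  case: ifPn => [h1|]; first by rewrite mulrN1z; apply/andP; split; lra.
  rewrite -leNgt => h1; case: ifPn => [h2|].
    by apply/andP; split; lra.
  by rewrite -ltNge => h2; apply/andP; split; lra.
rewrite Om in Ok; move: Ok => /= Ok.
apply/rowP => i; rewrite mxE.
have := congr1 (fun v : rv => v ord0 i) Ok; rewrite !mxE.
have := tpi i; rewrite ler_norml => /andP[b1 b2].
case: ifPn => [h1|_]; first by rewrite mulrN1z; lra.
by case: ifPn => [h2|_]; lra.
Qed.

(** On the compact set left when V is removed from the cube the maximum is attained, and
    [fourier_peak] excludes the value 1. If nothing is left, rho = 0 serves. *)
Lemma fourier_off_peak (V : set rv) : open V -> V 0 ->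
  exists2 rho : R, 0 <= rho < 1 & forall t : rv, (forall i, `|t ord0 i| <= pi) ->
    ~ V t -> cmod (fourier phi (t + xi0)) <= rho.
Proof.
move=> oV V0.
pose C := [set t : rv | (forall i, `|t ord0 i| <= pi)] `&` ~` V.
pose f t := cmod (fourier phi (t + xi0)).
have cf : continuous f.
  have cs : continuous (fun x : rv => x + xi0) by exact: continuous_shift.
  have cm : continuous (fun x => cmod (fourier phi x)).
    have -> : (fun x => cmod (fourier phi x)) =
       fun x => Num.sqrt (Re (fourier phi x) ^+ 2 + Im (fourier phi x) ^+ 2).
      by apply/funext => x; rewrite /cmod; case: (fourier phi x).
    apply: (cont_comp Num.sqrt); first exact: sqrt_continuous.
    apply: contD; apply: (cont_comp (fun s => s ^+ 2)); try exact: exprn_continuous.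
      exact: continuous_Re_fourier.
    exact: continuous_Im_fourier.
  by move=> x; have := continuous_comp (cs x) (cm (x + xi0)); exact.
have cC : compact C.
  apply: (@subclosed_compact _ _ [set t : rv | forall i, `[- pi, pi]%classic (t ord0 i)]).
  - apply: closedI; last exact: open_closedC.
    rewrite (_ : mkset _ = \bigcap_i [set t : rv | `|t ord0 i| <= pi]).
      apply: closed_bigI => i _.
      apply: (@preimage_closed _ _ (fun t : rv => `|t ord0 i|) [set y | y <= pi]).
        by move=> x _; apply: (cont_comp Num.norm); [exact: norm_continuous|exact: coord_continuous].
      exact: closed_le.
    by apply/seteqP; split => t h; [move=> i _; exact: h|move=> i; exact: (h i I)].
  - by apply: (@rV_compact _ _ (fun=> `[- pi, pi]%classic)) => i; exact: segment_compact.
  - by move=> t [h _] i /=; rewrite in_itv/= -ler_norml.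
have [[t0 Ct0]|Ce] := pselect (C !=set0); last first.
  exists 0; first by rewrite lexx ltr01.
  by move=> t tpi nV; exfalso; apply: Ce; exists t.
have [c /set_mem [cpi cV] cmax] : exists2 c, c \in C & forall t, t \in C -> f t <= f c.
  by apply: EVT_max_rV => //; [exists t0|exact: continuous_subspaceT].
exists (f c); last by move=> t tpi nV; apply: cmax; rewrite inE.
rewrite cmod_ge0/= lt_neqAle cmod_fourier_le1// andbT.
apply/eqP => /(fourier_peak _ cpi) c0; by rewrite c0 in cV.
Qed.

End fourier_peak.

Section asymptotics.
Context {R : realType}.

(** With l = -ln r, exp(n l) dominates (n l)^(k+1) / (k+1)! for an integer k >= mu: k powers of n
    give n^-mu, and the spare one absorbs the constant C/e. *)
Lemma geometric_le_powR (rho mu e : R) : 0 <= rho < 1 -> 0 < e ->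
  exists N : nat, forall n, (N <= n)%N -> rho ^+ n <= e * n%:R `^ (- mu).
Proof.
move=> /andP[rho0 rho1] e0.
(* Kept away from 0 so that its logarithm can be used even if rho = 0. *)
pose r := Num.max rho (1 / 2).
have r0 : 0 < r by rewrite lt_max; apply/orP; right; lra.
have r1 : r < 1 by rewrite gt_max rho1/=; lra.
pose l := - ln r.
have l0 : 0 < l by rewrite oppr_gt0 ln_lt0// r0.
have [k Hk] : exists k : nat, mu <= k%:R.
  by exists (Num.truncn `|mu|).+1; rewrite (le_trans (ler_norm _))// ltW// truncnS_gt.
pose C := (k.+1)`!%:R / l ^+ k.+1.
have C0 : 0 < C by rewrite divr_gt0 ?exprn_gt0// ltr0n fact_gt0.
exists (Num.truncn (C / e)).+1 => n nN.
have n1 : 1 <= n%:R :> R by rewrite ler1n (leq_trans _ nN).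
have n0 : 0 < n%:R :> R by rewrite (lt_le_trans ltr01).
have Cn : C / e <= n%:R.
  by apply: le_trans (ltW (truncnS_gt _)) _; rewrite ler_nat.
have h1 : rho ^+ n <= r ^+ n by rewrite lerXn2r ?nnegrE// ?(ltW r0)// le_max lexx.
apply: le_trans h1 _.
have -> : r ^+ n = (expR (n%:R * l))^-1.
  by rewrite -expRN /l mulrN opprK expRM_natl lnK.
have ln0 : 0 <= n%:R * l by rewrite mulr_ge0// ltW.
have h2 : (n%:R * l) ^+ k.+1 / (k.+1)`!%:R <= expR (n%:R * l).
  by apply: le_trans (expR_ge1Dxn k ln0); rewrite lerDr.
have h3 : 0 < (n%:R * l) ^+ k.+1 / (k.+1)`!%:R.
  by rewrite divr_gt0 ?exprn_gt0 ?mulr_gt0// ltr0n fact_gt0.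
apply: le_trans (_ : ((n%:R * l) ^+ k.+1 / (k.+1)`!%:R)^-1 <= _).
  by rewrite lef_pV2// posrE// expR_gt0.
have -> : ((n%:R * l) ^+ k.+1 / (k.+1)`!%:R)^-1 = C / n%:R * (n%:R ^+ k)^-1.
  rewrite invf_div exprMn /C exprSr; field.
  by rewrite !expf_neq0// ?gt_eqF.
apply: ler_pM.
- by rewrite divr_ge0// ltW.
- by rewrite invr_ge0 exprn_ge0// ltW.
- by rewrite ler_pdivrMr// mulrC -ler_pdivrMr// .
- rewrite powRN -powR_mulrn ?(ltW n0)// lef_pV2 ?posrE ?powR_gt0//.
  by rewrite ler_powR.
Qed.

End asymptotics.

(** * The convolution power as an integral around the peak *)

Section representation.
Context {R : realType} {d : nat}.
Local Notation zv := 'rV[int]_d.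
Local Notation rv := 'rV[R]_d.
Local Notation Re := complex.Re.
Local Notation Im := complex.Im.

Lemma pibox_eq1 (t : rv) : `|t| <= pi -> pibox d t = 1.
Proof.
move=> tpi; rewrite /pibox big1// => j _; rewrite /pi_ind indicE mem_set//=.
by rewrite in_itv/= -ler_norml (le_trans (le_coord_norm _ _)).
Qed.

Lemma pibox_neq0 (t : rv) : pibox d t != 0 -> forall i, `|t ord0 i| <= pi.
Proof.
move=> h i; apply: contraNT h => ti; rewrite /pibox (bigD1 i)//= /pi_ind indicE.
rewrite (_ : _ \in _ = false) ?mul0r//; apply/negbTE/negP; rewrite inE/= in_itv/= -ler_norml.
by move=> h; rewrite h in ti.
Qed.

Lemma measurable_cmod (f : rv -> R[i]) : cmeasurable f -> measurable_fun setT (fun x => cmod (f x)).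
Proof.
move=> [fr fi].
have -> : (fun x => cmod (f x)) = fun x => Num.sqrt (Re (f x) ^+ 2 + Im (f x) ^+ 2).
  by apply/funext => x; rewrite /cmod; case: (f x).
apply: (@measurableT_comp _ _ _ _ _ _ (@Num.sqrt R : measurableTypeR R -> measurableTypeR R)).
  by apply: continuous_measurable_fun; exact: sqrt_continuous.
by apply: measurable_funD; exact: measurable_funX.
Qed.

Variables (phi : zv -> R[i]) (xi0 : rv).
Hypothesis phiS : in_Sd phi.
Hypothesis sup1 : sup (range (fun xi => cmod (fourier phi xi))) = 1.
Hypothesis Om : Omega phi = [set xi0].
Variable alpha : rv.

Definition peak_ratio (t : rv) : R[i] := fourier phi (t + xi0) / fourier phi xi0.

(** The drift phase is built in: near 0 only the higher-order part of n Gamma remains, and the wave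
    factor outside carries exactly x - n alpha. *)
Definition amplitude n (t : rv) : R[i] :=
  (pibox d t)%:C * (peak_ratio t ^+ n * iexp (- (n%:R * dotR alpha t))).

Lemma cmod_peak_ratio t : cmod (peak_ratio t) = cmod (fourier phi (t + xi0)).
Proof. by rewrite /peak_ratio cmodM cmodV (cmod_fourier_xi0 _ _ Om) invr1 mulr1. Qed.

Lemma cmeasurable_amplitude n : cmeasurable (amplitude n).
Proof.
apply: cmeasurableM; first by apply: cmeasurable_real; exact: measurable_pibox.
apply: cmeasurableM.
  apply: cmeasurableX; apply: cmeasurableM; first exact: cmeasurable_fourier_shift.
  exact: cmeasurable_cst.
have := cmeasurable_iexp_dot (- (n%:R *: alpha)) 0.
by under eq_fun do rewrite dotRNl dotRZl addr0.
Qed.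

Lemma cmod_amplitude n t : cmod (amplitude n t) = pibox d t * cmod (fourier phi (t + xi0)) ^+ n.
Proof.
have [p0 _] := andP (pibox01 d t).
by rewrite /amplitude cmodM cmod_real ger0_norm// cmodM cmod_iexp mulr1 cmodX cmod_peak_ratio.
Qed.

Lemma cmod_amplitude_le n t : cmod (amplitude n t) <= pibox d t.
Proof.
have [p0 _] := andP (pibox01 d t).
rewrite cmod_amplitude ler_piMr// exprn_ile1 ?cmod_ge0//; exact: cmod_fourier_le1.
Qed.

Lemma cmeasurable_iexpN_dot (y : rv) : cmeasurable (fun t : rv => iexp (- dotR y t)).
Proof.
have := cmeasurable_iexp_dot (- y) 0.
by under eq_fun do rewrite dotRNl addr0.
Qed.

Lemma cintegrable_amplitude n (y : rv) :
  cintegrable (fun t => amplitude n t * iexp (- dotR y t)).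
Proof.
apply: cintegrable_le (integrable_pibox d) _.
  by apply: cmeasurableM; [exact: cmeasurable_amplitude|exact: cmeasurable_iexpN_dot].
by move=> t; rewrite cmodM cmod_iexp mulr1 cmod_amplitude_le.
Qed.

Lemma convpow_repr n x : (0 < n)%N -> convpow phi n x =
  fourier phi xi0 ^+ n * cexp (0 +i* (- dotR (zR x) xi0)) *
  (((2 * pi) ^- d)%:C *
    cint (fun t => amplitude n t * iexp (- dotR (zR x - n%:R *: alpha) t))).
Proof.
case: n => // n _; rewrite /convpow [n.+1.-1]/= (fourier_inversion _ xi0)//.
rewrite mulrCA; congr (_ * _).
rewrite -cintZ; last exact: cintegrable_amplitude.
apply: eq_cint => t; rewrite -/(iexp _) /amplitude /peak_ratio.
rewrite expr_div_n dotRDr dotRBl dotRZl !opprD !opprK !iexpD.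
have e : iexp (- (n.+1%:R * dotR alpha t)) * iexp (n.+1%:R * dotR alpha t) = 1.
  by rewrite -iexpD addNr iexp0.
have F0 : fourier phi xi0 ^+ n.+1 != 0 by rewrite expf_neq0// (fourier_xi0_neq0 _ _ Om).
by rewrite -[LHS]mulr1 -e; field; exact: F0.
Qed.

Lemma amplitude_cexp (U : set rv) (Q Qt Rr Rt : rv -> R) n t :
  Gamma_decomp phi xi0 U alpha Q Qt Rr Rt -> U t -> `|t| <= pi ->
  amplitude n t = cexp ((- (n%:R * (Rr t + Rt t))) +i* (- (n%:R * (Q t + Qt t)))).
Proof.
move=> [_ [_ [_ [_ [_ H]]]]] Ut tpi.
rewrite /amplitude pibox_eq1// mul1r /peak_ratio.
have [<- _] := H t Ut.
rewrite cexpX /iexp -cexpD; congr cexp; apply: complex_ext.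
  by rewrite ReD ReM natcE /= mul0r subr0 addr0; ring.
by rewrite ImD ImM natcE /= mul0r addr0; ring.
Qed.

End representation.

(** * The positive homogeneous case *)

Section positive_part.
Context {R : realType} {d : nat}.
Local Notation zv := 'rV[int]_d.
Local Notation rv := 'rV[R]_d.
Local Notation Re := complex.Re.
Local Notation Im := complex.Im.

Lemma poly_no_low_continuous (p : rv -> R) : poly_no_low p -> continuous p.
Proof.
move=> [s [_ pE]]; have -> : p = fun xi => \sum_(m <- s) m.1 * \prod_i xi ord0 i ^+ (m.2 ord0 i).
  by apply/funext.
apply: continuous_sum_fun => m _; apply: contM; first exact: cont_cst.
apply: continuous_prod_fun => i _; apply: (cont_comp (fun s => s ^+ m.2 ord0 i)).
  exact: exprn_continuous.
exact: coord_continuous.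
Qed.

Lemma open_ball0 (U : set rv) : open U -> U 0 -> exists2 r : R, 0 < r & forall t, `|t| <= r -> U t.
Proof.
move=> oU U0; have /nbhs_ballP[e /= e0 He] := open_nbhs_nbhs (conj oU U0).
exists (e / 2); first by rewrite divr_gt0.
move=> t te; apply: He; rewrite -ball_normE /= sub0r normrN; lra.
Qed.

Lemma cexpB1_cvg0 (a b : nat -> R) : a @ \oo --> (0 : R) -> b @ \oo --> (0 : R) ->
  (fun m => cmod (cexp (a m +i* b m) - 1)) @ \oo --> (0 : R).
Proof.
move=> ca cb.
have ea : expR (a m) @[m --> \oo] --> (1 : R).
  by rewrite -expR0; apply: continuous_cvg => //; exact: continuous_expR.
have eb : cos (b m) @[m --> \oo] --> (1 : R).
  by rewrite -cos0; apply: continuous_cvg => //; exact: continuous_cos.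
have es : sin (b m) @[m --> \oo] --> (0 : R).
  by rewrite -sin0; apply: continuous_cvg => //; exact: continuous_sin.
have c1 : (fun m => `|expR (a m) * cos (b m) - 1| + `|expR (a m) * sin (b m)|) @ \oo --> (0 : R).
  rewrite -[X in _ --> X]addr0; apply: cvgD.
    rewrite -(normr0 R) -[X in `|X|](subrr 1) -{1}[X in X - 1](mulr1 1).
    by apply: cvg_norm; apply: cvgB; [exact: cvgM|exact: cvg_cst].
  rewrite -(normr0 R) -[X in `|X|](mulr0 1).
  by apply: cvg_norm; exact: cvgM.
apply: (squeeze_cvgr _ (cvg_cst 0) c1); apply: nearW => m.
apply/andP; split; first exact: cmod_ge0.
apply: le_trans (cmod_le_ReIm _) _.
by rewrite ReB ImB /= subr0.
Qed.

Variables (phi : zv -> R[i]) (xi0 alpha : rv).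
Hypothesis phiS : in_Sd phi.
Hypothesis sup1 : sup (range (fun xi => cmod (fourier phi xi))) = 1.
Hypothesis Om : Omega phi = [set xi0].
Variables (U : set rv) (Q Qt Rr Rt : rv -> R) (E : 'M[R]_d).
Hypothesis dec : Gamma_decomp phi xi0 U alpha Q Qt Rr Rt.
Hypothesis (posR : pos_homogeneous Rr) (hR : Exp_set Rr E).
Hypothesis (sQt : subhomogeneous E Qt) (sRt : subhomogeneous E Rt).

Let cR : continuous Rr. Proof. by case: posR. Qed.
Let R0 x : 0 <= Rr x. Proof. by case: posR. Qed.
Let Req0 x : Rr x = 0 <-> x = 0. Proof. by case: posR. Qed.
Let cptR : compact [set x | Rr x = 1]. Proof. by case: posR. Qed.
Let ctr : contracting E. Proof. by case: sQt. Qed.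
Let cQ : continuous Q. Proof. by case: dec => _ [/poly_no_low_continuous]. Qed.
Let Rt0 : Rt 0 = 0. Proof. by case: dec => _ [_ [_ [_ [[]]]]]. Qed.
Let Qt0 : Qt 0 = 0. Proof. by case: dec => _ [_ [_ [[]]]]. Qed.

Let integrable_expR (a : R) : 0 < a ->
  lebd.-integrable setT (EFin \o (fun x => expR (- a * Rr x))).
Proof.
move=> a0; have [_ [_ [pR _]]] := dec.
have [C HC] := poly_no_low_growth _ pR.
have growth x : `|x| <= 1 -> Rr x <= C * `|x| ^+ 2.
  by move=> x1; exact: le_trans (ler_norm _) (HC _ x1).
have [c c0 Hc] := gauge_quadratic _ _ cR R0 Req0 cptR hR ctr _ growth.
exact: integrable_exp_quadratic c0 a0 Hc.
Qed.

(** The integrand of the attractor at time n, without its wave factor and in the unscaled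
    variable. *)
Let B (n : nat) (t : rv) : R[i] := cexp ((- (n%:R * Rr t)) +i* (- (n%:R * Q t))).

Let cmod_B n t : cmod (B n t) = expR (- (n%:R * Rr t)).
Proof. by rewrite /B cmod_cexp. Qed.

Let mB n : cmeasurable (B n).
Proof.
apply: cmeasurable_cexp; split => /=; apply: continuous_measurable_rV; apply: contN;
  by apply: contM => //; exact: cont_cst.
Qed.

Let err n t := cmod (amplitude phi xi0 alpha n t - B n t).

Let merr n : measurable_fun setT (err n).
Proof.
apply: measurable_cmod; apply: cmeasurableB => //; exact: cmeasurable_amplitude.
Qed.

Lemma positive_nbhd : exists2 delta : R, 0 < delta & forall t, Rr t < delta ->
  [/\ U t, `|t| <= pi & `|Rt t| <= 1 / 2 * Rr t].
Proof.
have [[oU U0 _] _] := dec.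
have [r r0 Hr] := open_ball0 _ oU U0.
have m0 : 0 < Num.min r pi by rewrite lt_min r0 pi_gt0.
have [t1 t10 H1] := gauge_small _ _ R0 Req0 cptR hR ctr _ m0.
have [t2 t20 H2] := gauge_subhom _ _ R0 Req0 cptR hR _ (1 / 2) sRt Rt0 ltac:(lra).
exists (Num.min t1 t2); first by rewrite lt_min t10.
move=> t; rewrite lt_min => /andP[/H1 + /H2 h2]; rewrite le_min => /andP[a b].
by split => //; exact: Hr.
Qed.

Section scaled.
Variable delta : R.
Hypotheses (delta0 : 0 < delta) (Hdelta : forall t, Rr t < delta ->
  [/\ U t, `|t| <= pi & `|Rt t| <= 1 / 2 * Rr t]).

(** The part of the error to be dilated. Where R >= delta only the attractor is kept; the amplitude
    there is left to the geometric bound in [err_le]. *)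
Let f n t := if Rr t < delta then err n t else expR (- (n%:R * Rr t)).

Let mf n : measurable_fun setT (f n).
Proof.
have mR : measurable_fun setT Rr by exact: continuous_measurable_rV.
apply: measurable_fun_ifT.
- by apply: measurable_fun_ltr => //; exact: measurable_cst.
- exact: merr.
- apply: continuous_measurable_rV; apply: (cont_comp expR); first exact: continuous_expR.
  by apply: contN; apply: contM => //; exact: cont_cst.
Qed.

Let f_ge0 n t : 0 <= f n t.
Proof. by rewrite /f; case: ifP => _; [exact: cmod_ge0|exact: expR_ge0]. Qed.

(** Where R < delta the remainder [Rt] costs at most half of R, so amplitude and attractor are each
    at most exp(-n R/2). Under dilation by n^-E this bound no longer depends on n. *)
Let f_le n t : f n t <= 2 * expR (- (1 / 2) * (n%:R * Rr t)).
Proof.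
have nR : 0 <= n%:R * Rr t by exact: mulr_ge0.
have h1 : expR (- (n%:R * Rr t)) <= expR (- (1 / 2) * (n%:R * Rr t)).
  by rewrite ler_expR; lra.
have h0 := expR_ge0 (- (1 / 2) * (n%:R * Rr t)).
rewrite /f; case: ifPn => [Rd|_]; last by lra.
have [Ut tpi Rtt] := Hdelta _ Rd.
apply: le_trans (cmodB _ _) _; rewrite cmod_B.
rewrite (amplitude_cexp _ _ _ _ _ _ _ _ _ _ dec)// cmod_cexp /=.
suff : expR (- (n%:R * (Rr t + Rt t))) <= expR (- (1 / 2) * (n%:R * Rr t)) by lra.
rewrite ler_expR; move: Rtt; rewrite ler_norml => /andP[a _].
rewrite mulrDr; have : - (1 / 2) * (n%:R * Rr t) <= n%:R * Rt t.
  by rewrite mulrCA ler_wpM2l// mulNr.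
by lra.
Qed.

Let f_integrable n : (0 < n)%N -> lebd.-integrable setT (EFin \o f n).
Proof.
move=> n0; have n0' : 0 < 1 / 2 * n%:R :> R by rewrite mulr_gt0// ?ltr0n//; lra.
have I := integrableZl measurableT 2 (integrable_expR _ n0').
apply: le_integrable I => //; first by apply/measurable_EFinP; exact: mf.
move=> t _ /=; rewrite lee_fin !ger0_norm ?mulr_ge0 ?expR_ge0//.
apply: le_trans (f_le _ _) _; rewrite le_eqVlt; apply/orP; left; apply/eqP.
by congr (_ * expR _); ring.
Qed.

Let F m z := f m.+1 (act (tpow (m.+1%:R)^-1 E) z).

Let iS m : 0 < (m.+1%:R)^-1 :> R. Proof. by rewrite invr_gt0. Qed.

Let n_scale (P : rv -> R) (hP : Exp_set P E) m z :
  m.+1%:R * P (act (tpow (m.+1%:R)^-1 E) z) = P z.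
Proof. by rewrite hP// mulrA divff ?mul1r. Qed.

(** Once R(z)/n < tau, |Pt(n^-E z)| is at most e' R(n^-E z) = e' R(z)/n; with e' = e/(R z + 1), n
    times this is at most e. *)
Let subhom_scaled (Pt : rv -> R) (sP : subhomogeneous E Pt) (P0 : Pt 0 = 0) z :
  (fun m => - (m.+1%:R * Pt (act (tpow (m.+1%:R)^-1 E) z))) @ \oo --> (0 : R).
Proof.
apply/cvgrPdist_le => e e0.
have e' : 0 < e / (Rr z + 1) by rewrite divr_gt0// ltr_wpDl.
have [tau tau0 Ht] := gauge_subhom _ _ R0 Req0 cptR hR _ _ sP P0 e'.
exists (Num.truncn (Rr z / tau)) => // m /= mM.
have Rs : Rr (act (tpow m.+1%:R^-1 E) z) < tau.
  rewrite hR// mulrC ltr_pdivrMr// mulrC -ltr_pdivrMr//.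
  by apply: lt_le_trans (truncnS_gt _) _; rewrite ler_nat.
rewrite sub0r opprK normrM ger0_norm//.
have h := Ht _ Rs.
apply: le_trans (_ : m.+1%:R * (e / (Rr z + 1) * Rr (act (tpow m.+1%:R^-1 E) z)) <= _).
  by rewrite ler_wpM2l.
rewrite mulrCA n_scale// mulrAC ler_pdivrMr ?ltr_wpDl//.
by rewrite ler_wpM2l ?(ltW e0)// lerDl.
Qed.

Let F_cvg z : F m z @[m --> \oo] --> (0 : R).
Proof.
have c1 := cexpB1_cvg0 _ _ (subhom_scaled _ sRt Rt0 z) (subhom_scaled _ sQt Qt0 z).
apply: (squeeze_cvgr _ (cvg_cst 0) c1).
exists (Num.truncn (Rr z / delta)) => // m /= mM.
rewrite f_ge0/= /F /f.
have Rs : Rr (act (tpow m.+1%:R^-1 E) z) < delta.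
  rewrite hR// mulrC ltr_pdivrMr// mulrC -ltr_pdivrMr//.
  by apply: lt_le_trans (truncnS_gt _) _; rewrite ler_nat.
rewrite Rs; set t := act _ z; have [Ut tpi _] := Hdelta _ Rs.
rewrite /err (amplitude_cexp _ _ _ _ _ _ _ _ _ _ dec)//.
(* Factoring out [B], of modulus at most 1, leaves the exponential of the scaled remainders minus
   1. *)
have -> : cexp ((- (m.+1%:R * (Rr t + Rt t))) +i* (- (m.+1%:R * (Q t + Qt t)))) =
   B m.+1 t * cexp ((- (m.+1%:R * Rt t)) +i* (- (m.+1%:R * Qt t))).
  rewrite /B -cexpD; congr cexp; apply: complex_ext; rewrite ?ReD ?ImD /=; ring.
rewrite -[X in _ - X]mulr1 -mulrBr cmodM ler_piMl ?cmod_ge0//.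
by rewrite cmod_B -expR0 ler_expR oppr_le0 mulr_ge0.
Qed.

Let F_le m z : `|F m z| <= 2 * expR (- (1 / 2) * Rr z).
Proof.
rewrite ger0_norm; last exact: f_ge0.
by apply: le_trans (f_le _ _) _; rewrite n_scale.
Qed.

(** The Jacobian of t = n^-E z cancels n^(tr E); the scaled errors tend to 0 pointwise under the
    fixed majorant 2 exp(-R/2). *)
Lemma scaled_error_cvg0 :
  (fun m => m.+1%:R `^ (\tr E) * \int[lebd]_t f m.+1 t) @ \oo --> (0 : R).
Proof.
have I : lebd.-integrable setT (EFin \o (fun z => 2 * expR (- (1 / 2) * Rr z))).
  rewrite /comp; under eq_fun do rewrite EFinM.
  by apply: integrableZl => //; apply: integrable_expR; lra.
have mF m : measurable_fun setT (F m).
  exact: (measurableT_comp (mf m.+1) (measurable_act _)).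
have H := Rintegral_dominated F (cst 0) _ mF (measurable_cst _) F_cvg I F_le.
have Z : \int[lebd]_x (cst 0 : rv -> R) x = 0 by rewrite /Rintegral integral0_eq.
rewrite Z in H.
suff -> : (fun m => m.+1%:R `^ (\tr E) * \int[lebd]_t f m.+1 t) = (fun m => \int[lebd]_z F m z) by [].
apply/funext => m.
rewrite /F (Rintegral_tpow (m.+1%:R)^-1 E (f m.+1))//; last exact: f_integrable.
by congr (_ * _); rewrite -[_^-1]powR_inv1// -powRrM mulN1r opprK.
Qed.

Lemma err_le rho : 0 <= rho < 1 ->
  (forall t : rv, (forall i, `|t ord0 i| <= pi) -> ~ Rr t < delta ->
    cmod (fourier phi (t + xi0)) <= rho) ->
  forall n t, err n t <= f n t + rho ^+ n * pibox d t.
Proof.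
move=> /andP[rho0 rho1] Hrho n t.
have [p0 p1] := andP (pibox01 d t).
rewrite /f; case: ifPn => Rd; first by rewrite lerDl mulr_ge0// exprn_ge0.
apply: le_trans (cmodB _ _) _; rewrite cmod_B addrC lerD2l cmod_amplitude//.
have [->|pn] := eqVneq (pibox d t) 0; first by rewrite mul0r mulr0.
rewrite mulrC ler_wpM2r// lerXn2r ?nnegrE ?cmod_ge0//.
apply: Hrho; first exact: pibox_neq0.
exact/negP.
Qed.

Lemma int_err_le n rho : (0 < n)%N -> 0 <= rho < 1 ->
  (forall t : rv, (forall i, `|t ord0 i| <= pi) -> ~ Rr t < delta ->
    cmod (fourier phi (t + xi0)) <= rho) ->
  lebd.-integrable setT (EFin \o err n) /\
  \int[lebd]_t err n t <= \int[lebd]_t f n t + rho ^+ n * \int[lebd]_t pibox d (t : rv).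
Proof.
move=> n0 r01 Hrho; have [rho0 _] := andP r01.
have I2 : lebd.-integrable setT (EFin \o (fun t : rv => rho ^+ n * pibox d t)).
  rewrite /comp; under eq_fun do rewrite EFinM.
  by apply: integrableZl => //; exact: integrable_pibox.
have I12 : lebd.-integrable setT (EFin \o (fun t : rv => f n t + rho ^+ n * pibox d t)).
  rewrite /comp; under eq_fun do rewrite EFinD.
  by apply: integrableD => //; exact: f_integrable.
have Ie : lebd.-integrable setT (EFin \o err n).
  apply: le_integrable I12 => //; first by apply/measurable_EFinP; exact: merr.
  move=> t _ /=; rewrite lee_fin ger0_norm ?cmod_ge0//.
  by apply: le_trans (err_le _ r01 Hrho n t) _; exact: ler_norm.
split => //; apply: le_trans (_ : \int[lebd]_t (f n t + rho ^+ n * pibox d t) <= _).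
  by apply: le_Rintegral => // t _; exact: err_le.
rewrite (RintegralD _ (f_integrable _ n0) I2)// RintegralZl//; exact: integrable_pibox.
Qed.

End scaled.

Lemma int_err_small (e : R) : 0 < e -> exists N : nat, forall n, (N <= n)%N ->
  (0 < n)%N /\ lebd.-integrable setT (EFin \o err n) /\
  \int[lebd]_t err n t <= e * n%:R `^ (- \tr E).
Proof.
move=> e0; have [delta delta0 Hd] := positive_nbhd.
have oV : open [set t | Rr t < delta].
  by apply: (@open_comp _ _ Rr [set y | y < delta]); [move=> x _; exact: cR|exact: open_lt].
have V0 : [set t | Rr t < delta] 0 by rewrite /= (Req0 0).2.
have [rho r01 Hrho] := fourier_off_peak _ _ phiS sup1 Om _ oV V0.
set K := \int[lebd]_t pibox d (t : rv).
have K0 : 0 <= K by apply: Rintegral_ge0 => t _; case/andP: (pibox01 d t).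
(* Half of e goes to the geometric part, half to the dilated part; K + 1 keeps the denominator
   positive. *)
have e1 : 0 < e / (2 * (K + 1)) by rewrite divr_gt0// mulr_gt0// ltr_wpDl.
have [N1 H1] := geometric_le_powR rho (\tr E) _ r01 e1.
have e2 : 0 < e / 2 by rewrite divr_gt0.
have := scaled_error_cvg0 _ delta0 Hd => /cvgrPdist_le /(_ _ e2) [N2 _ H2].
exists (maxn N1 N2).+1 => -[//|n] nN; split => //.
have [I le] := int_err_le _ Hd n.+1 rho isT r01 Hrho.
split => //; apply: le_trans le _.
have nN1 : (N1 <= n.+1)%N by apply: leq_trans nN; rewrite leqW// leq_maxl.
have nN2 : (N2 <= n)%N by rewrite (leq_trans _ (nN : (maxn N1 N2 <= n)%N))// leq_maxr.
have := H2 n nN2; rewrite sub0r normrN => h2.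
have {h2} := le_trans (ler_norm _) h2.
set If := Rintegral _ _ _; set p := n.+1%:R `^ \tr E => h2.
have p0 : 0 < p by rewrite powR_gt0.
have h1 := H1 _ nN1; rewrite powRN -/p in h1 *.
have h3 : If <= e / 2 * p^-1 by rewrite ler_pdivlMr// mulrC.
have h4 : rho ^+ n.+1 * K <= e / 2 * p^-1.
  apply: le_trans (ler_wpM2r K0 h1) _.
  rewrite mulrAC ler_wpM2r ?invr_ge0 ?(ltW p0)//.
  rewrite mulrAC ler_pdivrMr ?mulr_gt0 ?ltr_wpDl//.
  rewrite [leRHS](_ : _ = e * (K + 1)); last by field.
  by rewrite ler_wpM2l ?(ltW e0)// lerDl.
rewrite -/K; apply: le_trans (lerD h3 h4) _.
by rewrite le_eqVlt; apply/orP; left; apply/eqP; field; exact: lt0r_neq0.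
Qed.

Theorem positive_local_limit (P : rv -> R[i]) : (forall xi, P xi = (Rr xi) +i* (Q xi)) ->
  forall eps : R, 0 < eps -> exists N : nat, forall n : nat, (N <= n)%N ->
  forall x : zv,
    cmod (convpow phi n x
      - fourier phi xi0 ^+ n * cexp (0 +i* (- dotR (zR x) xi0))
        * H_attr P n%:R (zR x - n%:R *: alpha))
    <= eps * n%:R `^ (- \tr E).
Proof.
move=> PE eps eps0.
pose c : R := (2 * pi) ^- d.
have c0 : 0 < c by rewrite invr_gt0 exprn_gt0// mulr_gt0// pi_gt0.
(* The 2 is lost in [cmod_cint_le], where real and imaginary parts are bounded separately. *)
have e1 : 0 < eps / (2 * c) by rewrite divr_gt0// mulr_gt0.
have [N HN] := int_err_small _ e1; exists N => n /HN [n0 [I le]] x.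
set y := zR x - _.
have n0' : 0 < n%:R :> R by rewrite ltr0n.
have iB : cintegrable (fun t => B n t * iexp (- dotR y t)).
  apply: cintegrable_le (integrable_expR _ n0') _.
    by apply: cmeasurableM => //; exact: cmeasurable_iexpN_dot.
  by move=> t; rewrite cmodM cmod_iexp mulr1 cmod_B mulNr.
have HE : H_attr P n%:R y = c%:C * cint (fun t => B n t * iexp (- dotR y t)).
  rewrite /H_attr -cintRdE//; congr (_ * cintRd _); apply/funext => t.
  rewrite /B /iexp -cexpD; congr cexp; apply: complex_ext.
    by rewrite ReB ReD ReN ReM PE /= mul0r !subr0 addr0.
  by rewrite ImB ImD ImN ImM PE /= mul0r addr0.
rewrite (convpow_repr _ _ phiS sup1 Om alpha)// HE -/y -/c -mulrBr -mulrBr.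
rewrite -cintB//; last exact: cintegrable_amplitude.
rewrite -/(iexp _) !cmodM cmodX (cmod_fourier_xi0 _ _ Om) expr1n cmod_iexp !mul1r.
rewrite cmod_real gtr0_norm//.
have h : cmod (cint (fun t => amplitude phi xi0 alpha n t * iexp (- dotR y t) - B n t * iexp (- dotR y t)))
   <= 2 * \int[lebd]_t err n t.
  apply: cmod_cint_le => //.
    by apply: cintegrable_measurable; apply: cintegrableB => //; exact: cintegrable_amplitude.
  by move=> t; rewrite -mulrBl cmodM cmod_iexp mulr1.
apply: le_trans (_ : c * (2 * (eps / (2 * c) * n%:R `^ (- \tr E))) <= _).
  by rewrite ler_wpM2l ?(ltW c0)// (le_trans h)// ler_wpM2l.
rewrite le_eqVlt; apply/orP; left; apply/eqP; field; exact: lt0r_neq0.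
Qed.

End positive_part.

(** * Derivatives along dilation curves *)

Section chain_rule.
Context {R : realType} {d : nat}.
Local Notation rv := 'rV[R]_d.
Implicit Types (f : rv -> R).

Definition basis_vec (j : 'I_d) : rv := delta_mx 0 j.

Lemma is_derive_line f (p e : rv) (r : R) : derivable f (p + r *: e) e ->
  is_derive r (1 : R) (fun s => f (p + s *: e)) ('D_e f (p + r *: e)).
Proof.
move=> df.
have E : (fun h : R => h^-1 *: (((fun s => f (p + s *: e)) \o shift r) (h *: (1 : R)) - f (p + r *: e))) =
    (fun h => h^-1 *: ((f \o shift (p + r *: e)) (h *: e) - f (p + r *: e))).
  apply/funext => h /=; congr (_ *: (f _ - _)).
  by rewrite [h *: 1]mulr1 scalerDl addrCA.
by apply: DeriveDef; rewrite ?/derivable ?/derive E.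
Qed.

Lemma mvt_direction f (p e : rv) (h : R) :
  (forall c, `|c| <= `|h| -> derivable f (p + c *: e) e) ->
  exists2 c, `|c| <= `|h| & f (p + h *: e) - f p = h * 'D_e f (p + c *: e).
Proof.
move=> df.
pose F s := f (p + s *: e).
have dF c : `|c| <= `|h| -> is_derive c (1 : R) F ('D_e f (p + c *: e)).
  by move=> ch; apply: is_derive_line; exact: df.
have cF c : `|c| <= `|h| -> {for c, continuous F}.
  move=> /dF dc; have : derivable F c 1 by exact: ex_derive.
  by move=> /derivable1_diffP/differentiable_continuous.
have F0 : F 0 = f p by rewrite /F scale0r addr0.
have [h0|h0|h0] := ltgtP h 0.
- have nh : `|h| = - h by rewrite ltr0_norm.
  have [||c] := @MVT _ F (fun c => 'D_e f (p + c *: e)) h 0 h0.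
  + move=> x; rewrite in_itv/= => /andP[a b]; apply: dF; rewrite nh ltr0_norm//; lra.
  + apply: continuous_in_subspaceT => x; rewrite inE/= in_itv/= => /andP[a b].
    by apply: cF; rewrite nh ler0_norm//; lra.
  rewrite in_itv/= => /andP[a b] e1; exists c; first by rewrite nh ltr0_norm//; lra.
  by rewrite -/(F h) -F0; move: e1; lra.
- have nh : `|h| = h by rewrite gtr0_norm.
  have [||c] := @MVT _ F (fun c => 'D_e f (p + c *: e)) 0 h h0.
  + move=> x; rewrite in_itv/= => /andP[a b]; apply: dF; rewrite nh gtr0_norm//; lra.
  + apply: continuous_in_subspaceT => x; rewrite inE/= in_itv/= => /andP[a b].
    by apply: cF; rewrite nh ger0_norm//; lra.
  rewrite in_itv/= => /andP[a b] e1; exists c; first by rewrite nh gtr0_norm//; lra.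
  by rewrite -/(F h) -F0 e1 subr0 mulrC.
- by exists 0; rewrite ?normr0// h0 scale0r addr0 subrr mul0r.
Qed.

Lemma rV_norm_le (x : rv) (M : R) : 0 <= M -> (forall i, `|x ord0 i| <= M) -> `|x| <= M.
Proof.
move=> M0 H; rewrite [leLHS]/Num.norm/= mx_normrE; apply: bigmax_le => // -[i j] _ /=.
by rewrite (ord1 i).
Qed.

(** Pass from x to y by changing one coordinate at a time and apply the mean value theorem to each
    move; in the max norm no intermediate point is farther from x than y is. *)
Lemma increment_partials f (x y : rv) :
  (forall z e, `|z - x| <= `|y - x| -> derivable f z e) ->
  exists xi : 'I_d -> rv, (forall j, `|xi j - x| <= `|y - x|) /\
    f y - f x = \sum_j (y ord0 j - x ord0 j) * 'D_(basis_vec j) f (xi j).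
Proof.
move=> df.
pose p (k : nat) : rv := \row_i (if (i < k)%N then y ord0 i else x ord0 i).
have p0 : p 0 = x by apply/rowP => i; rewrite mxE.
have pd : p d = y by apply/rowP => i; rewrite mxE ltn_ord.
have pS (j : 'I_d) : p j.+1 = p j + (y ord0 j - x ord0 j) *: basis_vec j.
  apply/rowP => i; rewrite !mxE ltnS leq_eqVlt; have [->|ij] := eqVneq i j.
    by rewrite eqxx ltnn mulr1 addrCA addrN addr0.
  by rewrite -[(i : nat) == j]/(i == j) (negbTE ij) mulr0 addr0.
have near (j : 'I_d) c : `|c| <= `|y ord0 j - x ord0 j| ->
    `|p j + c *: basis_vec j - x| <= `|y - x|.
  move=> cj; apply: rV_norm_le => // i; rewrite !mxE.
  have yxi := le_coord_norm (y - x) i; rewrite !mxE in yxi.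
  have [->|ij] := eqVneq i j.
    rewrite ltnn mulr1 addrAC subrr add0r.
    by apply: le_trans cj _; have := le_coord_norm (y - x) j; rewrite !mxE.
  by rewrite mulr0 addr0; case: ifP => _ //; rewrite subrr normr0.
have H (j : 'I_d) : exists z : rv, `|z - x| <= `|y - x| /\
    f (p j.+1) - f (p j) = (y ord0 j - x ord0 j) * 'D_(basis_vec j) f z.
  have [c cj ec] := mvt_direction f (p j) (basis_vec j) (y ord0 j - x ord0 j)
    (fun c cj => df _ _ (near j c cj)).
  by exists (p j + c *: basis_vec j); split; [exact: near|rewrite pS].
have [xi Hxi] := choice H; exists xi; split; first by move=> j; have [] := Hxi j.
have -> : f y - f x = \sum_(0 <= k < d) (f (p k.+1) - f (p k)).
  by rewrite (telescope_sumr (fun k => f (p k)))// p0 pd.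
by rewrite big_mkord; apply: eq_bigr => j _; have [_] := Hxi j.
Qed.

Lemma is_derive_quotient (h : R -> R) (t l : R) : is_derive t (1 : R) h l ->
  u^-1 * (h (u + t) - h t) @[u --> 0^'] --> l.
Proof.
move=> [dv <-].
have -> : (fun u => u^-1 * (h (u + t) - h t)) =
    (fun u => u^-1 *: ((h \o shift t) (u *: (1 : R)) - h t)).
  by apply/funext => u /=; rewrite [u *: 1]mulr1.
exact: dv.
Qed.

(** [Ck_on] speaks of directional derivatives, so the chain rule is recovered from continuous
    partials: [increment_partials] expresses the difference quotient, and its intermediate points
    converge to g t. *)
Lemma chain_partial f (V : set rv) (g : R -> rv) (dg : 'I_d -> R) (t : R) :
  open V -> V (g t) ->
  (forall z e, V z -> derivable f z e) ->
  (forall z j, V z -> {for z, continuous ('D_(basis_vec j) f)}) ->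
  (forall j, is_derive t (1 : R) (fun s => g s ord0 j) (dg j)) ->
  is_derive t (1 : R) (fun s => f (g s)) (\sum_j dg j * 'D_(basis_vec j) f (g t)).
Proof.
move=> oV Vt df cDf gd.
have /nbhs_ballP[r /= r0 Hr] := open_nbhs_nbhs (conj oV Vt).
have cg : g s @[s --> t] --> g t.
  apply: cvg_matrix => i j; rewrite (ord1 i).
  have : derivable (fun s => g s ord0 j) t 1 by exact: ex_derive.
  by move=> /derivable1_diffP/differentiable_continuous.
have Vball z : `|z - g t| < r -> V z.
  by move=> zr; apply: Hr; rewrite -ball_normE /= distrC.
have H s : exists xi : 'I_d -> rv, (forall j, `|xi j - g t| <= `|g s - g t|) /\
    (`|g s - g t| < r -> f (g s) - f (g t) =
      \sum_j (g s ord0 j - g t ord0 j) * 'D_(basis_vec j) f (xi j)).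
  have [sr|sr] := ltP (`|g s - g t|) r; last first.
    by exists (fun=> g t); split => // j; rewrite subrr normr0.
  have [xi [h1 h2]] := increment_partials f (g t) (g s)
    (fun z e zs => df z e (Vball z (le_lt_trans zs sr))).
  by exists xi.
have [xi Hxi] := choice H.
have cxi j : xi s j @[s --> t] --> g t.
  apply/cvgrPdist_lt => e e0; have /cvgrPdist_lt /(_ _ e0) := cg.
  apply: filterS => s; rewrite distrC => se; rewrite distrC.
  by apply: le_lt_trans se; have [+ _] := Hxi s; exact.
have cD j : 'D_(basis_vec j) f (xi s j) @[s --> t] --> 'D_(basis_vec j) f (g t).
  exact: (cvg_comp _ _ (cxi j) (cDf _ j Vt)).
have shift0 : (fun h : R => h + t) h @[h --> 0^'] --> t.
  have : (fun h : R => h + t) h @[h --> (0 : R)] --> (0 : R) + t.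
    by apply: cvgD; [exact: cvg_id|exact: cvg_cst].
  by rewrite add0r; exact: cvg_within_filter.
have lim : h^-1 *: (f (g (h + t)) - f (g t)) @[h --> 0^'] --> \sum_j dg j * 'D_(basis_vec j) f (g t).
  have c1 : \sum_j (h^-1 * (g (h + t) ord0 j - g t ord0 j)) * 'D_(basis_vec j) f (xi (h + t) j)
      @[h --> 0^'] --> \sum_j dg j * 'D_(basis_vec j) f (g t).
    apply: cvg_sumR => j; apply: cvgM.
      exact: (is_derive_quotient (fun s => g s ord0 j)).
    exact: (cvg_comp _ _ shift0 (cD j)).
  apply: cvg_trans c1; apply: near_eq_cvg.
  have := cvg_comp _ _ shift0 cg => /cvgrPdist_lt /(_ _ r0).
  apply: filterS => h /=; rewrite distrC => hr.
  have [_ /(_ hr) ->] := Hxi (h + t).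
  by rewrite [RHS]mulr_sumr; apply: eq_bigr => j _; rewrite mulrA.
have E : (fun h : R => h^-1 *: (((fun s => f (g s)) \o shift t) (h *: (1 : R)) - f (g t))) =
    (fun h => h^-1 *: (f (g (h + t)) - f (g t))).
  by apply/funext => h /=; rewrite [h *: 1]mulr1.
apply: DeriveDef; first by rewrite /derivable E; apply/cvg_ex; exists (\sum_j dg j * 'D_(basis_vec j) f (g t)).
by rewrite /derive E; exact: cvg_lim lim.
Qed.

End chain_rule.

Section dilation_curve.
Context {R : realType} {d : nat}.
Local Notation rv := 'rV[R]_d.
Implicit Types (f : rv -> R) (E : 'M[R]_d) (w : rv).

Lemma is_derive_near_eq (f g : R -> R) (t l : R) : (\forall s \near t, f s = g s) ->
  is_derive t (1 : R) f l -> is_derive t (1 : R) g l.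
Proof. by move=> fg; apply: near_eq_is_derive => //; rewrite oner_neq0. Qed.

Lemma near_lt_pos (t tau : R) : 0 < t < tau -> \forall s \near t, 0 < s < tau.
Proof.
move=> /andP[t0 tt].
have h1 : \forall s \near t, 0 < s by exact: lt_nbhsr.
have h2 : \forall s \near t, s < tau by exact: lt_nbhsl.
by apply: filterS2 h1 h2 => s -> ->.
Qed.

Definition curve E w (s : R) : rv := act (tpow s E) w.
(** From d/ds s^E = E s^E / s; [curve_acc] is its derivative by the product rule. *)
Definition curve_vel E w (s : R) (j : 'I_d) : R := act E (curve E w s) ord0 j / s.

Lemma is_derive_curve E w (t : R) j : 0 < t ->
  is_derive t (1 : R) (fun s => curve E w s ord0 j) (curve_vel E w t j).
Proof.
move=> t0.
have -> : (fun s => curve E w s ord0 j) = fun s => \sum_k tpow s E j k * w ord0 k.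
  by apply/funext => s; rewrite /curve actE.
have -> : curve_vel E w t j = \sum_k (w ord0 k *: ((E *m tpow t E) j k / t)).
  rewrite /curve_vel /curve -act_mul actE mulr_suml; apply: eq_bigr => k _.
  by rewrite /GRing.scale/=; ring.
apply: (is_derive_sum_fin (fun k s => tpow s E j k * w ord0 k)) => k.
have -> : (fun s => tpow s E j k * w ord0 k) = w ord0 k *: (fun s => tpow s E j k).
  by apply/funext => s; rewrite mulrC.
exact: (is_deriveZ (w ord0 k) (is_derive_tpow t E j k t0)).
Qed.

Definition curve_acc E w (s : R) (j : 'I_d) : R :=
  (\sum_k E j k * curve_vel E w s k) / s - act E (curve E w s) ord0 j / s ^+ 2.

Lemma is_derive_curve_vel E w (t : R) j : 0 < t ->
  is_derive t (1 : R) (fun s => curve_vel E w s j) (curve_acc E w t j).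
Proof.
move=> t0; have tn0 := lt0r_neq0 t0.
have d1 : is_derive t (1 : R) (fun s => act E (curve E w s) ord0 j) (\sum_k E j k * curve_vel E w t k).
  have -> : (fun s => act E (curve E w s) ord0 j) = fun s => \sum_k E j k * curve E w s ord0 k.
    by apply/funext => s; rewrite actE.
  apply: (is_derive_sum_fin (fun k s => E j k * curve E w s ord0 k)) => k.
  exact: (is_deriveZ (E j k) (is_derive_curve E w t k t0)).
have d2 : is_derive t (1 : R) (fun s : R => s^-1) (- (t ^+ 2)^-1).
  have := is_deriveV tn0 (is_derive_id t 1).
  by rewrite /GRing.scale/= mulr1.
have := is_deriveM d1 d2; congr (is_derive t 1 _ _).
by rewrite /curve_acc /GRing.scale/=; field.
Qed.

Lemma continuous_curve E w (t : R) : 0 < t -> {for t, continuous (curve E w)}.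
Proof.
move=> t0; apply: cvg_matrix => i j; rewrite (ord1 i).
have : derivable (fun s => curve E w s ord0 j) t 1.
  by apply: ex_derive; exact: is_derive_curve.
by move=> /derivable1_diffP/differentiable_continuous.
Qed.

Lemma continuous_curve_vel E w (t : R) j : 0 < t ->
  {for t, continuous (fun s => curve_vel E w s j)}.
Proof.
move=> t0; have : derivable (fun s => curve_vel E w s j) t 1.
  by apply: ex_derive; exact: is_derive_curve_vel.
by move=> /derivable1_diffP/differentiable_continuous.
Qed.

Lemma continuous_curve_acc E w (t : R) j : 0 < t ->
  {for t, continuous (fun s => curve_acc E w s j)}.
Proof.
move=> t0; have tn0 := lt0r_neq0 t0.
have -> : (fun s => curve_acc E w s j) = fun s =>
    (\sum_k E j k * curve_vel E w s k) * s^-1 - curve_vel E w s j * s^-1.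
  apply/funext => s; rewrite /curve_acc /curve_vel; congr (_ - _).
  by rewrite -mulrA -invfM -expr2.
have cV : s^-1 @[s --> t] --> t^-1 by apply: inv_continuous.
apply: cvgB; apply: cvgM => //; last exact: continuous_curve_vel.
by apply: cvg_sumR => k; apply: cvgM; [exact: cvg_cst|exact: continuous_curve_vel].
Qed.

Definition C1_on (V : set rv) f := [/\ open V, forall z e, V z -> derivable f z e &
  forall z j, V z -> {for z, continuous ('D_(basis_vec j) f)}].

Definition along E w f (s : R) : R := f (curve E w s).
(** Closed forms for the first two derivatives along a curve: their continuity can be read off term
    by term, which iterated [derive1] does not allow. *)
Definition along1 E w f (s : R) : R := \sum_j curve_vel E w s j * 'D_(basis_vec j) f (curve E w s).
Definition along2 E w f (s : R) : R :=
  \sum_j (curve_vel E w s j * along1 E w ('D_(basis_vec j) f) s +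
          curve_acc E w s j * 'D_(basis_vec j) f (curve E w s)).

Lemma is_derive_along E w f (V : set rv) (t : R) : C1_on V f -> 0 < t -> V (curve E w t) ->
  is_derive t (1 : R) (along E w f) (along1 E w f t).
Proof.
move=> [oV df cf] t0 Vt; apply: (chain_partial f V (curve E w)) => // j.
exact: is_derive_curve.
Qed.

Lemma continuous_along1 E w f (V : set rv) (t : R) : C1_on V f -> 0 < t -> V (curve E w t) ->
  {for t, continuous (along1 E w f)}.
Proof.
move=> [oV df cf] t0 Vt; apply: cvg_sumR => j; apply: cvgM; first exact: continuous_curve_vel.
exact: (cvg_comp _ _ (continuous_curve E w t t0) (cf _ j Vt)).
Qed.

Lemma is_derive_along1 E w f (V : set rv) (t : R) : C1_on V f ->
  (forall j, C1_on V ('D_(basis_vec j) f)) -> 0 < t -> V (curve E w t) ->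
  is_derive t (1 : R) (along1 E w f) (along2 E w f t).
Proof.
move=> Cf CDf t0 Vt.
apply: (is_derive_sum_fin (fun j s => curve_vel E w s j * 'D_(basis_vec j) f (curve E w s))) => j.
have := is_deriveM (is_derive_curve_vel E w t j t0) (is_derive_along E w _ V t (CDf j) t0 Vt).
congr (is_derive t 1 _ _); rewrite /GRing.scale/=; congr (_ + _); rewrite mulrC//.
Qed.

Lemma continuous_along2 E w f (V : set rv) (t : R) : C1_on V f ->
  (forall j, C1_on V ('D_(basis_vec j) f)) -> 0 < t -> V (curve E w t) ->
  {for t, continuous (along2 E w f)}.
Proof.
move=> [oV df cf] CDf t0 Vt; apply: cvg_sumR => j; apply: cvgD; apply: cvgM.
- exact: continuous_curve_vel.
- exact: continuous_along1 (CDf j) t0 Vt.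
- exact: continuous_curve_acc.
- exact: (cvg_comp _ _ (continuous_curve E w t t0) (cf _ j Vt)).
Qed.

Lemma Ck_on_C1 (V : set rv) f : open V -> Ck_on V 1 f -> C1_on V f.
Proof.
move=> oV CV; split => // [z e Vz|z j Vz].
  by have [_ /(_ isT)] := CV [::] z Vz; exact.
by have [+ _] := CV [:: basis_vec j] z Vz; exact.
Qed.

Lemma Ck_on_le (V : set rv) f l m : (m <= l)%N -> Ck_on V l f -> Ck_on V m f.
Proof.
move=> ml CV vs x Vx; have [h1 h2] := CV vs x Vx; split => h.
  by apply: h1; exact: leq_trans ml.
by apply: h2; exact: leq_trans ml.
Qed.

Lemma Ck_on_D1 (V : set rv) f j : open V -> Ck_on V 2 f -> C1_on V ('D_(basis_vec j) f).
Proof.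
move=> oV CV; split => // [z e Vz|z i Vz].
  by have [_ /(_ isT)] := CV [:: basis_vec j] z Vz; exact.
by have [+ _] := CV [:: basis_vec i; basis_vec j] z Vz; exact.
Qed.

Lemma contracting_small E (K : set rv) (V : set rv) : contracting E -> compact K ->
  open V -> V 0 -> exists2 tau : R, 0 < tau & forall t w, 0 < t < tau -> K w -> V (curve E w t).
Proof.
move=> ctr cK oV V0; have [r r0 Hr] := open_ball0 _ oV V0.
have [M M0 HM] := compact_bound _ cK.
have D0 : 0 < d%:R * M + 1 by rewrite ltr_wpDl// mulr_ge0// ltW.
have e' : 0 < r / (d%:R * M + 1) by rewrite divr_gt0.
have /cvgrPdist_lt /(_ _ e') := ctr.
rewrite near_withinE => -[tau /= tau0 H]; exists tau => // t w /andP[t0 tt] Kw.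
have := H t; rewrite /= sub0r normrN gtr0_norm// => /(_ tt t0).
rewrite sub0r normrN => /ltW tE; apply: Hr.
apply: le_trans (act_norm _ _) _.
apply: le_trans (_ : d%:R * (r / (d%:R * M + 1)) * M <= _).
  by apply: ler_pM; rewrite ?mulr_ge0 ?HM// ler_wpM2l.
rewrite [leLHS](_ : _ = r * (d%:R * M) / (d%:R * M + 1)); last by ring.
by rewrite ler_pdivrMr// ler_wpM2l ?(ltW r0)// lerDl.
Qed.

Lemma derive1_along E w f (V : set rv) (t : R) : C1_on V f -> 0 < t -> V (curve E w t) ->
  derive1 (along E w f) t = along1 E w f t.
Proof.
by move=> Cf t0 Vt; have h := is_derive_along E w f V t Cf t0 Vt; rewrite derive1E derive_val.
Qed.

Lemma strong_subhom1 E f : strongly_subhomogeneous E 1 f ->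
  forall eps : R, 0 < eps -> forall K : set rv, compact K ->
  exists2 tau : R, 0 < tau & forall w t, K w -> 0 < t < tau ->
    [/\ is_derive t (1 : R) (along E w f) (along1 E w f t),
        {for t, continuous (along1 E w f)},
        `|along E w f t| <= eps * t & `|along1 E w f t| <= eps].
Proof.
move=> [ctr [V [oV V0 CV]] H] eps eps0 K cK.
have [t1 t10 H1] := contracting_small E K V ctr cK oV V0.
have [t2 [t20 H2]] := H _ eps0 _ cK.
have C1 := Ck_on_C1 _ _ oV CV.
exists (Num.min t1 t2); first by rewrite lt_min t10.
move=> w t Kw /andP[t0]; rewrite lt_min => /andP[tt1 tt2].
have Vt : V (curve E w t) by apply: H1 => //; rewrite t0.
split.
- exact: is_derive_along Vt.
- exact: continuous_along1 Vt.
- by have := H2 t w 0%N t0 tt2 Kw isT; rewrite expr0 mul1r.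
- have := H2 t w 1%N t0 tt2 Kw isT; rewrite expr1 derive1n1 -/(along E w f).
  rewrite (derive1_along _ _ _ _ _ C1 t0 Vt) normrM gtr0_norm// mulrC.
  by rewrite ler_pM2r.
Qed.

(** At order k the hypothesis bounds t^k times the k-th derivative by eps t; cancelling powers of t
    bounds the first derivative by eps and the second by eps/t. As the second is an iterated
    [derive1], the first must be identified with [along1] on a neighbourhood of t. *)
Lemma strong_subhom2 E f : strongly_subhomogeneous E 2 f ->
  forall eps : R, 0 < eps -> forall K : set rv, compact K ->
  exists2 tau : R, 0 < tau & forall w t, K w -> 0 < t < tau ->
    [/\ is_derive t (1 : R) (along E w f) (along1 E w f t),
        is_derive t (1 : R) (along1 E w f) (along2 E w f t),
        {for t, continuous (along1 E w f)},
        {for t, continuous (along2 E w f)} &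
        [/\ `|along E w f t| <= eps * t, `|along1 E w f t| <= eps &
            `|t * along2 E w f t| <= eps]].
Proof.
move=> [ctr [V [oV V0 CV]] H] eps eps0 K cK.
have [t1 t10 H1] := contracting_small E K V ctr cK oV V0.
have [t2 [t20 H2]] := H _ eps0 _ cK.
have C1 := Ck_on_C1 _ _ oV (Ck_on_le _ _ 2 1 isT CV).
have C2 j := Ck_on_D1 _ _ j oV CV.
exists (Num.min t1 t2); first by rewrite lt_min t10.
move=> w t Kw /andP[t0]; rewrite lt_min => /andP[tt1 tt2].
have Vt : V (curve E w t) by apply: H1 => //; rewrite t0.
split.
- exact: is_derive_along Vt.
- exact: is_derive_along1 Vt.
- exact: continuous_along1 Vt.
- exact: continuous_along2 Vt.
- split.
  + by have := H2 t w 0%N t0 tt2 Kw isT; rewrite expr0 mul1r.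
  + have := H2 t w 1%N t0 tt2 Kw isT; rewrite expr1 derive1n1 -/(along E w f).
    rewrite (derive1_along _ _ _ _ _ C1 t0 Vt) normrM gtr0_norm// mulrC.
    by rewrite ler_pM2r.
  + have := H2 t w 2%N t0 tt2 Kw isT; rewrite derive1nS derive1n1 -/(along E w f).
    have e2 : derive1 (derive1 (along E w f)) t = along2 E w f t.
      have dd : is_derive t (1 : R) (derive1 (along E w f)) (along2 E w f t).
        apply: is_derive_near_eq (is_derive_along1 E w f V t C1 C2 t0 Vt).
        have : \forall s \near t, 0 < s < t1 by apply: near_lt_pos; rewrite t0.
        apply: filterS => s st; rewrite (derive1_along _ _ _ V)//.
          by case/andP: st.
        exact: H1.
      by rewrite derive1E derive_val.
    rewrite e2 expr2 -mulrA normrM gtr0_norm// mulrC.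
    by rewrite ler_pM2r.
Qed.

End dilation_curve.

(** * Oscillatory integrals *)

Section oscillatory_integral.
Context {R : realType}.
Local Notation leb := (@lebesgue_measure R).
Variables (a b : R).
Hypotheses (a0 : 0 < a) (ab : a < b).

Lemma continuous_itv_integrable (f : R -> R) :
  (forall x, a <= x <= b -> {for x, continuous f}) ->
  leb.-integrable `[a, b] (EFin \o f).
Proof.
move=> cf; apply: continuous_compact_integrable; first exact: segment_compact.
by apply: continuous_in_subspaceT => x; rewrite inE/= in_itv/=; exact: cf.
Qed.

Lemma Rintegral_derive (f F : R -> R) :
  (forall x, a <= x <= b -> {for x, continuous f}) ->
  (forall x, a <= x <= b -> is_derive x (1 : R) F (f x)) ->
  \int[leb]_(x in `[a, b]) f x = F b - F a.
Proof. by move=> cf dF; rewrite /Rintegral (FTC2_is_derive _ _ _ _ ab cf dF). Qed.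

Lemma is_derive_continuous (f : R -> R) (x l : R) : is_derive x (1 : R) f l ->
  {for x, continuous f}.
Proof.
move=> df; have : derivable f x 1 by exact: ex_derive.
by move=> /derivable1_diffP/differentiable_continuous.
Qed.

Lemma powRB1 (p x : R) : 0 < x -> x `^ (p - 1) = x `^ p / x.
Proof.
by move=> x0; rewrite powRB ?powRr1 ?(ltW x0)//; apply/implyP => _; exact: lt0r_neq0.
Qed.

Lemma is_derive_powR (p x : R) : 0 < x ->
  is_derive x (1 : R) (fun s => s `^ p) (p * x `^ (p - 1)).
Proof.
move=> x0.
have h1 : is_derive x (1 : R) (fun s => expR (p * ln s)) (expR (p * ln x) * (p / x)).
  have h2 : is_derive x (1 : R) (fun s => p * ln s) (p / x) := is_deriveZ p (is_derive1_ln x0).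
  exact: (@is_derive1_comp R expR (fun s => p * ln s) x _ _ (is_derive_expR _) h2).
have e1 : \forall s \near x, expR (p * ln s) = s `^ p.
  have : \forall s \near x, 0 < s by exact: lt_nbhsr.
  by apply: filterS => s s0; rewrite /powR gt_eqF.
have := is_derive_near_eq _ _ _ _ e1 h1; congr (is_derive x 1 _ _).
rewrite powRB1//.
by rewrite /powR gt_eqF// mulrCA mulrA.
Qed.

(** The antiderivative -s^(p-1)/(1-p) makes the contribution of b non-positive, so the bound is
    uniform in b. *)
Lemma Rintegral_powR_le (p : R) : p < 1 ->
  \int[leb]_(s in `[a, b]) s `^ (p - 2) <= a `^ (p - 1) / (1 - p).
Proof.
move=> p1; have p1' : 1 - p != 0 by rewrite gt_eqF// subr_gt0.
have pos x : a <= x <= b -> 0 < x by move=> /andP[ax _]; exact: lt_le_trans ax.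
have cf x : a <= x <= b -> {for x, continuous (fun s => s `^ (p - 2))}.
  by move=> /pos x0; exact: (is_derive_continuous _ _ _ (is_derive_powR (p - 2) _ x0)).
have dF x : a <= x <= b ->
    is_derive x (1 : R) (fun s => - (1 - p)^-1 * s `^ (p - 1)) (x `^ (p - 2)).
  move=> /pos x0; have := is_deriveZ (- (1 - p)^-1) (is_derive_powR (p - 1) _ x0).
  congr (is_derive x 1 _ _); rewrite /GRing.scale/= (_ : p - 1 - 1 = p - 2); last by ring.
  by rewrite mulrA mulNr -mulrN opprB mulVf// mul1r.
rewrite (Rintegral_derive _ _ cf dF).
have : 0 <= b `^ (p - 1) / (1 - p) by rewrite divr_ge0 ?powR_ge0// subr_ge0 ltW.
by rewrite !mulNr opprK !(mulrC (_^-1)); lra.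
Qed.

Variables (g g1 psi psi1 psi2 : R -> R) (C p : R).
Hypotheses (C0 : 0 <= C) (p1 : p < 1).
Hypothesis H : forall s, a <= s <= b ->
  [/\ is_derive s (1 : R) g (g1 s), {for s, continuous g1},
      is_derive s (1 : R) psi (psi1 s), is_derive s (1 : R) psi1 (psi2 s) &
      {for s, continuous psi2}].
Hypothesis bound : forall s, a <= s <= b ->
  [/\ 1 / 2 <= `|psi1 s|, `|psi2 s| <= C / s, `|g s| <= s `^ (p - 1) &
      `|g1 s| <= C * s `^ (p - 2)].

(* Integration by parts against the antiderivative g / psi1 * sin psi. *)
Lemma oscillatory_integral_le :
  `| \int[leb]_(s in `[a, b]) (g s * cos (psi s)) | <= (4 + 6 * C / (1 - p)) * a `^ (p - 1).
Proof.
(* F' = g cos psi + r. The two boundary values of F give the 4, and r gives 6 C / (1 - p). *)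
pose r s := (g1 s / psi1 s - g s * psi2 s / psi1 s ^+ 2) * sin (psi s).
pose F s := g s / psi1 s * sin (psi s).
have pos x : a <= x <= b -> 0 < x by move=> /andP[ax _]; exact: lt_le_trans ax.
have n0 s : a <= s <= b -> psi1 s != 0.
  by move=> /bound[h _ _ _]; rewrite -normr_gt0; lra.
have cg s : a <= s <= b -> {for s, continuous g} by move=> /H[/is_derive_continuous].
have cpsi s : a <= s <= b -> {for s, continuous psi} by move=> /H[_ _ /is_derive_continuous].
have cpsi1 s : a <= s <= b -> {for s, continuous psi1} by move=> /H[_ _ _ /is_derive_continuous].
have cV s : a <= s <= b -> (psi1 x)^-1 @[x --> s] --> (psi1 s)^-1.
  by move=> sab; apply: cvgV; [exact: n0|exact: cpsi1].
have csin s : a <= s <= b -> {for s, continuous (fun x => sin (psi x))}.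
  by move=> sab; apply: (@continuous_comp _ _ _ psi sin s (cpsi _ sab)); exact: continuous_sin.
have ccos s : a <= s <= b -> {for s, continuous (fun x => cos (psi x))}.
  by move=> sab; apply: (@continuous_comp _ _ _ psi cos s (cpsi _ sab)); exact: continuous_cos.
have cr s : a <= s <= b -> {for s, continuous r}.
  move=> sab; have [_ cg1 _ _ cpsi2] := H _ sab.
  apply: cvgM; last exact: csin.
  apply: cvgB; first by apply: cvgM => //; exact: cV.
  have -> : (fun x => g x * psi2 x / psi1 x ^+ 2) =
      (fun x => g x * psi2 x * ((psi1 x)^-1 * (psi1 x)^-1)).
    by apply/funext => x; rewrite expr2 invfM.
  have e : g s * psi2 s / psi1 s ^+ 2 = g s * psi2 s * ((psi1 s)^-1 * (psi1 s)^-1).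
    by rewrite expr2 invfM.
  rewrite e; apply: cvgM; apply: cvgM => //; [exact: cg|exact: cV|exact: cV].
have cgc s : a <= s <= b -> {for s, continuous (fun x => g x * cos (psi x))}.
  by move=> sab; apply: cvgM; [exact: cg|exact: ccos].
have dF s : a <= s <= b -> is_derive s (1 : R) F (g s * cos (psi s) + r s).
  move=> sab; have [dg _ dpsi dpsi1 _] := H _ sab.
  have d1 := is_deriveV (n0 _ sab) dpsi1.
  have d2 := is_derive1_comp (is_derive_sin (psi s)) dpsi.
  have := is_deriveM (is_deriveM dg d1) d2; congr (is_derive s 1 _ _).
  rewrite /r /GRing.scale/= -[(g * _) s]/(g s * (psi1 s)^-1); field; exact: n0.
have I1 := continuous_itv_integrable _ cgc.
have I2 := continuous_itv_integrable _ cr.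
have : \int[leb]_(s in `[a, b]) (g s * cos (psi s) + r s) = F b - F a.
  apply: Rintegral_derive dF => s sab; apply: cvgD; [exact: cgc|exact: cr].
rewrite RintegralD// => /eqP; rewrite -subr_eq => /eqP/esym; rewrite opprK => e.
have {}e : \int[leb]_(s in `[a, b]) (g s * cos (psi s)) = F b - F a - \int[leb]_(s in `[a, b]) r s.
  by move: e; lra.
have F_le s : a <= s <= b -> `|F s| <= 2 * a `^ (p - 1).
  move=> sab; have [h1 _ h3 _] := bound _ sab.
  have h4 : s `^ (p - 1) <= a `^ (p - 1).
    have e1 : p - 1 = - (1 - p) by ring.
    rewrite e1 !powRN lef_pV2 ?posrE ?powR_gt0//; last exact: pos.
    by rewrite ge0_ler_powR ?nnegrE ?subr_ge0 ?(ltW p1) ?(ltW a0) ?(ltW (pos _ sab))//; case/andP: sab.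
  have h5 : `|psi1 s|^-1 <= 2.
    by rewrite -[leRHS]invrK lef_pV2 ?posrE ?invr_gt0// ?(lt_le_trans _ h1) //; lra.
  rewrite /F !normrM normrV ?unitfE ?n0//.
  have h6 : `|sin (psi s)| <= 1 by rewrite ler_norml sin_geN1 sin_le1.
  apply: le_trans (_ : a `^ (p - 1) * 2 * 1 <= _); last by rewrite mulr1 mulrC.
  apply: ler_pM => //.
  by apply: ler_pM => //; rewrite ?invr_ge0//; exact: le_trans h4.
(* As 1/|psi1| <= 2, the two terms of r are at most 2 C s^(p-2) and 4 C s^(p-2). *)
have r_le s : a <= s <= b -> `|r s| <= 6 * C * s `^ (p - 2).
  move=> sab; have [h1 h2 h3 h4] := bound _ sab.
  have s0 := pos _ sab.
  have h5 : `|psi1 s|^-1 <= 2.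
    by rewrite -[leRHS]invrK lef_pV2 ?posrE ?invr_gt0// ?(lt_le_trans _ h1) //; lra.
  have h6 : `|sin (psi s)| <= 1 by rewrite ler_norml sin_geN1 sin_le1.
  have e2 : s `^ (p - 1) / s = s `^ (p - 2).
    rewrite (_ : p - 2 = p - 1 - 1); last by ring.
    by rewrite [RHS]powRB1.
  have q0 : 0 <= s `^ (p - 2) by exact: powR_ge0.
  have h7 : `|g1 s / psi1 s| <= C * s `^ (p - 2) * 2.
    by rewrite normrM normrV ?unitfE ?n0//; apply: ler_pM => //; rewrite invr_ge0.
  have h8 : `|g s * psi2 s / psi1 s ^+ 2| <= (C * s `^ (p - 2)) * (2 * 2).
    rewrite normrM normrV ?unitfE ?expf_neq0 ?n0// normrX expr2 invfM normrM.
    apply: ler_pM => //; rewrite ?mulr_ge0 ?invr_ge0//; last first.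
      by apply: ler_pM => //; rewrite invr_ge0.
    rewrite -e2 mulrCA; apply: ler_pM => //.
  rewrite /r normrM; apply: le_trans (_ : (C * s `^ (p - 2) * 2 + (C * s `^ (p - 2)) * (2 * 2)) * 1 <= _).
    apply: ler_pM => //; apply: le_trans (ler_normB _ _) _; exact: lerD.
  lra.
have cp x : a <= x <= b -> {for x, continuous (fun s => s `^ (p - 2))}.
  by move=> /pos x0; exact: (is_derive_continuous _ _ _ (is_derive_powR (p - 2) _ x0)).
have I3 := continuous_itv_integrable _ cp.
have I4 : leb.-integrable `[a, b] (EFin \o (fun s => 6 * C * s `^ (p - 2))).
  by apply: continuous_itv_integrable => x xab; apply: cvgM; [exact: cvg_cst|exact: cp].
have int_r : `|\int[leb]_(s in `[a, b]) r s| <= 6 * C * (a `^ (p - 1) / (1 - p)).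
  apply: le_trans (le_normr_Rintegral _ I2) _ => //.
  apply: le_trans (_ : \int[leb]_(s in `[a, b]) (6 * C * s `^ (p - 2)) <= _).
    by apply: le_Rintegral => //; exact: integrable_norm.
  rewrite RintegralZl// ler_wpM2l ?mulr_ge0//; exact: Rintegral_powR_le.
rewrite e; apply: le_trans (ler_normB _ _) _.
have Fa := F_le a; have Fb := F_le b; rewrite !lexx (ltW ab) /= in Fa Fb.
have := ler_normB (F b) (F a); have := Fa isT; have := Fb isT.
move: int_r; rewrite (_ : 6 * C * (a `^ (p - 1) / (1 - p)) = 6 * C / (1 - p) * a `^ (p - 1)); last by ring.
set Y := a `^ (p - 1); set q := 6 * C / (1 - p).
have -> : (4 + q) * Y = 4 * Y + q * Y by ring.
by move: (q * Y) => X; lra.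
Qed.

End oscillatory_integral.

(** * Integration along dilation curves *)

Section polar.
Context {R : realType} {d : nat}.
Local Notation rv := 'rV[R]_d.
Local Notation leb := (@lebesgue_measure R).
Local Notation mR := (measurableTypeR R).
Variables (N : rv -> R) (E : 'M[R]_d).
Hypotheses (mN : measurable_fun setT N) (hN : Exp_set N E).

(* For N z > 0 the weights s^-1 over N z / 2 <= s <= N z have total mass ln 2,
   so averaging over dilated shells replaces polar coordinates. *)
Definition shell_slice (G : rv -> R) (s : R) (z : rv) : R :=
  if (0 < s) && (s <= N z) && (N z <= 2 * s) then G z * s `^ (-1) else 0.

(** [shell_slice] after z = s^E w: since N(s^E w) = s N(w), the moving shell becomes the fixed one 1
    <= N w <= 2, and the Jacobian s^(tr E) merges with the weight s^-1. *)
Definition dilated_slice (G : rv -> R) (s : R) (w : rv) : R :=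
  if (0 < s) && (1 <= N w) && (N w <= 2) then s `^ (\tr E - 1) * G (act (tpow s E) w) else 0.

Lemma integral_shell_slice (G : rv -> R) z : 0 < N z ->
  (\int[leb]_s (shell_slice G s z)%:E = (ln 2 * G z)%:E)%E.
Proof.
move=> Nz; have z2 : N z / 2 < N z by lra.
transitivity (\int[leb]_(s in `[(N z / 2)%R, N z]) (G z * s^-1)%:E)%E.
  rewrite [RHS]integral_mkcond; apply: eq_integral => s _; rewrite /shell_slice patchE.
  have e : ((0 < s) && (s <= N z) && (N z <= 2 * s)) = (s \in (`[N z / 2, N z]%classic : set R)).
    apply/idP/idP; rewrite inE/= in_itv/=.
      by move=> /andP[/andP[a b] c]; apply/andP; split => //; lra.
    by move=> /andP[a b]; apply/andP; split; last lra; apply/andP; split => //; lra.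
  rewrite e; case: ifPn => // sI.
  have s0 : 0 < s by move: sI; rewrite inE/= in_itv/= => /andP[]; lra.
  by rewrite powR_inv1// ltW.
have pos s : N z / 2 <= s <= N z -> 0 < s by move=> /andP[a _]; lra.
have cf s : N z / 2 <= s <= N z -> {for s, continuous (fun s : R => G z * s^-1)}.
  move=> /pos s0; apply: cvgM; first exact: cvg_cst.
  by apply: inv_continuous; rewrite gt_eqF.
have dF s : N z / 2 <= s <= N z -> is_derive s (1 : R) (fun s => G z * ln s) (G z * s^-1).
  by move=> /pos s0; exact: (is_deriveZ (G z) (is_derive1_ln s0)).
rewrite (FTC2_is_derive _ _ _ _ z2 cf dF) -mulrBr -ln_div ?posrE//; last by lra.
by rewrite invf_div mulrCA divff ?mulr1 ?gt_eqF// mulrC.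
Qed.

Variable G : rv -> R.
Hypothesis iG : lebd.-integrable setT (EFin \o G).

Let mG : measurable_fun setT G.
Proof. by have /integrableP[/measurable_EFinP + _] := iG. Qed.

Lemma measurable_shell_slice :
  measurable_fun setT (fun p : mR * rv => shell_slice G p.1 p.2).
Proof.
have m1 : measurable_fun setT (fun p : mR * rv => p.1 : R) by exact: measurable_fst.
have m2 : measurable_fun setT (fun p : mR * rv => N p.2).
  exact: (measurableT_comp mN measurable_snd).
apply: measurable_fun_ifT; last exact: measurable_cst.
  apply: measurable_and; last first.
    by apply: measurable_fun_ler => //; apply: measurable_funM => //; exact: measurable_cst.
  apply: measurable_and; first by apply: measurable_fun_ltr => //; exact: measurable_cst.
  exact: measurable_fun_ler.
apply: measurable_funM; first exact: (measurableT_comp mG measurable_snd).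
exact: (measurableT_comp (@measurable_powR R (-1)) m1).
Qed.

Lemma measurable_dilated_slice :
  measurable_fun setT (fun p : mR * rv => dilated_slice G p.1 p.2).
Proof.
have m1 : measurable_fun setT (fun p : mR * rv => p.1 : R) by exact: measurable_fst.
have m2 : measurable_fun setT (fun p : mR * rv => N p.2).
  exact: (measurableT_comp mN measurable_snd).
apply: measurable_fun_ifT; last exact: measurable_cst.
  apply: measurable_and; last first.
    by apply: measurable_fun_ler => //; exact: measurable_cst.
  apply: measurable_and; first by apply: measurable_fun_ltr => //; exact: measurable_cst.
  by apply: measurable_fun_ler => //; exact: measurable_cst.
apply: measurable_funM; first exact: (measurableT_comp (@measurable_powR R _) m1).
exact: (measurableT_comp mG (measurable_act_tpow E)).
Qed.

Lemma integral_dilated_slice s :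
  (\int[lebd]_w (dilated_slice G s w)%:E = \int[lebd]_z (shell_slice G s z)%:E)%E.
Proof.
have [s0|s0] := ltP 0 s; last first.
  apply: eq_integral => w _.
  by rewrite /dilated_slice /shell_slice ltNge s0.
have iF : lebd.-integrable setT (EFin \o shell_slice G s).
  apply: le_integrable (integrableZl measurableT (s `^ (-1)) (integrable_norm iG)) => //.
    apply/measurable_EFinP.
    exact: (measurableT_comp measurable_shell_slice (pair1_measurable s)).
  move=> z _ /=; rewrite lee_fin [leRHS]ger0_norm ?mulr_ge0 ?powR_ge0//.
  rewrite /shell_slice; case: ifP => _; last by rewrite normr0 mulr_ge0// powR_ge0.
  by rewrite normrM mulrC (ger0_norm (powR_ge0 _ _)).
have e w : ((dilated_slice G s w)%:E = (s `^ (\tr E))%:E * (shell_slice G s (act (tpow s E) w))%:E)%E.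
  rewrite -EFinM /dilated_slice /shell_slice hN// s0/=.
  have -> : (s <= s * N w) = (1 <= N w) by rewrite -{1}[s]mulr1 ler_pM2l.
  have -> : (s * N w <= 2 * s) = (N w <= 2) by rewrite (mulrC 2) ler_pM2l.
  case: ifP => _; last by rewrite mulr0.
  by rewrite powRD; [rewrite mulrCA mulrC|rewrite lt0r_neq0 ?implybT].
under eq_integral do rewrite e.
rewrite integralZl//; last exact: (integrable_tpow s E _ s0 iF).
have H (f : rv -> \bar R) := ge0_integral_tpow s E f s0.
rewrite (integral_scaling _ _ H _ iF).
rewrite muleA -EFinM -powRD; last by rewrite lt0r_neq0 ?implybT.
by rewrite subrr powRr0 mul1e.
Qed.

Hypothesis G_supp : forall z, G z != 0 -> 0 < N z.

(** Tonelli with s integrated first: the inner integral of the absolute value is ln 2 times |G|. *)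
Lemma integrable_shell_slice :
  (leb \x lebd)%E.-integrable setT (fun p : mR * rv => (shell_slice G p.1 p.2)%:E).
Proof.
have mF := measurable_shell_slice.
apply/integrable21ltyP; first exact/measurable_EFinP.
rewrite (eq_integral (fun z => (ln 2)%:E * `|(G z)%:E|)%E); last first.
  move=> z _ /=.
  have [G0|Gz] := eqVneq (G z) 0.
    rewrite G0 normr0 mule0; apply: integral0_eq => s _.
    by rewrite /shell_slice G0 mul0r; case: ifP => _; rewrite normr0.
  have := integral_shell_slice (fun z => `|G z|) z (G_supp _ Gz).
  rewrite -EFinM => <-; apply: eq_integral => s _.
  rewrite /shell_slice; case: ifP => _; last by rewrite normr0.
  by rewrite normrM (ger0_norm (powR_ge0 _ _)).
have ln2 : 0 <= ln 2 :> R by rewrite ln_ge0//; lra.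
have mA : measurable_fun setT (fun z => `|(G z)%:E|)%E.
  by apply: measurableT_comp => //; exact/measurable_EFinP.
rewrite (ge0_integralZl lebd measurableT mA (fun z _ => abse_ge0 _) (k := (ln 2)%:E)) ?lee_fin//.
by apply: lte_mul_pinfty; rewrite ?lee_fin//; have /integrableP[] := iG.
Qed.

End polar.

Section polar_bound.
Context {R : realType} {d : nat}.
Local Notation rv := 'rV[R]_d.
Local Notation leb := (@lebesgue_measure R).
Local Notation mR := (measurableTypeR R).
Variables (N : rv -> R) (E : 'M[R]_d).
Hypotheses (mN : measurable_fun setT N) (hN : Exp_set N E).
Variable G : rv -> R.
Hypothesis iG : lebd.-integrable setT (EFin \o G).
Hypothesis G_supp : forall z, G z != 0 -> 0 < N z.

Lemma integrable_dilated_slice :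
  (leb \x lebd)%E.-integrable setT (fun p : mR * rv => (dilated_slice N E G p.1 p.2)%:E).
Proof.
have mD := measurable_dilated_slice N E mN G iG.
have iA : lebd.-integrable setT (EFin \o (fun z => `|G z|)) := integrable_norm iG.
have A_supp z : `|G z| != 0 -> 0 < N z by rewrite normr_eq0; exact: G_supp.
apply/integrable12ltyP; first exact/measurable_EFinP.
have mA := measurable_shell_slice N mN _ iA.
have {}mA : measurable_fun setT (fun p : mR * rv => (shell_slice N (fun z => `|G z|) p.1 p.2)%:E).
  exact/measurable_EFinP.
have := (integrable12ltyP leb lebd mA).1 (integrable_shell_slice N mN _ iA A_supp).
apply: le_lt_trans.
rewrite le_eqVlt; apply/orP; left; apply/eqP; apply: eq_integral => s _ /=.
have := integral_dilated_slice N E mN hN _ iA s.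
rewrite (_ : \int[lebd]_w (dilated_slice N E (fun z => `|G z|) s w)%:E =
  \int[lebd]_w `|(dilated_slice N E G s w)%:E|)%E; last first.
  apply: eq_integral => w _; rewrite /dilated_slice /=; case: ifP => _; last by rewrite normr0.
  by rewrite normrM (ger0_norm (powR_ge0 _ _)).
move=> ->; apply: eq_integral => z _; congr EFin; rewrite ger0_norm// /shell_slice.
by case: ifP => // _; rewrite mulr_ge0// powR_ge0.
Qed.

Let shell : set rv := [set w | 1 <= N w <= 2].

(** By Fubini for both kinds of slice, ln 2 times the integral of G is the integral over the shell
    of the curve integrals. The shell takes the place of a surface measure on {N = 1}. *)
Lemma polar_bound (B : R) : 0 <= B -> measurable shell -> (lebd shell < +oo)%E ->
  (forall w, shell w -> (`|\int[leb]_s (dilated_slice N E G s w)%:E| <= B%:E)%E) ->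
  `|\int[lebd]_z G z| <= B * fine (lebd shell) / ln 2.
Proof.
move=> B0 mS S_fin H.
have ln2 : 0 < ln 2 :> R by rewrite ln_gt0//; lra.
rewrite ler_pdivlMr// mulrC -[ln 2]gtr0_norm// -normrM.
have e : ((ln 2 * \int[lebd]_z G z)%:E =
    \int[lebd]_w \int[leb]_s (dilated_slice N E G s w)%:E)%E.
  have F2 := Fubini integrable_dilated_slice.
  rewrite /= in F2; rewrite -F2.
  have F1 := Fubini (integrable_shell_slice N mN _ iG G_supp).
  under eq_integral do rewrite (integral_dilated_slice N E mN hN G iG).
  rewrite F1 EFinM /Rintegral fineK; last exact: integrable_fin_num.
  rewrite -integralZl//; apply: eq_integral => z _ /=; rewrite -EFinM.
  have [G0|Gz] := eqVneq (G z) 0; last by rewrite integral_shell_slice// G_supp.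
  rewrite G0 mulr0; apply/esym; apply: integral0_eq => s _.
  by rewrite /shell_slice G0 mul0r; case: ifP.
have mI : measurable_fun setT (fun w : rv => (\int[leb]_s (dilated_slice N E G s w)%:E)%E).
  exact: (measurable_fubini_G integrable_dilated_slice).
rewrite -lee_fin EFinM fineK; last by rewrite ge0_fin_numE.
rewrite -abse_EFin e; apply: le_trans (le_abse_integral _ _ _) _ => //.
apply: le_trans (_ : \int[lebd]_w (B%:E * (\1_shell w)%:E) <= _)%E.
  apply: ge0_le_integral => //.
  - exact: measurableT_comp.
  - by apply: measurable_funeM; apply/measurable_EFinP.
  - move=> w _; rewrite indicE; have [wS|wS] := boolP (w \in shell).
      by rewrite mule1; apply: H; rewrite inE in wS.
    rewrite mule0 integral0_eq ?abse0// => s _; rewrite /dilated_slice; case: ifP => //.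
    move=> /andP[/andP[_ a] b]; case/negP: wS; rewrite inE; exact/andP.
have mI1 : measurable_fun setT (fun w : rv => (\1_shell w)%:E : \bar R) by exact/measurable_EFinP.
have I0 (w : rv) : setT w -> (0 <= (\1_shell w)%:E :> \bar R)%E by rewrite lee_fin.
rewrite (ge0_integralZl lebd measurableT mI1 I0 (k := B%:E)) ?lee_fin//.
by rewrite integral_indic// setIT.
Qed.

End polar_bound.

(** * Tails beyond a level of the gauge *)

Section oscillatory_tail.
Context {R : realType} {d : nat}.
Local Notation rv := 'rV[R]_d.
Local Notation leb := (@lebesgue_measure R).
Variables (N : rv -> R) (E : 'M[R]_d).
Hypotheses (cN : continuous N) (N0 : forall x, 0 <= N x)
  (Neq0 : forall x, N x = 0 <-> x = 0) (cpt : compact [set x : rv | N x = 1])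
  (hN : Exp_set N E) (ctr : contracting E).

Let mN : measurable_fun setT N. Proof. exact: continuous_measurable_rV. Qed.

Lemma measurable_gauge_le c : measurable [set z : rv | N z <= c].
Proof.
have := mN measurableT _ (measurable_itv (`]-oo, c] : interval R)).
rewrite setTI; congr measurable; apply/seteqP; split => z /=; by rewrite in_itv.
Qed.

Lemma measurable_gauge_itv b c : measurable [set z : rv | b <= N z <= c].
Proof.
have := mN measurableT _ (measurable_itv (`[b, c] : interval R)).
rewrite setTI; congr measurable; apply/seteqP; split => z /=; by rewrite in_itv.
Qed.

Lemma gauge_le_bounded c : exists2 M : R, 0 < M & forall z, N z <= c -> `|z| <= M.
Proof.
have [M M0 HM] := gauge_le1_bounded N E N0 Neq0 cpt hN ctr.
pose t := Num.max c 1; have t0 : 0 < t by rewrite lt_max ltr01 orbT.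
exists (d%:R * `|tpow t E| * M + 1) => [|z Nz]; first by rewrite ltr_wpDl// !mulr_ge0// ltW.
rewrite -(act_tpowK t E z t0); apply: le_trans (act_norm _ _) _.
apply: le_trans (_ : d%:R * `|tpow t E| * M <= _); last by rewrite lerDl.
rewrite ler_wpM2l ?mulr_ge0//; apply: HM.
rewrite hN ?invr_gt0// ler_pdivrMl// mulr1; apply: le_trans Nz _.
by rewrite le_max lexx.
Qed.

Lemma lebd_gauge_le c : (lebd [set z : rv | (N z <= c)%R] < +oo)%E.
Proof.
have [M M0 HM] := gauge_le_bounded c.
apply: le_lt_trans (lebm_nbox d (Num.truncn M).+1).
apply: le_measure; rewrite ?inE; [exact: measurable_gauge_le|exact: measurable_nbox|].
move=> z /= /HM zM j _.
apply: le_trans (le_coord_norm _ _) (le_trans zM _); exact/ltW/truncnS_gt.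
Qed.

Lemma integrable_gauge_bounded c (f : rv -> R) (M : R) : measurable_fun setT f ->
  (forall z, `|f z| <= M) -> (forall z, f z != 0 -> N z <= c) ->
  lebd.-integrable setT (EFin \o f).
Proof.
move=> mf fM fc.
have I := integrable_indic_fin lebd _ (measurable_gauge_le c) (lebd_gauge_le c).
apply: le_integrable (integrableZl measurableT M I) => //; first exact/measurable_EFinP.
move=> z _; rewrite /= lee_fin indicE.
have [zc|zc] := boolP (z \in [set z | N z <= c]).
  by rewrite mulr1 (le_trans (fM z))// ler_norm.
rewrite mulr0 normr0; have [->|/fc h] := eqVneq (f z) 0; first by rewrite normr0.
by case/negP: zc; rewrite inE.
Qed.

Variables (C p : R).
Hypotheses (C0 : 0 <= C) (pE : p = \tr E) (p1 : p < 1).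

(** The constant of [oscillatory_integral_le], with 1 - p + C accounting for the derivative of the
    weight s^(p-1); a factor 2^(1-p) because a curve enters at s = T / N w with N w <= 2; the mass
    of the shell over ln 2. *)
Definition tail_const : R := (4 + 6 * (1 - p + C) / (1 - p)) * 2 `^ (1 - p) *
  fine (lebd [set w : rv | 1 <= N w <= 2]) / ln 2.

Lemma tail_const_ge0 : 0 <= tail_const.
Proof.
have ln2 : 0 <= ln 2 :> R by rewrite ln_ge0//; lra.
have p1' : 0 <= 1 - p by rewrite subr_ge0 ltW.
rewrite /tail_const divr_ge0// !mulr_ge0 ?powR_ge0 ?fine_ge0//.
by rewrite addr_ge0// divr_ge0// mulr_ge0// addr_ge0.
Qed.

(* On each curve s |-> s^E w the phase has derivative bounded below, and the
   Jacobian contributes s^(p-1) with p < 1, so the tail beyond T is O(T^(p-1)). *)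
Lemma oscillatory_tail (T T' : R) (a Phi G : rv -> R) : 0 < T -> T < T' ->
  measurable_fun setT G ->
  (forall z, G z = if T <= N z < T' then a z * cos (Phi z) else 0) ->
  (forall w, 1 <= N w <= 2 -> exists a1 psi1 psi2 : R -> R,
    forall s, T <= s * N w <= T' ->
    [/\ is_derive s (1 : R) (along E w a) (a1 s), {for s, continuous a1},
        is_derive s (1 : R) (along E w Phi) (psi1 s), is_derive s (1 : R) psi1 (psi2 s) &
        {for s, continuous psi2}] /\
    [/\ 1 / 2 <= `|psi1 s|, `|psi2 s| <= C / s, `|along E w a s| <= 1 & `|a1 s| <= C / s]) ->
  `|\int[lebd]_z G z| <= tail_const * T `^ (p - 1).
Proof.
move=> T0 TT mG GE H.
have N1 z : N z != 0 -> 0 < N z by rewrite lt0r N0 andbT.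
have supp z : G z != 0 -> 0 < N z.
  rewrite GE; case: ifP => [/andP[h _] _|]; last by rewrite eqxx.
  exact: lt_le_trans h.
(* The hypothesis on curves is read at s = N z on the curve through the normalised point. *)
have a_le z : T <= N z < T' -> `|a z| <= 1.
  move=> /andP[Tz zT]; have Nz : 0 < N z by exact: lt_le_trans Tz.
  have z0 : z != 0 by apply: contraTneq Nz => ->; rewrite (Neq0 0).2// ltxx.
  have Nw := gauge_normalize N E N0 Neq0 hN z z0.
  have [|a1 [psi1 [psi2 h]]] := H (act (tpow (N z)^-1 E) z); first by rewrite Nw lexx ler1n.
  have [|_ [_ _ + _]] := h (N z); first by rewrite Nw mulr1 Tz ltW.
  by rewrite /along /curve gauge_polar.
have iG : lebd.-integrable setT (EFin \o G).
  apply: (integrable_gauge_bounded T' _ 1) => // z; rewrite GE.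
    case: ifP => [/a_le h|_]; last by rewrite normr0.
    rewrite normrM -[leRHS]mulr1 ler_pM// ler_norml cos_geN1 cos_le1//.
  by case: ifP => [/andP[_ /ltW]//|]; rewrite eqxx.
pose K := (4 + 6 * (1 - p + C) / (1 - p)) * 2 `^ (1 - p) * T `^ (p - 1).
have p1' : 0 <= 1 - p by rewrite subr_ge0 ltW.
have C2 : 0 <= 1 - p + C by rewrite addr_ge0.
have q0 : 0 <= 4 + 6 * (1 - p + C) / (1 - p) by rewrite addr_ge0// divr_ge0// mulr_ge0.
have K0 : 0 <= K by rewrite /K !mulr_ge0 ?powR_ge0.
have mS : measurable [set w : rv | 1 <= N w <= 2] by exact: measurable_gauge_itv.
have fS : (lebd [set w : rv | (1 <= N w <= 2)%R] < +oo)%E.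
  apply: le_lt_trans (lebd_gauge_le 2); apply: le_measure; rewrite ?inE//.
    exact: measurable_gauge_le.
  by move=> w /= /andP[].
have bnd := polar_bound N E mN hN G iG supp K K0 mS fS.
rewrite [leRHS](_ : _ = K * fine (lebd [set w : rv | 1 <= N w <= 2]) / ln 2); last first.
  by rewrite /K /tail_const; ring.
apply: bnd => w Sw; have [a1 [psi1 [psi2 h]]] := H w Sw.
have [w1 w2] := andP Sw; have Nw : 0 < N w by exact: lt_le_trans w1.
pose A := T / N w; pose B := T' / N w.
have A0 : 0 < A by rewrite divr_gt0.
have AB : A < B by rewrite ltr_pM2r// invr_gt0.
have itv s : A <= s <= B -> T <= s * N w <= T'.
  by rewrite /A /B ler_pdivrMr// ler_pdivlMr.
pose g s := s `^ (p - 1) * along E w a s.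
pose g1 s := (p - 1) * s `^ (p - 2) * along E w a s + s `^ (p - 1) * a1 s.
have pos s : A <= s <= B -> 0 < s by move=> /andP[h1 _]; exact: lt_le_trans h1.
have Hd s : A <= s <= B -> [/\ is_derive s (1 : R) g (g1 s), {for s, continuous g1},
      is_derive s (1 : R) (along E w Phi) (psi1 s), is_derive s (1 : R) psi1 (psi2 s) &
      {for s, continuous psi2}].
  move=> sAB; have s0 := pos _ sAB; have [[da ca dP dp cp] _] := h s (itv _ sAB).
  have dpow := is_derive_powR (p - 1) s s0.
  have dpow2 := is_derive_powR (p - 2) s s0.
  split => //.
    have := is_deriveM dpow da; congr (is_derive s 1 _ _).
    by rewrite /g1 /GRing.scale/= (_ : p - 1 - 1 = p - 2); ring.
  apply: cvgD; apply: cvgM => //.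
  - apply: cvgM; [exact: cvg_cst|exact: (is_derive_continuous _ _ _ dpow2)].
  - exact: (is_derive_continuous _ _ _ da).
  - exact: (is_derive_continuous _ _ _ dpow).
have Hb s : A <= s <= B -> [/\ 1 / 2 <= `|psi1 s|, `|psi2 s| <= (1 - p + C) / s,
     `|g s| <= s `^ (p - 1) & `|g1 s| <= (1 - p + C) * s `^ (p - 2)].
  move=> sAB; have s0 := pos _ sAB; have [_ [b1 b2 b3 b4]] := h s (itv _ sAB).
  have e2 : s `^ (p - 2) = s `^ (p - 1) / s.
    by rewrite -powRB1//; congr (_ `^ _); ring.
  have z1 := powR_ge0 s (p - 1); have z2 := powR_ge0 s (p - 2).
  split => //.
  - by apply: le_trans b2 _; rewrite ler_pM2r ?invr_gt0// lerDr.
  - by rewrite /g normrM ger0_norm// ler_piMr.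
  - apply: le_trans (ler_normD _ _) _; rewrite !normrM mulrDl.
    rewrite (ger0_norm z1) (ger0_norm z2) lerD//.
      by rewrite ltr0_norm ?subr_lt0// opprB ler_piMr ?mulr_ge0.
    by rewrite e2 mulrCA; exact: ler_wpM2l.
have osc := oscillatory_integral_le A B A0 AB g g1 _ psi1 psi2 _ p C2 p1 Hd Hb.
have cgc s : A <= s <= B -> {for s, continuous (fun s => g s * cos (along E w Phi s))}.
  move=> sAB; have [dg _ dP _ _] := Hd _ sAB; apply: cvgM.
    exact: (is_derive_continuous _ _ _ dg).
  apply: (@continuous_comp _ _ _ (along E w Phi) cos s); last exact: continuous_cos.
  exact: (is_derive_continuous _ _ _ dP).
have I := continuous_itv_integrable _ _ _ cgc.
have -> : (\int[leb]_s (dilated_slice N E G s w)%:E =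
    \int[leb]_(s in `[A, B]) (g s * cos (along E w Phi s))%:E)%E.
  (* G is cut off at N z < T', while the curve integral includes s N w = T'; the end point is
     negligible. *)
  rewrite -integral_itv_bndo_bndc; last first.
    apply: measurable_funS (measurable_int _ I) => //.
    by move=> x /=; rewrite !in_itv/= => /andP[-> /ltW ->].
  rewrite [RHS]integral_mkcond; apply: eq_integral => s _; rewrite patchE.
  have -> : (s \in (`[A, B[%classic : set R)) = (T <= s * N w < T').
    by apply/idP/idP; rewrite inE/= in_itv/= /A /B ler_pdivrMr// ltr_pdivlMr.
  rewrite /dilated_slice w1 w2 !andbT; case: ifPn => s0; last first.
    case: ifP => // /andP[h1 _]; case/negP: s0.
    by rewrite -(pmulr_lgt0 _ Nw); exact: lt_le_trans h1.
  by rewrite GE hN// -pE; case: ifP => _; rewrite ?mulr0// mulrA.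
have fin : (\int[leb]_(s in `[A, B]) (g s * cos (along E w Phi s))%:E \is a fin_num)%E.
  exact: integrable_fin_num.
rewrite -(fineK fin) abse_EFin lee_fin; apply: le_trans osc _.
rewrite /K; move: q0; set q := 4 + _ => q0; rewrite -(mulrA q) ler_wpM2l//.
rewrite /A powRM ?invr_ge0 ?(ltW T0) ?(ltW Nw)// mulrC ler_wpM2r ?powR_ge0//.
rewrite -powR_inv1 ?(ltW Nw)// -powRrM mulN1r opprB.
by rewrite ge0_ler_powR// nnegrE ltW.
Qed.

End oscillatory_tail.

(** * The compact shell and linear phases along its curves *)

Section shell.
Context {R : realType} {d : nat}.
Local Notation rv := 'rV[R]_d.

Lemma compact_pos_bounds (K : set rv) (f : rv -> R) : compact K -> continuous f ->
  (forall w, K w -> 0 < f w) ->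
  exists r1 r2 : R, 0 < r1 /\ forall w, K w -> r1 <= f w <= r2.
Proof.
move=> cK cf f0; have [[w0 Kw0]|Ke] := pselect (K !=set0); last first.
  by exists 1, 1; split => // w Kw; exfalso; apply: Ke; exists w.
have [c1 /set_mem Kc1 m1] : exists2 c, c \in K & forall t, t \in K -> f t <= f c.
  by apply: EVT_max_rV => //; [exists w0|exact: continuous_subspaceT].
have [c2 /set_mem Kc2 m2] : exists2 c, c \in K & forall t, t \in K -> - f t <= - f c.
  apply: (@EVT_max_rV _ _ (fun t => - f t)) => //; first by exists w0.
  by apply: continuous_subspaceT; exact: contN.
exists (f c2), (f c1); split; first exact: f0.
by move=> w Kw; rewrite -[f c2 <= _]lerN2 m1 ?m2 ?inE.
Qed.

Variables (N : rv -> R) (E : 'M[R]_d).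
Hypotheses (cN : continuous N) (N0 : forall x, 0 <= N x)
  (Neq0 : forall x, N x = 0 <-> x = 0) (cpt : compact [set x : rv | N x = 1])
  (hN : Exp_set N E) (ctr : contracting E).

Lemma compact_shell : compact [set w : rv | 1 <= N w <= 2].
Proof.
have [M M0 HM] := gauge_le_bounded N E N0 Neq0 cpt hN ctr 2.
apply: (@subclosed_compact _ _ [set t : rv | forall i, `[- M, M]%classic (t ord0 i)]).
- rewrite (_ : mkset _ = [set t | 1 <= N t] `&` [set t | N t <= 2]).
    apply: closedI.
      by apply: (@preimage_closed _ _ N [set y | 1 <= y]); [move=> x _; exact: cN|exact: closed_ge].
    by apply: (@preimage_closed _ _ N [set y | y <= 2]); [move=> x _; exact: cN|exact: closed_le].
  by apply/seteqP; split => t /=; [move=> /andP|move=> [-> ->]].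
- by apply: (@rV_compact _ _ (fun=> `[- M, M]%classic)) => i; exact: segment_compact.
- move=> t /andP[_ /HM h] i /=; rewrite in_itv/= -ler_norml.
  exact: le_trans (le_coord_norm _ _) h.
Qed.

Definition linear_vel (eta w : rv) (s : R) : R := \sum_j eta ord0 j * curve_vel E w s j.
Definition linear_acc (eta w : rv) (s : R) : R := \sum_j eta ord0 j * curve_acc E w s j.

Lemma is_derive_linear (eta w : rv) (s : R) : 0 < s ->
  [/\ is_derive s (1 : R) (along E w (dotR eta)) (linear_vel eta w s),
      is_derive s (1 : R) (linear_vel eta w) (linear_acc eta w s) &
      {for s, continuous (linear_acc eta w)}].
Proof.
move=> s0; split.
- apply: (is_derive_sum_fin (fun j s => eta ord0 j * curve E w s ord0 j)) => j.
  exact: (is_deriveZ (eta ord0 j) (is_derive_curve E w s j s0)).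
- apply: (is_derive_sum_fin (fun j s => eta ord0 j * curve_vel E w s j)) => j.
  exact: (is_deriveZ (eta ord0 j) (is_derive_curve_vel E w s j s0)).
- apply: cvg_sumR => j; apply: cvgM; first exact: cvg_cst.
  exact: continuous_curve_acc.
Qed.

Lemma sum_coord_le (eta : rv) (f : 'I_d -> R) (H M : R) : 0 <= M -> `|eta| <= H ->
  (forall j, `|f j| <= M) -> `|\sum_j eta ord0 j * f j| <= d%:R * (H * M).
Proof.
move=> M0 eH fM; apply: le_trans (ler_norm_sum _ _ _) _.
apply: le_trans (ler_sum _ (G := fun=> H * M) _) _.
  by move=> j _; rewrite normrM ler_pM// (le_trans (le_coord_norm _ _)).
by rewrite sumr_const card_ord -[leLHS]mulr_natl.
Qed.

Variable c : R.
Hypothesis c0 : 0 < c.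
Hypothesis far : forall x, 1 <= N x -> `|x| ^+ 2 <= c * N x.

(* |s^E w| = O(s^(1/2)), so linear phases have derivative O(s^(-1/2)). *)
Lemma linear_phase (H : R) : 0 <= H -> exists S L : R, 1 <= S /\ 0 <= L /\
  forall eta w s, `|eta| <= H -> 1 <= N w <= 2 -> S <= s ->
    `|linear_vel eta w s| <= 1 / 4 /\ `|linear_acc eta w s| <= L / s.
Proof.
move=> H0; pose B := d%:R * `|E|; have B0 : 0 <= B by rewrite mulr_ge0.
pose D := d%:R * H; have D0 : 0 <= D by rewrite mulr_ge0.
pose L := 4 * (D * B) + 1; have L0 : 0 < L by rewrite ltr_wpDl// !mulr_ge0.
(* For s at least this threshold, |s^E w|^2 <= 2 c s gives L |s^E w| <= s. Since L >= 4 D B, the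
   velocity bound D B |s^E w| / s is at most 1/4. *)
exists (2 * c * L ^+ 2 + 1), (D * (B * B + B)).
have S0 : 0 <= 2 * c * L ^+ 2 by rewrite !mulr_ge0// ltW.
split; first by rewrite lerDr.
split; first by rewrite mulr_ge0// addr_ge0// mulr_ge0.
move=> eta w s eH /andP[w1 w2] sS.
have s1 : 1 <= s by apply: le_trans sS; rewrite lerDr.
have s0 : 0 < s by exact: lt_le_trans s1.
have x2 : `|curve E w s| ^+ 2 <= c * (s * N w).
  have e : N (curve E w s) = s * N w by exact: hN.
  by rewrite -e far// e; apply: mulr_ege1.
have xs : `|curve E w s| * L <= s.
  rewrite -ler_sqr ?nnegrE ?mulr_ge0 ?(ltW L0) ?(ltW s0)// exprMn.
  apply: le_trans (_ : c * (s * 2) * L ^+ 2 <= _).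
    rewrite ler_wpM2r ?sqr_ge0// (le_trans x2)// !ler_wpM2l//; exact: ltW.
  rewrite [leLHS](_ : _ = s * (2 * c * L ^+ 2)); last by ring.
  by rewrite expr2 ler_wpM2l ?(ltW s0)// (le_trans _ sS)// lerDl.
have L1 : 1 <= L by rewrite lerDr mulr_ge0// mulr_ge0.
have xs1 : `|curve E w s| <= s by apply: le_trans xs; rewrite ler_peMr.
have Ex j : `|act E (curve E w s) ord0 j| <= B * `|curve E w s|.
  by apply: le_trans (le_coord_norm _ _) _; exact: act_norm.
have vel j : `|curve_vel E w s j| <= B * `|curve E w s| / s.
  rewrite /curve_vel normrM normfV (gtr0_norm s0) ler_pM2r ?invr_gt0//.
have velB j : `|curve_vel E w s j| <= B.
  apply: le_trans (vel j) _; rewrite ler_pdivrMr// ler_wpM2l//.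
split.
  apply: le_trans (sum_coord_le _ _ _ _ _ eH vel) _.
    by rewrite divr_ge0 ?(ltW s0)// mulr_ge0.
  rewrite (_ : d%:R * (H * (B * `|curve E w s| / s)) = D * B * `|curve E w s| / s); last first.
    by rewrite /D !mulrA.
  rewrite ler_pdivrMr//.
  have : D * B * `|curve E w s| * 4 <= s.
    apply: le_trans xs; rewrite [leLHS](_ : _ = `|curve E w s| * (4 * (D * B))); last by ring.
    by rewrite ler_wpM2l// /L lerDl.
  by move: (D * B * _) => Y; lra.
have acc j : `|curve_acc E w s j| <= (B * B + B) / s.
  rewrite /curve_acc; apply: le_trans (ler_normB _ _) _; rewrite mulrDl lerD//.
    rewrite normrM normfV (gtr0_norm s0) ler_pM2r ?invr_gt0//.
    apply: le_trans (ler_norm_sum _ _ _) _.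
    apply: le_trans (ler_sum _ (G := fun=> `|E| * B) _) _.
      by move=> k _; rewrite normrM ler_pM// mx_entry_norm.
    by rewrite sumr_const card_ord -[leLHS]mulr_natl mulrA.
  rewrite normrM normfV normrX (gtr0_norm s0) expr2 invfM mulrA ler_pM2r ?invr_gt0//.
  rewrite ler_pdivrMr//; apply: le_trans (Ex j) _; exact: ler_wpM2l.
apply: le_trans (sum_coord_le _ _ _ _ _ eH acc) _.
  by rewrite divr_ge0 ?(ltW s0)// addr_ge0// mulr_ge0.
by rewrite !mulrA.
Qed.

(** Homogeneity of |Q| determines Q(t^E x) up to sign. If Q x is nonzero, Q vanishes nowhere on the
    dilation curve of x, so by the intermediate value theorem its sign cannot change. *)
Lemma Exp_set_abs (Q : rv -> R) : continuous Q -> Exp_set (fun x => `|Q x|) E -> Exp_set Q E.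
Proof.
move=> cQ hQ t x t0.
have h : `|Q (act (tpow t E) x)| = t * `|Q x| by exact: hQ.
have : (Q (act (tpow t E) x) == t * Q x) || (Q (act (tpow t E) x) == - (t * Q x)).
  by rewrite -eqr_norm2 h normrM gtr0_norm.
move=> /orP[/eqP//|/eqP e].
have [Q0|Qx] := eqVneq (Q x) 0; first by rewrite e Q0 mulr0 oppr0.
pose f s := Q (curve E x s).
have f1 : f 1 = Q x by rewrite /f /curve act_tpow1.
have ft : f t = - (t * Q x) by [].
have m0 : 0 < Num.min 1 t by rewrite lt_min ltr01.
have cf : {within `[Num.min 1 t, Num.max 1 t], continuous f}.
  apply: continuous_in_subspaceT => s; rewrite inE/= in_itv/= => /andP[ms _].
  have s0 : 0 < s by exact: lt_le_trans ms.
  by have := continuous_comp (continuous_curve E x s s0) (cQ (curve E x s)); exact.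
have fs (s : R) : 0 < s -> f s != 0.
  by move=> s0; rewrite -normr_eq0 /f hQ// mulf_neq0 ?normr_eq0// gt_eqF.
have mM : Num.min 1 t <= Num.max 1 t by rewrite ge_min !le_max lexx.
have v0 : Num.min (f (Num.min 1 t)) (f (Num.max 1 t)) <= 0 <= Num.max (f (Num.min 1 t)) (f (Num.max 1 t)).
  have sgn : Num.min (Q x) (- (t * Q x)) <= 0 <= Num.max (Q x) (- (t * Q x)).
    have [a|a] := leP (Q x) 0.
      have b : 0 <= - (t * Q x) by rewrite oppr_ge0 pmulr_rle0.
      by rewrite ge_min le_max a b orbT.
    have b : - (t * Q x) <= 0 by rewrite oppr_le0 pmulr_rge0// ltW.
    by rewrite ge_min le_max (ltW a) b orbT.
  by case: (leP 1 t) => _; rewrite f1 ft // minC maxC.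
have [s] := IVT mM cf v0; rewrite in_itv/= => /andP[ms _] /eqP fs0.
by move: (fs s (lt_le_trans m0 ms)); rewrite fs0.
Qed.

End shell.

(** * The imaginary homogeneous case *)

Section imaginary_tail.
Context {R : realType} {d : nat}.
Local Notation rv := 'rV[R]_d.
Variables (Q : rv -> R) (E : 'M[R]_d).
Local Notation N := (fun x : rv => `|Q x|).
Hypotheses (cQ : continuous Q) (cN : continuous N)
  (Neq0 : forall x, N x = 0 <-> x = 0) (cpt : compact [set x : rv | N x = 1])
  (hN : Exp_set N E) (ctr : contracting E) (p1 : \tr E < 1).
Variable c : R.
Hypotheses (c0 : 0 < c) (far : forall x, 1 <= N x -> `|x| ^+ 2 <= c * N x).

Let N0 x : 0 <= N x. Proof. exact: normr_ge0. Qed.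
Let hQ : Exp_set Q E. Proof. exact: Exp_set_abs cQ hN. Qed.

(** What the tail estimate demands of an amplitude a and a phase perturbation V, with one C for all
    curves. The 1/4 for V and the 1/4 for the linear phase leave at least 1/2 of the main speed |Q
    w| >= 1. *)
Definition curve_regular (C : R) (a V : rv -> R) (T : R) : Prop :=
  forall w, 1 <= N w <= 2 -> exists a1 v1 v2 : R -> R,
    forall s, 0 < s -> s * N w <= T ->
    [/\ is_derive s (1 : R) (along E w a) (a1 s), {for s, continuous a1},
        is_derive s (1 : R) (along E w V) (v1 s), is_derive s (1 : R) v1 (v2 s) &
        {for s, continuous v2}] /\
    [/\ `|v1 s| <= 1 / 4, `|v2 s| <= C / s, `|along E w a s| <= 1 & `|a1 s| <= C / s].

(** S and K precede eta, theta, a and V, so the bound is uniform over waves with |eta| <= H. The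
    angle theta serves to turn the cosine into a sine. *)
Lemma phase_tail (H C : R) : 0 <= H -> 0 <= C -> exists S K : R, 0 < S /\ 0 <= K /\
  forall eta theta T T' a V G, `|eta| <= H -> S <= T -> T < T' -> measurable_fun setT G ->
    (forall z, G z = if T <= N z < T' then a z * cos (theta - (Q z + V z) - dotR eta z) else 0) ->
    curve_regular C a V T' ->
    `|\int[lebd]_z G z| <= K * T `^ (\tr E - 1).
Proof.
move=> H0 C0; have [S [L [S1 [L0 HL]]]] := linear_phase N E hN c c0 far H H0.
have CL : 0 <= C + L by rewrite addr_ge0.
(* As N w <= 2, the condition s N w >= 2 S ensures s >= S. *)
exists (2 * S), (tail_const N (C + L) (\tr E)).
split; first by rewrite mulr_gt0// (lt_le_trans ltr01).
split; first exact: tail_const_ge0.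
move=> eta theta T T' a V G eH ST TT mG GE reg.
have T0 : 0 < T by apply: lt_le_trans ST; rewrite mulr_gt0// (lt_le_trans ltr01).
apply: (oscillatory_tail N E cN N0 Neq0 cpt hN ctr (C + L) (\tr E) CL erefl p1 T T' a
  (fun z => theta - (Q z + V z) - dotR eta z) G T0 TT mG GE) => w Nw.
have [a1 [v1 [v2 hreg]]] := reg w Nw; have [w1 w2] := andP Nw.
exists a1, (fun s => - (Q w + v1 s) - linear_vel E eta w s),
  (fun s => - v2 s - linear_acc E eta w s) => s /andP[Ts sT].
have Nw0 : 0 < N w by exact: lt_le_trans w1.
have s0 : 0 < s by rewrite -(pmulr_lgt0 _ Nw0); exact: lt_le_trans Ts.
have Ss : S <= s.
  have : s * N w <= s * 2 by rewrite ler_wpM2l// ltW.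
  by lra.
have [[da ca dV dv1 cv2] [b1 b2 b3 b4]] := hreg s s0 sT.
have [dl dl1 cl2] := is_derive_linear E eta w s s0.
have [l1 l2] := HL eta w s eH Nw Ss.
have dQ : is_derive s (1 : R) (along E w Q) (Q w).
  have e1 : \forall r \near s, Q w * r = along E w Q r.
    have : \forall r \near s, 0 < r by exact: lt_nbhsr.
    by apply: filterS => r r0; rewrite /along /curve hQ// mulrC.
  apply: is_derive_near_eq e1 _.
  have := is_deriveZ (Q w) (is_derive_id s (1 : R)); congr (is_derive s 1 _ _).
  by rewrite /GRing.scale/= mulr1.
split; split => //.
- have := is_deriveB (is_deriveB (is_derive_cst theta s (1 : R)) (is_deriveD dQ dV)) dl.
  by congr (is_derive s 1 _ _); rewrite sub0r.
- have := is_deriveB (is_deriveN (is_deriveD (is_derive_cst (Q w) s (1 : R)) dv1)) dl1.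
  by congr (is_derive s 1 _ _); rewrite add0r.
- by apply: cvgB => //; apply: cvgN.
- have := ler_normB (Q w + v1 s + linear_vel E eta w s) (v1 s + linear_vel E eta w s).
  rewrite (_ : _ - (v1 s + _) = Q w); last by ring.
  rewrite (_ : - (Q w + v1 s) - _ = - (Q w + v1 s + linear_vel E eta w s)) ?normrN; last by ring.
  by have := ler_normD (v1 s) (linear_vel E eta w s); lra.
- apply: le_trans (ler_normB _ _) _; rewrite normrN mulrDl; exact: lerD.
- apply: le_trans b4 _; rewrite ler_pM2r ?invr_gt0// lerDl//.
Qed.

Variables (Qt Rr Rt : rv -> R) (k : R).
Hypotheses (posR : pos_homogeneous Rr) (k1 : 1 < k) (hR : Exp_set Rr (k^-1 *: E))
  (sQt : strongly_subhomogeneous E 2 Qt) (sRt : strongly_subhomogeneous (k^-1 *: E) 1 Rt).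

Definition scaled_amp (n : R) (z : rv) : R :=
  expR (- (n * (Rr (act (tpow n^-1 E) z) + Rt (act (tpow n^-1 E) z)))).
Definition scaled_phase (n : R) (z : rv) : R := n * Qt (act (tpow n^-1 E) z).

Lemma expR_mul_le1 (x : R) : 0 <= x -> x * expR (- x) <= 1.
Proof.
move=> x0; rewrite expRN ler_pdivrMr ?expR_gt0// mul1r.
by apply: le_trans (expR_ge1Dx x); rewrite lerDr.
Qed.

(** With u = (s/n)^k the point n^-E s^E w is u^(E/k) w, so the damping exponent n m(s) is at least n
    u r1/2, while its derivative is O(n u / s). As x exp(-x) <= 1, the amplitude has derivative
    O(1/s) uniformly in n. *)
Lemma amplitude_regular : exists delta C : R, 0 < delta /\ 0 <= C /\
  forall n, 0 < n -> curve_regular C (scaled_amp n) (scaled_phase n) (n * delta).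
Proof.
have [cR R0 Req0 _ _] := posR.
have cS := compact_shell N E cN N0 Neq0 cpt hN ctr.
have Rpos w : 1 <= N w <= 2 -> 0 < Rr w.
  move=> /andP[w1 _]; rewrite lt0r R0 andbT; apply/eqP => /Req0 w0.
  by move: w1; rewrite w0 (Neq0 0).2// ler10.
have [r1 [r2 [r10 Hr]]] := compact_pos_bounds _ Rr cS cR Rpos.
have e1 : 0 < 1 / 4 :> R by lra.
have e2 : 0 < r1 / 2 by rewrite divr_gt0.
have [t1 t10 H1] := strong_subhom2 E Qt sQt _ e1 _ cS.
have [t2 t20 H2] := strong_subhom1 _ Rt sRt _ e2 _ cS.
have k0 : 0 < k by exact: lt_trans k1.
have kn : k != 0 by rewrite gt_eqF.
(* The cap 1 ensures (s/n)^k <= s/n, so that one delta controls both parameters s/n and u. *)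
pose delta := Num.min (Num.min t1 t2) 1 / 2.
have d0 : 0 < delta by rewrite divr_gt0// !lt_min t10 t20 ltr01.
have dt1 : delta < t1.
  have : Num.min (Num.min t1 t2) 1 <= t1 by rewrite !ge_min lexx.
  by rewrite /delta; lra.
have dt2 : delta < t2.
  have : Num.min (Num.min t1 t2) 1 <= t2 by rewrite !ge_min lexx orbT.
  by rewrite /delta; lra.
have d1 : delta <= 1.
  have : Num.min (Num.min t1 t2) 1 <= 1 by rewrite ge_min lexx orbT.
  by rewrite /delta; lra.
pose C := (r2 + r1 / 2) * k * (2 / r1) + 1.
have r20 w : 1 <= N w <= 2 -> 0 < r2.
  by move=> /Hr/andP[a b]; rewrite (lt_le_trans r10)// (le_trans a).
(* The maximum keeps the constant non-negative even for an empty shell, and covers the bound 1/4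
   coming from [Qt]. *)
pose C' := Num.max C 1.
exists delta, C'; split => //; split; first by rewrite le_max ler01 orbT.
move=> n n0 w Nw; have [w1 w2] := andP Nw.
have CC : 0 <= (r2 + r1 / 2) * k * (2 / r1).
  have r20' := ltW (r20 w Nw).
  have rr : 0 <= r2 + r1 / 2 by rewrite addr_ge0// ltW.
  by rewrite mulr_ge0// ?mulr_ge0// ?divr_ge0 ?invr_ge0 ?(ltW r10) ?(ltW k0).
have nn : n != 0 by rewrite gt_eqF.
pose E' := k^-1 *: E.
pose u (s : R) := (s / n) `^ k.
pose du (s : R) := k * u s / s.
pose m (s : R) := u s * Rr w + along E' w Rt (u s).
pose dm (s : R) := (Rr w + along1 E' w Rt (u s)) * du s.
exists (fun s => - (n * dm s) * expR (- (n * m s))), (fun s => along1 E w Qt (s / n)),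
  (fun s => along2 E w Qt (s / n) / n).
have ni : 0 < n^-1 by rewrite invr_gt0.
have sc s : 0 < s -> act (tpow n^-1 E) (curve E w s) = curve E w (s / n).
  move=> s0; have h := esym (act_tpowM n^-1 s E w ni s0).
  exact: etrans h (congr1 (fun r => curve E w r) (mulrC n^-1 s)).
have uk s : 0 < s -> u s `^ k^-1 = s / n.
  by move=> s0; rewrite /u -powRrM divff// powRr1// divr_ge0// ltW.
have sc' s : 0 < s -> act (tpow n^-1 E) (curve E w s) = curve E' w (u s).
  move=> s0; have us0 : 0 < u s by rewrite powR_gt0// divr_gt0.
  have h : curve E' w (u s) = curve E w (s / n).
    by have h := tpowZ (u s) k^-1 E us0; rewrite (uk s s0) in h; rewrite /curve h.
  exact: etrans (sc s s0) (esym h).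
have aE s : 0 < s -> along E w (scaled_amp n) s = expR (- (n * m s)).
  move=> s0; have us0 : 0 < u s by rewrite powR_gt0// divr_gt0.
  have e := hR (u s) w us0; rewrite -/E' -/(curve E' w (u s)) in e.
  by rewrite /along /scaled_amp (sc' s s0) e.
move=> s s0 sN.
have sn0 : 0 < s / n by rewrite divr_gt0.
have sn_d : s / n <= delta.
  rewrite ler_pdivrMr// mulrC; apply: le_trans sN; rewrite ler_peMr//; exact: ltW.
have u0 : 0 < u s by rewrite powR_gt0.
have ud : u s <= delta.
  apply: (le_trans _ sn_d); rewrite -[leRHS]powRr1 ?(ltW sn0)//.
  have s1 : 0 < s / n <= 1 by rewrite sn0 (le_trans sn_d d1).
  exact: (ger_powR s1 (ltW k1)).
have [dQ dQ1 cQ1 cQ2 [bQ bQ1 bQ2]] := H1 w (s / n) Nw ltac:(by rewrite sn0 (le_lt_trans sn_d)).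
have [dR cR1 bR bR1] := H2 w (u s) Nw ltac:(by rewrite u0 (le_lt_trans ud)).
have ddiv : is_derive s (1 : R) (fun s => s / n) n^-1.
  have -> : (fun s : R => s / n) = n^-1 *: (fun s : R => s) by apply/funext => r; rewrite mulrC.
  have := is_deriveZ n^-1 (is_derive_id s (1 : R)); congr (is_derive s 1 _ _).
  by rewrite /GRing.scale/= mulr1.
have dU : is_derive s (1 : R) u (du s).
  have := @is_derive1_comp R (fun x => x `^ k) (fun s => s / n) s _ _ (is_derive_powR k (s / n) sn0) ddiv.
  congr (is_derive s 1 _ _); rewrite /du /u powRB1//.
  by rewrite invf_div; field; rewrite nn gt_eqF.
have cU := is_derive_continuous _ _ _ dU.
have dM : is_derive s (1 : R) m (dm s).
  have d2 := @is_derive1_comp R (along E' w Rt) u s _ _ dR dU.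
  have := is_deriveD (is_deriveZ (Rr w) dU) d2.
  have -> : (Rr w *: u + (along E' w Rt \o u)) = m.
    by apply/funext => r; rewrite /m mulrC.
  by congr (is_derive s 1 _ _); rewrite /dm /GRing.scale/=; ring.
have cM := is_derive_continuous _ _ _ dM.
have dA : is_derive s (1 : R) (fun s => expR (- (n * m s))) (- (n * dm s) * expR (- (n * m s))).
  have d3 : is_derive s (1 : R) (fun s => - (n * m s)) (- (n * dm s)) := is_deriveN (is_deriveZ n dM).
  have := @is_derive1_comp R expR (fun s => - (n * m s)) s _ _ (is_derive_expR _) d3.
  by congr (is_derive s 1 _ _); rewrite mulrC.
have cA := is_derive_continuous _ _ _ dA.
have m_ge : n * u s * (r1 / 2) <= n * m s.
  rewrite -mulrA ler_wpM2l ?(ltW n0)// /m.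
  have [a _] := andP (Hr w Nw); move: bR; rewrite ler_norml => /andP[b _].
  by have : u s * r1 <= u s * Rr w; [rewrite ler_wpM2l// ltW|lra].
have nu0 : 0 <= n * u s * (r1 / 2) by rewrite !mulr_ge0 ?divr_ge0// ltW.
split; split.
- apply: is_derive_near_eq dA.
  have : \forall r \near s, 0 < r by exact: lt_nbhsr.
  by apply: filterS => r r0; rewrite aE.
- apply: cvgM => //; apply: cvgN; apply: cvgM; first exact: cvg_cst.
  apply: cvgM.
    apply: cvgD; first exact: cvg_cst.
    by have := continuous_comp cU cR1; exact.
  by apply: cvgM; [apply: cvgM => //; exact: cvg_cst|apply: inv_continuous; rewrite gt_eqF].
- have e3 : \forall r \near s, n * along E w Qt (r / n) = along E w (scaled_phase n) r.
    have : \forall r \near s, 0 < r by exact: lt_nbhsr.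
    by apply: filterS => r r0; rewrite /along /scaled_phase sc.
  apply: is_derive_near_eq e3 _.
  have := is_deriveZ n (@is_derive1_comp R (along E w Qt) (fun s => s / n) s _ _ dQ ddiv); congr (is_derive s 1 _ _).
  by rewrite /GRing.scale/=; field.
- exact: (@is_derive1_comp R (along1 E w Qt) (fun s => s / n) s _ _ dQ1 ddiv).
- apply: cvgM; last exact: cvg_cst.
  by have := continuous_comp (is_derive_continuous _ _ _ ddiv) cQ2; exact.
- exact: bQ1.
- rewrite (_ : along2 E w Qt (s / n) / n = (s / n * along2 E w Qt (s / n)) / s); last first.
    by field; rewrite nn gt_eqF.
  rewrite normrM [`|s^-1|]gtr0_norm ?invr_gt0// ler_pM2r ?invr_gt0//.
  by apply: le_trans bQ2 _; rewrite le_max; apply/orP; right; lra.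
- rewrite aE// ger0_norm ?expR_ge0// -expR0 ler_expR oppr_le0; exact: le_trans m_ge.
- rewrite normrM normrN normrM (gtr0_norm n0) (ger0_norm (expR_ge0 _)) /dm /du.
  rewrite normrM (ger0_norm (divr_ge0 (mulr_ge0 (ltW k0) (ltW u0)) (ltW s0))).
  have b1 : `|Rr w + along1 E' w Rt (u s)| <= r2 + r1 / 2.
    apply: le_trans (ler_normD _ _) _; apply: lerD => //.
    by rewrite ger0_norm//; case/andP: (Hr w Nw).
  have b2 : n * u s * (r1 / 2) * expR (- (n * m s)) <= 1.
    apply: le_trans (expR_mul_le1 _ nu0); rewrite ler_wpM2l// ler_expR lerN2//.
  set X := `|_ + _| in b1 *; set Y := expR _ in b2 *.
  rewrite (_ : n * (X * (k * u s / s)) * Y = X * k * (2 / r1) * (n * u s * (r1 / 2) * Y) / s); last first.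
    by field; rewrite !gt_eqF.
  rewrite ler_pM2r ?invr_gt0//.
  have q0 : 0 <= 2 / r1 by rewrite divr_ge0// ltW.
  have l1 : X * k * (2 / r1) <= (r2 + r1 / 2) * k * (2 / r1).
    by apply: ler_wpM2r => //; apply: ler_wpM2r => //; exact: ltW.
  have X0 : 0 <= X * k * (2 / r1) by apply: mulr_ge0 => //; apply: mulr_ge0; [exact: normr_ge0|exact: ltW].
  have Y0 : 0 <= n * u s * (r1 / 2) * Y by apply: mulr_ge0 => //; exact: expR_ge0.
  apply: le_trans (_ : (r2 + r1 / 2) * k * (2 / r1) * 1 <= _); first exact: ler_pM.
  by rewrite mulr1 le_max /C lerDl ler01.
Qed.

End imaginary_tail.

(** * Conditionally convergent attractor integrals *)

Section attractor_limit.
Context {R : realType} {d : nat}.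
Local Notation rv := 'rV[R]_d.
Local Notation Re := complex.Re.
Local Notation Im := complex.Im.

Lemma powRN_small (q e : R) : 0 < q -> 0 < e ->
  exists2 T0 : R, 0 < T0 & forall T, T0 <= T -> T `^ (- q) <= e.
Proof.
move=> q0 e0; exists (e `^ (- q^-1)); first exact: powR_gt0.
move=> T eT; have T00 : 0 < e `^ (- q^-1) by exact: powR_gt0.
have -> : e = (e `^ (- q^-1)) `^ (- q) by rewrite -powRrM mulrNN mulVf ?gt_eqF// powRr1// ltW.
have T0 : 0 < T by exact: lt_le_trans T00 eT.
rewrite !(powRN _ q) lef_pV2 ?posrE ?powR_gt0//.
by apply: ge0_ler_powR; rewrite ?nnegrE ?(ltW q0) ?(ltW T00) ?(ltW T0).
Qed.

Lemma cmeasurable_if (b : rv -> bool) (f g : rv -> R[i]) : measurable_fun setT b ->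
  cmeasurable f -> cmeasurable g -> cmeasurable (fun z => if b z then f z else g z).
Proof.
move=> mb [f1 f2] [g1 g2]; split.
  rewrite (_ : (fun _ => _) = fun z => if b z then Re (f z) else Re (g z)).
    exact: measurable_fun_ifT.
  by apply/funext => z; case: ifP.
rewrite (_ : (fun _ => _) = fun z => if b z then Im (f z) else Im (g z)).
  exact: measurable_fun_ifT.
by apply/funext => z; case: ifP.
Qed.

Variables (Q : rv -> R) (E : 'M[R]_d).
Local Notation N := (fun x : rv => `|Q x|).
Hypotheses (cQ : continuous Q) (cN : continuous N)
  (Neq0 : forall x, N x = 0 <-> x = 0) (cpt : compact [set x : rv | N x = 1])
  (hN : Exp_set N E) (ctr : contracting E) (p1 : \tr E < 1).
Variable c : R.
Hypotheses (c0 : 0 < c) (far : forall x, 1 <= N x -> `|x| ^+ 2 <= c * N x).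

Let N0 x : 0 <= N x. Proof. exact: normr_ge0. Qed.
Let mN : measurable_fun setT N. Proof. exact: continuous_measurable_rV. Qed.

Lemma measurable_gauge_lt T : measurable_fun setT (fun z : rv => `|Q z| < T).
Proof. by apply: measurable_fun_ltr => //; exact: measurable_cst. Qed.

Lemma measurable_gauge_ge T : measurable_fun setT (fun z : rv => T <= `|Q z|).
Proof. by apply: measurable_fun_ler => //; exact: measurable_cst. Qed.

Lemma cintegrable_gauge_bounded (b M : R) (f : rv -> R[i]) : cmeasurable f ->
  (forall z, cmod (f z) <= M) -> (forall z, f z != 0 -> `|Q z| <= b) -> cintegrable f.
Proof.
move=> [f1 f2] fM fb.
have nz (g : R[i] -> R) : g 0 = 0 -> forall z, g (f z) != 0 -> `|Q z| <= b.
  by move=> g0 z h; apply: fb; apply: contra_neq h => ->.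
split; apply: (integrable_gauge_bounded N E cN N0 Neq0 cpt hN ctr b _ M) => //.
- by move=> z; exact: le_trans (Re_le_cmod _) (fM z).
- exact: (nz (fun z => Re z) erefl).
- by move=> z; exact: le_trans (Im_le_cmod _) (fM z).
- exact: (nz (fun z => Im z) erefl).
Qed.

(** The real part is the case theta = 0, the imaginary part the case theta = -pi/2; together they
    double the constant. *)
Lemma cphase_tail (H C : R) : 0 <= H -> 0 <= C -> exists S K : R, 0 < S /\ 0 <= K /\
  forall eta T T' a V G, `|eta| <= H -> S <= T -> T < T' -> cmeasurable G ->
    (forall z, G z = if T <= `|Q z| < T'
      then (a z)%:C * iexp (- (Q z + V z) - dotR eta z) else 0) ->
    curve_regular Q E C a V T' -> cmod (cint G) <= K * T `^ (\tr E - 1).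
Proof.
move=> H0 C0.
have [S [K [S0 [K0 HK]]]] := phase_tail Q E cQ cN Neq0 cpt hN ctr p1 c c0 far H C H0 C0.
exists S, (2 * K); split => //; split; first exact: mulr_ge0.
move=> eta T T' a V G eH ST TT [mr mi] GE reg.
apply: le_trans (cmod_le_ReIm _) _; rewrite -mulrA mulr_natl mulr2n; apply: lerD.
  apply: (HK eta 0 T T' a V (fun z => Re (G z)) eH ST TT mr _ reg) => z.
  rewrite GE; case: ifP => // _.
  by rewrite ReM Re_iexp /= mul0r subr0 sub0r.
apply: (HK eta (- (pi / 2)) T T' a V (fun z => Im (G z)) eH ST TT mi _ reg) => z.
rewrite GE; case: ifP => // _; rewrite ImM Im_iexp /= mul0r addr0; congr (_ * _).
rewrite -cosBpihalf; congr cos; ring.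
Qed.

(** The truncated attractor at time 1; other times are reduced to it by dilation in
    [cint_attr_trunc]. *)
Definition attr_cut (eta : rv) (T : R) (z : rv) : R[i] :=
  if `|Q z| < T then iexp (- Q z - dotR eta z) else 0.

Lemma cmeasurable_attr_phase (eta : rv) : cmeasurable (fun z => iexp (- Q z - dotR eta z)).
Proof.
apply: cmeasurable_cexp; split; first exact: measurable_cst.
apply: continuous_measurable_rV; apply: contB; first exact: contN.
exact: continuous_dotR.
Qed.

Lemma cintegrable_attr_cut eta T : cintegrable (attr_cut eta T).
Proof.
apply: (cintegrable_gauge_bounded T 1).
- apply: cmeasurable_if; [exact: measurable_gauge_lt|exact: cmeasurable_attr_phase|exact: cmeasurable_cst].
- by move=> z; rewrite /attr_cut; case: ifP => _; rewrite ?cmod_iexp ?cmod0.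
- by move=> z; rewrite /attr_cut; case: ifP => [/ltW//|]; rewrite eqxx.
Qed.

Lemma attr_cut_cauchy (H : R) : 0 <= H -> exists S K : R, 0 < S /\ 0 <= K /\
  forall eta T T', `|eta| <= H -> S <= T -> T < T' ->
    cmod (cint (attr_cut eta T') - cint (attr_cut eta T)) <= K * T `^ (\tr E - 1).
Proof.
move=> H0; have [S [K [S0 [K0 HK]]]] := cphase_tail H 0 H0 (lexx 0).
exists S, K; split => //; split => // eta T T' eH ST TT.
have I1 := cintegrable_attr_cut eta T'; have I2 := cintegrable_attr_cut eta T.
rewrite -cintB//; apply: (HK eta T T' (fun=> 1) (fun=> 0)) => //.
- by apply: cintegrable_measurable; exact: cintegrableB.
- move=> z; rewrite /attr_cut mul1r addr0.
  have [zT|zT] := ltP `|Q z| T; last by rewrite subr0.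
  by rewrite (lt_trans zT TT) subrr.
- move=> w _; exists (fun=> 0), (fun=> 0), (fun=> 0) => s s0 _.
  split; split; try exact: is_derive_cst; try exact: cvg_cst.
  + by rewrite normr0; lra.
  + by rewrite normr0 mul0r.
  + by rewrite /along normr1.
  + by rewrite normr0 mul0r.
Qed.

(** The tail bound makes the truncations Cauchy, and letting T' tend to infinity in it gives the
    rate. The constants depend on eta only through H, as uniformity in x demands. *)
Lemma attr_cut_cvg (H : R) : 0 <= H -> exists S K : R, 0 < S /\ 0 <= K /\
  forall eta, `|eta| <= H -> exists l : R[i],
    [/\ Re (cint (attr_cut eta T)) @[T --> +oo] --> Re l,
        Im (cint (attr_cut eta T)) @[T --> +oo] --> Im l &
        forall T, S <= T -> cmod (l - cint (attr_cut eta T)) <= K * T `^ (\tr E - 1)].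
Proof.
move=> H0; have [S [K [S0 [K0 HK]]]] := attr_cut_cauchy H H0.
exists S, (2 * K); split => //; split; first exact: mulr_ge0.
move=> eta eH.
have q0 : 0 < 1 - \tr E by rewrite subr_gt0.
have small e : 0 < e -> exists2 T, S <= T & K * T `^ (\tr E - 1) < e.
  move=> e0; have e1 : 0 < e / 2 / (K + 1) by rewrite !divr_gt0// ltr_wpDl.
  have [T0 T00 HT] := powRN_small _ _ q0 e1.
  exists (Num.max S T0); first by rewrite le_max lexx.
  have /HT : T0 <= Num.max S T0 by rewrite le_max lexx orbT.
  rewrite opprB => h; apply: le_lt_trans (ler_wpM2l K0 h) _.
  rewrite mulrA ltr_pdivrMr ?ltr_wpDl// mulrC.
  have : e / 2 * (K + 1) < e * (K + 1) by rewrite ltr_pM2r ?ltr_wpDl//; lra.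
  have : K * (e / 2) <= (K + 1) * (e / 2) by rewrite ler_wpM2r ?lerDl// divr_ge0// ltW.
  by rewrite ![_ * (e / 2)]mulrC; lra.
have cv (g : R[i] -> R) : (forall x y, `|g x - g y| <= cmod (x - y)) ->
    exists l, (g (cint (attr_cut eta T)) @[T --> +oo] --> l) /\
      forall T, S <= T -> `|l - g (cint (attr_cut eta T))| <= K * T `^ (\tr E - 1).
  move=> gl.
  have cau : cvg (g (cint (attr_cut eta T)) @[T --> +oo]).
    apply/cauchy_cvgP/cauchy_exP => e e0; have [T ST Ke] := small e e0.
    exists (g (cint (attr_cut eta T))).
    have : \forall T' \near +oo, T < T' by apply: nbhs_pinfty_gt; exact: num_real.
    apply: (@filterS _ _ _ _ (fun T' => ball (g (cint (attr_cut eta T))) e (g (cint (attr_cut eta T'))))).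
    move=> T' TT; rewrite /= -ball_normE /= distrC.
    by apply: le_lt_trans (gl _ _) _; apply: le_lt_trans Ke; exact: HK.
  exists (lim (g (cint (attr_cut eta T)) @[T --> +oo])); split => // T ST.
  have cc : `|g (cint (attr_cut eta T')) - g (cint (attr_cut eta T))| @[T' --> +oo] -->
      `|lim (g (cint (attr_cut eta T)) @[T --> +oo]) - g (cint (attr_cut eta T))|.
    by apply: cvg_norm; apply: cvgB => //; exact: cvg_cst.
  rewrite -(cvg_lim _ cc)//; apply: limr_le; first exact: cvgP cc.
  have : \forall T' \near +oo, T < T' by apply: nbhs_pinfty_gt; exact: num_real.
  apply: filterS => T' TT; apply: le_trans (gl _ _) _; exact: HK.
have gR (x y : R[i]) : `|Re x - Re y| <= cmod (x - y) by rewrite -ReB; exact: Re_le_cmod.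
have gI (x y : R[i]) : `|Im x - Im y| <= cmod (x - y) by rewrite -ImB; exact: Im_le_cmod.
have [l1 [c1 h1]] := cv (fun z => Re z) gR; have [l2 [c2 h2]] := cv (fun z => Im z) gI.
exists (l1 +i* l2); split => // T ST.
apply: le_trans (cmod_le_ReIm _) _; rewrite ReB ImB -mulrA mulr_natl mulr2n.
by apply: lerD; [exact: h1|exact: h2].
Qed.

End attractor_limit.

(** * Comparison on the inner, middle and outer zones *)

Section imaginary_comparison.
Context {R : realType} {d : nat}.
Local Notation zv := 'rV[int]_d.
Local Notation rv := 'rV[R]_d.
Local Notation Re := complex.Re.
Local Notation Im := complex.Im.

Lemma strongly_subhomogeneous_sub (E : 'M[R]_d) l (f : rv -> R) :
  strongly_subhomogeneous E l f -> subhomogeneous E f.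
Proof.
move=> [ctr _ H]; split => // e e0 K cK; have [tau [tau0 Ht]] := H e e0 K cK.
exists tau; split => // t x t0 tt Kx.
by have := Ht t x 0%N t0 tt Kx isT; rewrite expr0 mul1r.
Qed.

Lemma curve_regular_le (Q : rv -> R) E (C : R) (a V : rv -> R) (T T' : R) : T <= T' ->
  curve_regular Q E C a V T' -> curve_regular Q E C a V T.
Proof.
move=> TT reg w /reg[a1 [v1 [v2 h]]]; exists a1, v1, v2 => s s0 sT.
by apply: h => //; exact: le_trans TT.
Qed.

Variables (phi : zv -> R[i]) (xi0 alpha : rv).
Hypothesis phiS : in_Sd phi.
Hypothesis sup1 : sup (range (fun xi => cmod (fourier phi xi))) = 1.
Hypothesis Om : Omega phi = [set xi0].
Variables (U : set rv) (Q Qt Rr Rt : rv -> R) (E : 'M[R]_d) (k : R).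
Local Notation N := (fun x : rv => `|Q x|).
Hypothesis dec : Gamma_decomp phi xi0 U alpha Q Qt Rr Rt.
Hypotheses (posN : pos_homogeneous N) (posR : pos_homogeneous Rr) (hN : Exp_set N E).
Hypotheses (k1 : 1 < k) (hR : Exp_set Rr (k^-1 *: E)).
Hypotheses (sQt : strongly_subhomogeneous E 2 Qt)
  (sRt : strongly_subhomogeneous (k^-1 *: E) 1 Rt).
Hypothesis p1 : \tr E < 1.

Let cQ : continuous Q. Proof. by case: dec => _ [/poly_no_low_continuous]. Qed.
Let cN : continuous N. Proof. by case: posN. Qed.
Let N0 x : 0 <= N x. Proof. exact: normr_ge0. Qed.
Let Neq0 x : N x = 0 <-> x = 0. Proof. by case: posN. Qed.
Let cpt : compact [set x | N x = 1]. Proof. by case: posN. Qed.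
Let ctr : contracting E. Proof. by case: sQt. Qed.
Let Qt0 : Qt 0 = 0. Proof. by case: dec => _ [_ [_ [[]]]]. Qed.
Let Rt0 : Rt 0 = 0. Proof. by case: dec => _ [_ [_ [_ [[]]]]]. Qed.
Let hQ : Exp_set Q E. Proof. exact: Exp_set_abs cQ hN. Qed.
Let mN : measurable_fun setT N. Proof. exact: continuous_measurable_rV. Qed.

Lemma imaginary_far : exists2 c : R, 0 < c & forall x, 1 <= N x -> `|x| ^+ 2 <= c * N x.
Proof.
have [_ [pQ _]] := dec; have [C HC] := poly_no_low_growth _ pQ.
exact: (gauge_quadratic_far N E cN N0 Neq0 cpt hN C HC).
Qed.

Lemma imaginary_nbhd : exists2 delta : R, 0 < delta & forall t, N t < delta -> U t /\ `|t| <= pi.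
Proof.
have [[oU U0 _] _] := dec.
have [r r0 Hr] := open_ball0 _ oU U0.
have m0 : 0 < Num.min r pi by rewrite lt_min r0 pi_gt0.
have [t1 t10 H1] := gauge_small _ _ N0 Neq0 cpt hN ctr _ m0.
exists t1 => // t /H1; rewrite le_min => /andP[a b].
by split => //; exact: Hr.
Qed.

Definition scaled_amplitude (n : nat) (z : rv) : R[i] :=
  amplitude phi xi0 alpha n (act (tpow (n%:R)^-1 E) z).
Local Notation F := scaled_amplitude.

Lemma cmeasurable_scaled_amplitude n : cmeasurable (F n).
Proof.
have [m1 m2] := cmeasurable_amplitude phi xi0 phiS alpha n.
by split; [exact: (measurableT_comp m1 (measurable_act _))|
           exact: (measurableT_comp m2 (measurable_act _))].
Qed.

Lemma cmod_scaled_amplitude_le1 n z : cmod (F n z) <= 1.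
Proof.
apply: le_trans (cmod_amplitude_le _ _ phiS sup1 Om _ _ _) _.
by case/andP: (pibox01 d (act (tpow (n%:R)^-1 E) z)).
Qed.

Section with_delta.
Variable delta : R.
Hypothesis delta0 : 0 < delta.
Hypothesis Hdelta : forall t, N t < delta -> U t /\ `|t| <= pi.

Lemma scaled_amplitudeE n z : (0 < n)%N -> N z < n%:R * delta ->
  F n z = (scaled_amp E Rr Rt n%:R z)%:C * iexp (- (Q z + scaled_phase E Qt n%:R z)).
Proof.
move=> n0 Nz; have n0' : 0 < n%:R :> R by rewrite ltr0n.
have ni : 0 < n%:R^-1 :> R by rewrite invr_gt0.
set t := act (tpow (n%:R)^-1 E) z.
have Nt : N t < delta.
  have -> : N t = n%:R^-1 * N z by exact: hN.
  by rewrite mulrC ltr_pdivrMr// mulrC.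
have [Ut tpi] := Hdelta _ Nt.
rewrite /F (amplitude_cexp _ _ _ _ _ _ _ _ _ _ dec)// -/t.
have Qz : n%:R * Q t = Q z by rewrite /t hQ// mulrA divff ?mul1r// gt_eqF.
rewrite /scaled_amp /scaled_phase -/t [n%:R * (Q t + Qt t)]mulrDr Qz /iexp.
apply: complex_ext; rewrite /cexp ?ReM ?ImM /= expR0 !mul1r ?mul0r ?subr0 ?addr0//.
Qed.

(** Since n^-E = (n^-k)^(E/k), n R(n^-E z) = n^(1-k) R(z), which tends to 0 because k > 1: damping
    disappears in the limit. The remainder [Rt] is compared with R, and [Qt] with |Q|. *)
Let scaled_cvg0 z :
  ((fun m => - (m.+1%:R * (Rr (act (tpow (m.+1%:R)^-1 E) z) +
      Rt (act (tpow (m.+1%:R)^-1 E) z)))) @ \oo --> (0 : R)) /\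
  ((fun m => - (m.+1%:R * Qt (act (tpow (m.+1%:R)^-1 E) z))) @ \oo --> (0 : R)).
Proof.
have [cR R0 Req0 _ cptR] := posR.
have iS m : 0 < (m.+1%:R)^-1 :> R by rewrite invr_gt0.
have sQ := strongly_subhomogeneous_sub _ _ _ sQt.
have sR := strongly_subhomogeneous_sub _ _ _ sRt.
have k0 : 0 < k by exact: lt_trans k1.
have RE m : Rr (act (tpow (m.+1%:R)^-1 E) z) = m.+1%:R `^ (- k) * Rr z.
  have h0 : 0 < m.+1%:R `^ (- k) :> R by rewrite powR_gt0.
  rewrite -(hR _ z h0) (tpowZ _ _ _ h0); congr (Rr (act (tpow _ E) z)).
  by rewrite -powRrM mulNr mulfV ?gt_eqF// powR_inv1.
have q0 : 0 < k - 1 by rewrite subr_gt0.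
have nk m : m.+1%:R * m.+1%:R `^ (- k) = m.+1%:R `^ (- (k - 1)) :> R.
  rewrite -[X in X * _ = _](powRr1) // -powRD; first by congr (_ `^ _); ring.
  by rewrite pnatr_eq0 implybT.
have nat_ge (T : R) m : (Num.truncn T <= m)%N -> T <= m.+1%:R.
  by move=> h; apply: le_trans (ltW (truncnS_gt _)) _; rewrite ler_nat.
split; apply/cvgrPdist_le => e e0.
- have [tau tau0 Ht] := gauge_subhom Rr _ R0 Req0 cptR hR Rt 1 sR Rt0 ltr01.
  (* The first entry brings R of the dilated point below tau, so that |Rt| <= R there; the second
     makes n times 2 R at most e. *)
  have e1 : 0 < Num.min (tau / (Rr z + 1)) (e / (2 * (Rr z + 1))).
    by rewrite lt_min !divr_gt0// ?mulr_gt0// ltr_wpDl.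
  have [T0 T00 HT] := powRN_small _ _ q0 e1.
  exists (Num.truncn T0) => // m /= /nat_ge /HT; rewrite -nk le_min => /andP[a b].
  have Rz : 0 < Rr z + 1 by rewrite ltr_wpDl.
  rewrite sub0r opprK RE.
  set q := m.+1%:R `^ (- k) in a b *.
  have qq0 : 0 < q by rewrite powR_gt0.
  have q_le : q <= m.+1%:R * q by rewrite ler_peMl ?ler1n// ltW.
  have small : q * Rr z < tau.
    apply: le_lt_trans (_ : tau / (Rr z + 1) * Rr z < _).
      by rewrite ler_wpM2r// (le_trans q_le).
    by rewrite mulrAC ltr_pdivrMr// ltr_pM2l// ltrDl.
  have := Ht (act (tpow (m.+1%:R)^-1 E) z); rewrite RE -/q mul1r => /(_ small) h.
  rewrite normrM (gtr0_norm (ltr0Sn _ _)).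
  apply: le_trans (_ : m.+1%:R * (2 * (q * Rr z)) <= _).
    rewrite ler_wpM2l//; apply: le_trans (ler_normD _ _) _.
    by rewrite (ger0_norm (mulr_ge0 (ltW qq0) (R0 z))); lra.
  rewrite (_ : _ * (2 * _) = m.+1%:R * q * (2 * Rr z)); last by ring.
  apply: le_trans (ler_wpM2r _ b) _; first by rewrite mulr_ge0.
  rewrite mulrAC ler_pdivrMr ?mulr_gt0// ler_wpM2l ?(ltW e0)// ler_wpM2l// lerDl//.
- have Nz : 0 < N z + 1 by rewrite ltr_wpDl.
  have e1 : 0 < e / (N z + 1) by rewrite divr_gt0.
  have [tau tau0 Ht] := gauge_subhom N E N0 Neq0 cpt hN Qt _ sQ Qt0 e1.
  exists (Num.truncn (N z / tau)) => // m /= mM.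
  have NE : N (act (tpow m.+1%:R^-1 E) z) = m.+1%:R^-1 * N z by exact: hN.
  have small : N (act (tpow m.+1%:R^-1 E) z) < tau.
    rewrite NE mulrC ltr_pdivrMr// mulrC -ltr_pdivrMr//.
    by apply: lt_le_trans (truncnS_gt _) _; rewrite ler_nat.
  have := Ht _ small; rewrite NE => h.
  rewrite sub0r opprK normrM (gtr0_norm (ltr0Sn _ _)).
  apply: le_trans (ler_wpM2l (ler0n _ _) h) _.
  rewrite mulrCA mulVKf ?pnatr_eq0// mulrAC ler_pdivrMr//.
  by rewrite ler_wpM2l ?(ltW e0)// lerDl.
Qed.

(** The wave exp(-i eta.z), of modulus 1, is left out, so convergence of its integral to 0 is
    uniform in eta. *)
Definition inner_error (T : R) (n : nat) (z : rv) : R :=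
  if N z < T then cmod (F n z - iexp (- Q z)) else 0.

Let miQ : cmeasurable (fun z => iexp (- Q z)).
Proof.
apply: cmeasurable_cexp; split; first exact: measurable_cst.
by apply: continuous_measurable_rV; exact: contN.
Qed.

Lemma measurable_inner_error T n : measurable_fun setT (inner_error T n).
Proof.
apply: measurable_fun_ifT; [exact: measurable_gauge_lt|apply: measurable_cmod|exact: measurable_cst].
by apply: cmeasurableB => //; exact: cmeasurable_scaled_amplitude.
Qed.

Lemma integrable_inner_error T n : lebd.-integrable setT (EFin \o inner_error T n).
Proof.
apply: (integrable_gauge_bounded N E cN N0 Neq0 cpt hN ctr T _ 2) => [||z].
- exact: measurable_inner_error.
- move=> z; rewrite /inner_error; case: ifP => _; last by rewrite normr0.
  rewrite ger0_norm ?cmod_ge0//; apply: le_trans (cmodB _ _) _.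
  by rewrite cmod_iexp; have := cmod_scaled_amplitude_le1 n z; lra.
- by rewrite /inner_error; case: ifP => [/ltW//|]; rewrite eqxx.
Qed.

Lemma inner_error_cvg0 T : (fun m => \int[lebd]_z inner_error T m.+1 z) @ \oo --> (0 : R).
Proof.
have Z : \int[lebd]_x (cst 0 : rv -> R) x = 0 by rewrite /Rintegral integral0_eq.
rewrite -[X in _ --> X]Z.
have mT : measurable_fun setT (fun z : rv => if N z < T then 2 else 0 : R).
  by apply: measurable_fun_ifT; [exact: measurable_gauge_lt|exact: measurable_cst|exact: measurable_cst].
apply: (Rintegral_dominated _ _ (fun z : rv => if N z < T then 2 else 0)).
- by move=> m; exact: measurable_inner_error.
- exact: measurable_cst.
- move=> z; have [ca cb] := scaled_cvg0 z.
  have c1 := cexpB1_cvg0 _ _ ca cb.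
  apply: (squeeze_cvgr _ (cvg_cst 0) c1).
  exists (Num.truncn (N z / delta)) => // m /= mM.
  have Nz : N z < m.+1%:R * delta.
    rewrite -ltr_pdivrMr//.
    by apply: lt_le_trans (truncnS_gt _) _; rewrite ler_nat.
  rewrite /inner_error; case: ifP => _; last by apply/andP; split => //; exact: cmod_ge0.
  apply/andP; split; first exact: cmod_ge0.
  rewrite (scaled_amplitudeE m.+1 z isT Nz).
  have -> : (scaled_amp E Rr Rt m.+1%:R z)%:C * iexp (- (Q z + scaled_phase E Qt m.+1%:R z)) =
     iexp (- Q z) * cexp ((- (m.+1%:R * (Rr (act (tpow (m.+1%:R)^-1 E) z) +
      Rt (act (tpow (m.+1%:R)^-1 E) z)))) +i* (- (m.+1%:R * Qt (act (tpow (m.+1%:R)^-1 E) z)))).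
    have e : (scaled_amp E Rr Rt m.+1%:R z)%:C = cexp ((- (m.+1%:R * (Rr (act (tpow (m.+1%:R)^-1 E) z) +
      Rt (act (tpow (m.+1%:R)^-1 E) z)))) +i* 0).
      by apply: complex_ext; rewrite /cexp /= ?cos0 ?sin0 ?mulr1 ?mulr0.
    rewrite e /iexp -!cexpD; congr cexp; apply: complex_ext; rewrite ?ReD ?ImD /=.
      by rewrite addr0 add0r.
    by rewrite /scaled_phase add0r opprD.
  by rewrite -[X in _ - X]mulr1 -mulrBr cmodM cmod_iexp mul1r.
- apply: (integrable_gauge_bounded N E cN N0 Neq0 cpt hN ctr T _ 2) => // z.
    by case: ifP => _; rewrite ?normr0// ger0_norm.
  by case: ifP => [/ltW//|]; rewrite eqxx.
- move=> m z; rewrite /inner_error; case: ifP => _; last by rewrite normr0.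
  rewrite ger0_norm ?cmod_ge0//; apply: le_trans (cmodB _ _) _.
  by rewrite cmod_iexp; have := cmod_scaled_amplitude_le1 m.+1 z; lra.
Qed.

Lemma cmeasurable_amplitude_wave n (eta : rv) :
  cmeasurable (fun z => F n z * iexp (- dotR eta z)).
Proof.
apply: cmeasurableM; first exact: cmeasurable_scaled_amplitude.
exact: cmeasurable_iexpN_dot.
Qed.

Let pibox_scaled n (z : rv) := pibox d (act (tpow (n%:R)^-1 E) z).

(** Here n^-E z is off the peak, so the amplitude is at most rho^n on the dilated cube, whose volume
    grows only like n^(tr E). *)
Lemma outer_error_le (n : nat) eta rho : (0 < n)%N -> 0 <= rho < 1 ->
  (forall t : rv, (forall i, `|t ord0 i| <= pi) -> ~ N t < delta ->
    cmod (fourier phi (t + xi0)) <= rho) ->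
  cmod (cint (fun z => if n%:R * delta <= N z then F n z * iexp (- dotR eta z) else 0)) <=
    2 * (rho ^+ n * (n%:R `^ (\tr E) * \int[lebd]_t pibox d (t : rv))).
Proof.
move=> n0 /andP[rho0 rho1] Hrho.
have n0' : 0 < n%:R :> R by rewrite ltr0n.
have ni : 0 < n%:R^-1 :> R by rewrite invr_gt0.
have I1 : lebd.-integrable setT (EFin \o pibox_scaled n).
  exact: (integrable_tpow _ E _ ni (integrable_pibox d)).
have e : n%:R `^ (\tr E) * \int[lebd]_t pibox d (t : rv) = \int[lebd]_z pibox_scaled n z.
  rewrite /pibox_scaled (Rintegral_tpow _ E _ ni (integrable_pibox d)); congr (_ * _).
  by rewrite -[_^-1]powR_inv1 ?ler0n// -powRrM mulN1r opprK.
rewrite e -RintegralZl//; apply: cmod_cint_le.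
- apply: cmeasurable_if; [exact: measurable_gauge_ge|exact: cmeasurable_amplitude_wave|exact: cmeasurable_cst].
- exact: (integrableZl measurableT (rho ^+ n) I1).
- move=> z; rewrite /pibox_scaled.
  have [q0 q1] := andP (pibox01 d (act (tpow n%:R^-1 E) z)).
  case: ifPn => Nz; last by rewrite cmod0 mulr_ge0// exprn_ge0.
  rewrite cmodM cmod_iexp mulr1 /F (cmod_amplitude _ _ Om).
  have [->|pn] := eqVneq (pibox d (act (tpow n%:R^-1 E) z)) 0; first by rewrite mul0r mulr0.
  rewrite mulrC ler_wpM2r// lerXn2r ?nnegrE ?cmod_ge0//.
  apply: Hrho; first exact: pibox_neq0.
  have NE : N (act (tpow n%:R^-1 E) z) = n%:R^-1 * N z by exact: hN.
  by apply/negP; rewrite -leNgt NE mulrC ler_pdivlMr// mulrC.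
Qed.

Lemma cmod_inner_le T n eta :
  cmod (cint (fun z => if N z < T then (F n z - iexp (- Q z)) * iexp (- dotR eta z) else 0)) <=
    2 * \int[lebd]_z inner_error T n z.
Proof.
apply: cmod_cint_le; last 2 first.
- exact: integrable_inner_error.
- move=> z; rewrite /inner_error; case: ifP => _; last by rewrite cmod0.
  by rewrite cmodM cmod_iexp mulr1.
apply: cmeasurable_if; [exact: measurable_gauge_lt| |exact: cmeasurable_cst].
apply: cmeasurableM; last exact: cmeasurable_iexpN_dot.
by apply: cmeasurableB => //; exact: cmeasurable_scaled_amplitude.
Qed.

(** Only the attractor truncated at T is subtracted, so the middle and outer terms involve the
    amplitude alone; the tail of the attractor is left to [attr_cut_cvg]. *)
Lemma cint_split n eta (T : R) : (0 < n)%N -> T < n%:R * delta ->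
  cint (fun z => F n z * iexp (- dotR eta z)) - cint (attr_cut Q eta T) =
  cint (fun z => if N z < T then (F n z - iexp (- Q z)) * iexp (- dotR eta z) else 0) +
  (cint (fun z => if T <= N z < n%:R * delta then F n z * iexp (- dotR eta z) else 0) +
  cint (fun z => if n%:R * delta <= N z then F n z * iexp (- dotR eta z) else 0)).
Proof.
move=> n0 Tn; have n0' : 0 < n%:R :> R by rewrite ltr0n.
have ni : 0 < n%:R^-1 :> R by rewrite invr_gt0.
have mF := cmeasurable_amplitude_wave n eta.
have iF : cintegrable (fun z => F n z * iexp (- dotR eta z)).
  apply: cintegrable_le (integrable_tpow _ E _ ni (integrable_pibox d)) _ => // z.
  by rewrite cmodM cmod_iexp mulr1 /F; apply: cmod_amplitude_le.
have iA := cintegrable_attr_cut Q E cQ cN Neq0 cpt hN ctr eta T.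
have i1 : cintegrable (fun z => if N z < T then (F n z - iexp (- Q z)) * iexp (- dotR eta z) else 0).
  apply: (cintegrable_gauge_bounded Q E cN Neq0 cpt hN ctr T 2).
  - apply: cmeasurable_if; [exact: measurable_gauge_lt| |exact: cmeasurable_cst].
    apply: cmeasurableM; last exact: cmeasurable_iexpN_dot.
    by apply: cmeasurableB => //; exact: cmeasurable_scaled_amplitude.
  - move=> z; case: ifP => _; last by rewrite cmod0.
    rewrite cmodM cmod_iexp mulr1; apply: le_trans (cmodB _ _) _.
    by rewrite cmod_iexp; have := cmod_scaled_amplitude_le1 n z; lra.
  - by move=> z; case: ifP => [/ltW//|]; rewrite eqxx.
have mmid : cmeasurable (fun z => if T <= N z < n%:R * delta then F n z * iexp (- dotR eta z) else 0).
  apply: cmeasurable_if; [|exact: mF|exact: cmeasurable_cst].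
  by apply: measurable_and; [exact: measurable_gauge_ge|exact: measurable_gauge_lt].
have i2 : cintegrable (fun z => if T <= N z < n%:R * delta then F n z * iexp (- dotR eta z) else 0).
  apply: (cintegrable_gauge_bounded Q E cN Neq0 cpt hN ctr (n%:R * delta) 1) => //.
  - move=> z; case: ifP => _; last by rewrite cmod0.
    by rewrite cmodM cmod_iexp mulr1; exact: cmod_scaled_amplitude_le1.
  - by move=> z; case: ifP => [/andP[_ /ltW]//|]; rewrite eqxx.
have i3 : cintegrable (fun z => if n%:R * delta <= N z then F n z * iexp (- dotR eta z) else 0).
  apply: cintegrable_le (integrable_tpow _ E _ ni (integrable_pibox d)) _.
    by apply: cmeasurable_if; [exact: measurable_gauge_ge|exact: mF|exact: cmeasurable_cst].
  move=> z; case: ifP => _; last by rewrite cmod0; case/andP: (pibox01 d (act (tpow n%:R^-1 E) z)).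
  by rewrite cmodM cmod_iexp mulr1 /F; apply: cmod_amplitude_le.
rewrite -cintB// -cintD// -cintD//; last exact: cintegrableD.
apply: eq_cint => z; rewrite /attr_cut.
have [zT|zT] := ltP (N z) T.
  rewrite (leNgt (n%:R * delta)) (lt_trans zT Tn) /= !addr0 mulrBl; congr (_ - _).
  by rewrite iexpD.
rewrite subr0 add0r /=; have [zn|zn] := ltP (N z) (n%:R * delta); first by rewrite addr0.
by rewrite add0r.
Qed.

End with_delta.

(** T is chosen first, so that the two oscillatory tails total at most e/2; then n, so that the
    inner and outer errors are at most e/4 each. Neither choice involves eta. *)
Lemma uniform_comparison (H e : R) : 0 <= H -> 0 < e ->
  exists n0 : nat, forall n : nat, (n0 <= n)%N -> forall eta : rv, `|eta| <= H ->
  exists l : R[i],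
    [/\ Re (cint (attr_cut Q eta T)) @[T --> +oo] --> Re l,
        Im (cint (attr_cut Q eta T)) @[T --> +oo] --> Im l &
        cmod (cint (fun z => F n z * iexp (- dotR eta z)) - l) <= e].
Proof.
move=> H0 e0.
have [c c0 far] := imaginary_far.
have [d1 d10 Hd1] := imaginary_nbhd.
have [d2 [C [d20 [C0 Hreg]]]] := amplitude_regular Q E cN Neq0 cpt hN ctr Qt Rr Rt k posR k1 hR sQt sRt.
(* d1 gives the exponential form of the amplitude, d2 its regularity along curves. *)
pose delta := Num.min d1 d2.
have delta0 : 0 < delta by rewrite lt_min d10.
have Hdelta t : N t < delta -> U t /\ `|t| <= pi by rewrite lt_min => /andP[/Hd1].
have [S1 [K1 [S10 [K10 HK1]]]] := cphase_tail Q E cQ cN Neq0 cpt hN ctr p1 c c0 far H C H0 C0.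
have [S2 [K2 [S20 [K20 HK2]]]] := attr_cut_cvg Q E cQ cN Neq0 cpt hN ctr p1 c c0 far H H0.
have q0 : 0 < 1 - \tr E by rewrite subr_gt0.
have KK : 0 < K1 + K2 + 1 by rewrite ltr_wpDl// addr_ge0.
have e1 : 0 < e / 2 / (K1 + K2 + 1) by rewrite !divr_gt0.
have [T0 T00 HT] := powRN_small _ _ q0 e1.
pose T := Num.max T0 (Num.max S1 S2).
have TT0 : T0 <= T by rewrite le_max lexx.
have TS1 : S1 <= T by rewrite !le_max lexx orbT.
have TS2 : S2 <= T by rewrite !le_max lexx !orbT.
have T_gt0 : 0 < T by exact: lt_le_trans TT0.
have tails : K1 * T `^ (\tr E - 1) + K2 * T `^ (\tr E - 1) <= e / 2.
  have := HT _ TT0; rewrite opprB => h; rewrite -mulrDl.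
  apply: le_trans (ler_wpM2l (addr_ge0 K10 K20) h) _.
  rewrite mulrA ler_pdivrMr// mulrC ler_wpM2l ?lerDl//.
  by rewrite divr_ge0// ltW.
have oV : open [set t | N t < delta].
  by apply: (@open_comp _ _ N [set y | y < delta]); [move=> x _; exact: cN|exact: open_lt].
have V0 : [set t | N t < delta] 0 by rewrite /= (Neq0 0).2.
have [rho r01 Hrho] := fourier_off_peak _ _ phiS sup1 Om _ oV V0.
set K := \int[lebd]_t pibox d (t : rv).
have K0 : 0 <= K by apply: Rintegral_ge0 => t _; case/andP: (pibox01 d t).
have e8 : 0 < e / (8 * (K + 1)) by rewrite divr_gt0// mulr_gt0// ltr_wpDl.
have [n1 Hn1] := geometric_le_powR rho (\tr E) _ r01 e8.
have e8' : 0 < e / 8 by rewrite divr_gt0.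
have := inner_error_cvg0 delta delta0 Hdelta T => /cvgrPdist_le /(_ _ e8') [n2 _ Hn2].
(* The last summand ensures T < n delta, so that the middle zone is a genuine interval of levels. *)
exists (n1 + n2 + Num.truncn (T / delta)).+1 => -[//|n] nN eta eH.
have n0' : 0 < n.+1%:R :> R by rewrite ltr0n.
have [l [cr ci Hl]] := HK2 eta eH; exists l; split => //.
have Tn : T < n.+1%:R * delta.
  rewrite -ltr_pdivrMr//; apply: lt_le_trans (truncnS_gt _) _; rewrite ler_nat.
  by apply: leq_trans nN; rewrite ltnS leq_addl.
have := cint_split delta n.+1 eta T isT Tn.
set J := cint _; set A := cint (attr_cut _ _ _); set I1 := cint _; set I2 := cint _; set I3 := cint _ => eJ.
have -> : J - l = I1 + (I2 + I3) - (l - A) by rewrite -eJ opprB addrA subrK.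
apply: le_trans (cmodB _ _) _; have h4 := Hl T TS2.
have h1 : cmod I1 <= e / 4.
  apply: le_trans (cmod_inner_le _ _ _) _.
  have nn2 : (n2 <= n)%N.
    by move: nN; rewrite ltnS; apply: leq_trans; rewrite -addnA addnCA leq_addr.
  have := Hn2 n nn2; rewrite /= sub0r normrN => h; have := le_trans (ler_norm _) h; lra.
have h2 : cmod I2 <= K1 * T `^ (\tr E - 1).
  apply: (HK1 eta T (n.+1%:R * delta) (scaled_amp E Rr Rt n.+1%:R) (scaled_phase E Qt n.+1%:R)) => //.
  - apply: cmeasurable_if; [|exact: cmeasurable_amplitude_wave|exact: cmeasurable_cst].
    by apply: measurable_and; [exact: measurable_gauge_ge|exact: measurable_gauge_lt].
  - move=> z; case: ifP => // /andP[_ zn].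
    by rewrite (scaled_amplitudeE delta Hdelta n.+1 z isT zn) -mulrA -iexpD.
  - apply: curve_regular_le (Hreg _ n0'); rewrite ler_wpM2l//.
    by rewrite ge_min lexx orbT.
have h3 : cmod I3 <= e / 4.
  apply: le_trans (outer_error_le delta n.+1 eta rho isT r01 Hrho) _.
  have nn1 : (n1 <= n.+1)%N by apply: leq_trans (ltnW nN); rewrite -addnA leq_addr.
  have := Hn1 _ nn1; rewrite powRN; set q := n.+1%:R `^ \tr E => h.
  have qp : 0 < q by rewrite powR_gt0.
  rewrite mulrA; apply: le_trans (_ : 2 * (e / (8 * (K + 1)) / q) * (q * K) <= _).
    by rewrite ler_wpM2r ?mulr_ge0 ?(ltW qp)// ler_wpM2l.
  rewrite (_ : 2 * _ * _ = e / 4 * (K / (K + 1))).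
    by rewrite ler_piMr ?divr_ge0 ?(ltW e0)// ler_pdivrMr ?ltr_wpDl// mul1r lerDl.
  by field; rewrite !gt_eqF// ltr_wpDl.
have := cmodD I1 (I2 + I3); have := cmodD I2 I3; lra.
Qed.

End imaginary_comparison.

(** * Return to the original scale *)

Section imaginary_local_limit.
Context {R : realType} {d : nat}.
Local Notation zv := 'rV[int]_d.
Local Notation rv := 'rV[R]_d.
Local Notation Re := complex.Re.
Local Notation Im := complex.Im.

(* n^E' n^-E preserves |Q|, hence stays bounded, even if E' differs from E. *)
Lemma dual_scaling_bounded (Q : rv -> R) (E E' : 'M[R]_d) (M : R) :
  pos_homogeneous (fun x => `|Q x|) -> contracting E -> 0 <= M ->
  Exp_set (fun x => `|Q x|) E -> Exp_set Q E' ->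
  exists2 H : R, 0 <= H & forall (n : R) (eta : rv), 0 < n -> `|eta| <= M ->
    `|act (tpow n^-1 E)^T (act (tpow n E'^T) eta)| <= H.
Proof.
move=> [cN N0 Neq0 _ cpt] ctr M0 hE hE'.
(* The value of |Q| at n^E' n^-E e_j is |Q(e_j)|, and b bounds these for all j at once. *)
pose b := \sum_j `|Q (basis_vec j)|.
have [L L0 HL] := gauge_le_bounded _ E N0 Neq0 cpt hE ctr b.
exists (d%:R * M * L) => [|n eta n0 eM]; first by rewrite !mulr_ge0// ltW.
apply: rV_norm_le => [|j]; first by rewrite !mulr_ge0// ltW.
have dot_basis (x : rv) : x ord0 j = dotR x (basis_vec j).
  rewrite /dotR (bigD1 j)//= big1 ?addr0 => [|i ij]; first by rewrite mxE !eqxx mulr1.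
  by rewrite mxE (negbTE ij) andbF mulr0.
rewrite dot_basis dotR_act tpow_tr dotR_act.
apply: le_trans (dotR_norm _ _) _; apply: ler_pM; rewrite ?mulr_ge0//.
  by rewrite ler_wpM2l.
apply: HL; rewrite hE'// normrM (gtr0_norm n0).
have -> : `|Q (act (tpow n^-1 E) (basis_vec j))| = n^-1 * `|Q (basis_vec j)|.
  by apply: hE; rewrite invr_gt0.
rewrite mulVKf ?gt_eqF// /b (bigD1 j)//= lerDl; exact: sumr_ge0.
Qed.

Variables (phi : zv -> R[i]) (xi0 alpha : rv).
Hypothesis phiS : in_Sd phi.
Hypothesis sup1 : sup (range (fun xi => cmod (fourier phi xi))) = 1.
Hypothesis Om : Omega phi = [set xi0].
Variables (U : set rv) (Q Qt Rr Rt : rv -> R) (E : 'M[R]_d) (k : R).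
Local Notation N := (fun x : rv => `|Q x|).
Hypothesis dec : Gamma_decomp phi xi0 U alpha Q Qt Rr Rt.
Hypotheses (posN : pos_homogeneous N) (posR : pos_homogeneous Rr) (hN : Exp_set N E).
Hypotheses (k1 : 1 < k) (hR : Exp_set Rr (k^-1 *: E)).
Hypotheses (sQt : strongly_subhomogeneous E 2 Qt)
  (sRt : strongly_subhomogeneous (k^-1 *: E) 1 Rt).
Hypothesis p1 : \tr E < 1.

Let cQ : continuous Q. Proof. by case: dec => _ [/poly_no_low_continuous]. Qed.
Let cN : continuous N. Proof. by case: posN. Qed.
Let Neq0 x : N x = 0 <-> x = 0. Proof. by case: posN. Qed.
Let cpt : compact [set x | N x = 1]. Proof. by case: posN. Qed.
Let ctr : contracting E. Proof. by case: sQt. Qed.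
Let hQ : Exp_set Q E. Proof. exact: Exp_set_abs cQ hN. Qed.

Definition attr_trunc (n : R) (y : rv) (tau : R) (xi : rv) : R[i] :=
  if `|Q xi| < tau then cexp (0 +i* (- (n * Q xi) - dotR y xi)) else 0.

Lemma cintegrable_attr_trunc n y tau : cintegrable (attr_trunc n y tau).
Proof.
apply: (cintegrable_gauge_bounded Q E cN Neq0 cpt hN ctr tau 1).
- apply: cmeasurable_if; [exact: measurable_gauge_lt| |exact: cmeasurable_cst].
  apply: cmeasurable_cexp; split; first exact: measurable_cst.
  apply: continuous_measurable_rV; apply: contB; last exact: continuous_dotR.
  by apply: contN; apply: contM; [exact: cont_cst|exact: cQ].
- by move=> z; rewrite /attr_trunc; case: ifP => _; rewrite ?cmod_iexp ?cmod0.
- by move=> z; rewrite /attr_trunc; case: ifP => [/ltW//|]; rewrite eqxx.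
Qed.

(** Dilation by n^-E removes the time: the level tau becomes n tau, the transpose of n^-E acts on y,
    and the Jacobian gives n^(-tr E). *)
Lemma cint_attr_trunc (n : R) y tau : 0 < n ->
  cint (attr_trunc n y tau) =
  (n `^ (- \tr E))%:C * cint (attr_cut Q (act (tpow n^-1 E)^T y) (n * tau)).
Proof.
move=> n0; have ni : 0 < n^-1 by rewrite invr_gt0.
have -> : cint (attr_cut Q (act (tpow n^-1 E)^T y) (n * tau)) =
    cint (fun z => attr_trunc n y tau (act (tpow n^-1 E) z)).
  apply: eq_cint => z; rewrite /attr_cut /attr_trunc.
  have -> : `|Q (act (tpow n^-1 E) z)| = n^-1 * `|Q z| by exact: hN.
  rewrite ltr_pdivrMl// hQ// mulVKf ?gt_eqF// dotR_act.
  by [].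
rewrite (cint_tpow n^-1 E _ ni (cintegrable_attr_trunc n y tau)) mulrA -rmorphM/=.
have -> : n^-1 `^ (- \tr E) = n `^ (\tr E).
  by rewrite -[n^-1]powR_inv1 ?(ltW n0)// -powRrM mulN1r opprK.
rewrite -powRD; last by rewrite lt0r_neq0 ?implybT.
by rewrite addNr powRr0 mul1r.
Qed.

(** As tau grows, so does n tau; hence the limits in the definition exist and are rescaled limits of
    [attr_cut]. This rules out the default value of [lim]. *)
Lemma H_attr_imagE (n : R) y (l : R[i]) : 0 < n ->
  Re (cint (attr_cut Q (act (tpow n^-1 E)^T y) T)) @[T --> +oo] --> Re l ->
  Im (cint (attr_cut Q (act (tpow n^-1 E)^T y) T)) @[T --> +oo] --> Im l ->
  H_attr_imag Q n y = ((2 * pi) ^- d)%:C * ((n `^ (- \tr E))%:C * l).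
Proof.
move=> n0 cr ci; rewrite /H_attr_imag; congr (_ * _).
have cn : n * T @[T --> +oo] --> +oo by exact: gt0_cvgMry.
have eR tau : intRd (fun xi => Re (attr_trunc n y tau xi)) = n `^ (- \tr E) *
    Re (cint (attr_cut Q (act (tpow n^-1 E)^T y) (n * tau))).
  have := cintRdE _ (cintegrable_attr_trunc n y tau); rewrite cint_attr_trunc//.
  by move=> /(congr1 (fun z => Re z)); rewrite ReM /= mul0r subr0.
have eI tau : intRd (fun xi => Im (attr_trunc n y tau xi)) = n `^ (- \tr E) *
    Im (cint (attr_cut Q (act (tpow n^-1 E)^T y) (n * tau))).
  have := cintRdE _ (cintegrable_attr_trunc n y tau); rewrite cint_attr_trunc//.
  by move=> /(congr1 (fun z => Im z)); rewrite ImM /= mul0r addr0.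
have hr : intRd (fun xi => Re (attr_trunc n y tau xi)) @[tau --> +oo] --> n `^ (- \tr E) * Re l.
  under eq_fun do rewrite eR; apply: cvgM; first exact: cvg_cst.
  exact: (cvg_comp _ _ cn cr).
have hi : intRd (fun xi => Im (attr_trunc n y tau xi)) @[tau --> +oo] --> n `^ (- \tr E) * Im l.
  under eq_fun do rewrite eI; apply: cvgM; first exact: cvg_cst.
  exact: (cvg_comp _ _ cn ci).
apply: complex_ext; rewrite ?ReM ?ImM /= mul0r ?subr0 ?addr0.
  exact: cvg_lim hr.
exact: cvg_lim hi.
Qed.

Theorem imaginary_local_limit (K : set rv) (E' : 'M[R]_d) (eps : R) :
  compact K -> Exp_set Q E' -> 0 < eps ->
  exists n0 : nat, forall n : nat, (n0 <= n)%N -> forall (x : zv) (eta : rv), K eta ->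
    zR x = n%:R *: alpha + act (tpow n%:R E'^T) eta ->
    cmod (convpow phi n x
      - fourier phi xi0 ^+ n * cexp (0 +i* (- dotR (zR x) xi0))
        * H_attr_imag Q n%:R (zR x - n%:R *: alpha)) <= eps * n%:R `^ (- \tr E).
Proof.
move=> cK hE' eps0.
have [M M0 HM] := compact_bound _ cK.
have [H H0 HH] := dual_scaling_bounded Q E E' M posN ctr (ltW M0) hN hE'.
pose c : R := (2 * pi) ^- d.
have c0 : 0 < c by rewrite invr_gt0 exprn_gt0// mulr_gt0// pi_gt0.
have e1 : 0 < eps / c by rewrite divr_gt0.
have [n0 Hn0] := uniform_comparison phi xi0 alpha phiS sup1 Om U Q Qt Rr Rt E k dec
  posN posR hN k1 hR sQt sRt p1 H _ H0 e1.
(* The shift guarantees n >= 1, as the dilations and [convpow_repr] require. *)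
exists n0.+1 => -[//|m]; set n := m.+1 => nN x eta Keta xE.
set y := zR x - _.
have yE : y = act (tpow n%:R E'^T) eta by rewrite /y xE addrC addKr.
have nn : (n0 <= n)%N by exact: ltnW.
have n_gt0 : 0 < n%:R :> R by rewrite ltr0n.
have ni : 0 < n%:R^-1 :> R by rewrite invr_gt0.
have eH : `|act (tpow n%:R^-1 E)^T y| <= H by rewrite yE; apply: HH => //; exact: HM.
have [l [cr ci le]] := Hn0 n nn _ eH.
rewrite (H_attr_imagE _ _ _ n_gt0 cr ci).
rewrite (convpow_repr _ _ phiS sup1 Om alpha)// -/y -/c -mulrBr -mulrBr.
have iA := cintegrable_amplitude phi xi0 phiS sup1 Om alpha n y.
have -> : cint (fun t => amplitude phi xi0 alpha n t * iexp (- dotR y t)) =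
    (n%:R `^ (- \tr E))%:C * cint (fun z => scaled_amplitude phi xi0 alpha E n z *
       iexp (- dotR (act (tpow n%:R^-1 E)^T y) z)).
  have -> : (fun z => scaled_amplitude phi xi0 alpha E n z *
       iexp (- dotR (act (tpow n%:R^-1 E)^T y) z)) =
     fun z => (fun t => amplitude phi xi0 alpha n t * iexp (- dotR y t)) (act (tpow n%:R^-1 E) z).
    by apply/funext => z; rewrite dotR_act.
  rewrite (cint_tpow n%:R^-1 E _ ni iA) mulrA -rmorphM/=.
  have -> : n%:R^-1 `^ (- \tr E) = n%:R `^ (\tr E) :> R.
    by rewrite -[n%:R^-1]powR_inv1 ?(ltW n_gt0)// -powRrM mulN1r opprK.
  rewrite -powRD; last by rewrite lt0r_neq0 ?implybT.
by rewrite addNr powRr0 mul1r.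
rewrite -mulrBr -/(iexp _) !cmodM cmodX (cmod_fourier_xi0 _ _ Om) expr1n cmod_iexp !mul1r.
rewrite !cmod_real (gtr0_norm c0) (ger0_norm (powR_ge0 _ _)).
rewrite mulrCA mulrC ler_wpM2r ?powR_ge0//.
apply: le_trans (ler_wpM2l (ltW c0) le) _.
by rewrite mulrCA divff ?mulr1// gt_eqF.
Qed.

End imaginary_local_limit.

(** mu is the trace of the exponent witnessing the type, while (2) describes the range of x by any
    exponent of Q; [dual_scaling_bounded] reconciles the two. *)
Theorem theorem1 (R : realType) (d : nat) (phi : 'rV[int]_d -> R[i])
    (xi0 : 'rV[R]_d) :
  in_Sd phi ->
  sup (range (fun xi => cmod (fourier phi xi))) = 1 ->
  Omega phi = [set xi0] ->
  (* (1) positive homogeneous type *)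
  (forall (alpha : 'rV[R]_d) (P : 'rV[R]_d -> R[i]) (mu : R),
     positive_type phi xi0 alpha P mu ->
     forall eps : R, 0 < eps ->
     exists N : nat, forall n : nat, (N <= n)%N ->
     forall x : 'rV[int]_d,
       cmod (convpow phi n x
             - fourier phi xi0 ^+ n * cexp (0 +i* (- dotR (zR x) xi0))
               * H_attr P n%:R (zR x - n%:R *: alpha))
       <= eps * n%:R `^ (- mu)) /\
  (* (2) imaginary homogeneous type, with mu < 1 *)
  (forall (alpha : 'rV[R]_d) (Q : 'rV[R]_d -> R) (mu : R),
     imaginary_type phi xi0 alpha Q mu -> mu < 1 ->
     forall K : set 'rV[R]_d, compact K ->
     forall E : 'M[R]_d, Exp_set Q E ->
     forall eps : R, 0 < eps ->
     exists N : nat, forall n : nat, (N <= n)%N ->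
     forall (x : 'rV[int]_d) (eta : 'rV[R]_d), K eta ->
       zR x = n%:R *: alpha + act (tpow n%:R E^T) eta ->
       cmod (convpow phi n x
             - fourier phi xi0 ^+ n * cexp (0 +i* (- dotR (zR x) xi0))
               * H_attr_imag Q n%:R (zR x - n%:R *: alpha))
       <= eps * n%:R `^ (- mu)).
Proof.
move=> phiS sup1 Om; split.
- move=> alpha P mu [U [Q [Qt [Rr [Rt [E [dec [posR [hR [_ [sQt [sRt [PE ->]]]]]]]]]]]]].
  exact: (positive_local_limit phi xi0 alpha phiS sup1 Om U Q Qt Rr Rt E dec posR hR sQt sRt P PE).
- move=> alpha _ mu [U [Q [Qt [Rr [Rt [E [k [dec [posN [posR [hN [k1 [hR [sQt [sRt [-> ->]]]]]]]]]]]]]]]].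
  move=> p1 K cK E' hE' eps eps0.
  exact: (imaginary_local_limit phi xi0 alpha phiS sup1 Om U Q Qt Rr Rt E k dec
    posN posR hN k1 hR sQt sRt p1 K E' eps cK hE' eps0).
Qed.
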